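(* Let Assumption (C) (see context) hold for the data $(\varphi,b,\sigma,h)$ and the parameter $\mu$, and let $\mu,\lambda\in\mathbb{R}$ satisfy $\mu>\rho_{b,\sigma;x,u}$ and $\lambda\ge2\mu$. Let $\hat u(\cdot)\in\mathcal{U}_{-\mu}$ be a control process with state process $\hat X:=X^{\hat u}$, and let $(\hat Y,\hat Z)\in\mathcal{M}^{2,-\mu}_{\mathbb{F}}(0,\infty;\mathbb{R}^n\times\mathbb{R}^{n\times d})$ be the adapted M-solution of the adjoint equation $$\hat Y(t)=h_x(t)+\int_t^\infty e^{-\lambda(s-t)}\Bigl\{b_x(s,t)^\top\hat Y(s)+\sum_{k=1}^d\sigma^k_x(s,t)^\top\hat Z^k(s,t)\Bigr\}ds-\int_t^\infty\hat Z(t,s)\,dW(s),\quad t\ge0.$$ Assume that the function $$\mathbb{R}^n\times U\ni(x,u)\mapsto H_\lambda\bigl(t,x,u,\mathbb{E}_t[\hat Y(\cdot)],\hat Z(\cdot,t)\bigr)\in\mathbb{R}$$ is convex for a.e. $t\ge0$, a.s., and that, for a.e. $t\ge0$, a.s., $$\bigl\langle\partial_uH_\lambda\bigl(t,\hat X(t),\hat u(t),\mathbb{E}_t[\hat Y(\cdot)],\hat Z(\cdot,t)\bigr),\,u-\hat u(t)\bigr\rangle\ge0\quad\text{for all }u\in U.$$ Then $\hat u(\cdot)$ is optimal, i.e. $J_\lambda(\hat u(\cdot))=\inf_{u(\cdot)\in\mathcal{U}_{-\mu}}J_\lambda(u(\cdot))$.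
   Context: $(\Omega,\mathcal{F},\mathbb{P})$ is a complete probability space with a $d$-dimensional Brownian motion $W=(W_1,\dots,W_d)^\top$; $\mathbb{F}=(\mathcal{F}_t)_{t\ge0}$ is the $\mathbb{P}$-augmented filtration generated by $W$; $\mathbb{E}_t[\cdot]=\mathbb{E}[\cdot|\mathcal{F}_t]$. Matrices carry the Frobenius norm $|\cdot|$. For $z\in\mathbb{R}^{n\times d}$, $z^k$ is the $k$-th column, and $\int z\,dW=\sum_{k=1}^d\int z^k\,dW_k$. $\Delta^{\mathrm{c}}[0,\infty)=\{(t,s):0\le s\le t<\infty\}$. Gradients of scalar functions are column vectors; the derivative of an $\mathbb{R}^{d_2}$-valued function on $\mathbb{R}^{d_1}$ is a $d_2\times d_1$ matrix. For $p\in\{1,2\}$, $L^{p,*}(0,\infty;\mathbb{R}_+)$ is the set of measurable $f:[0,\infty)\to\mathbb{R}_+$ such that $\int_0^\infty e^{p\beta t}f(t)^p\,dt<\infty$ for some $\beta\in\mathbb{R}$; for such $f$ and $\rho\in\mathbb{R}$, $[f]_p(\rho):=\bigl(\int_0^\infty e^{-p\rho t}f(t)^p\,dt\bigr)^{1/p}\in[0,\infty]$. For $\beta\in\mathbb{R}$ and a nonempty Borel subset $V$ of a Euclidean space, $L^{2,\beta}_{\mathbb{F}}(0,\infty;V)$ is the set of measurable adapted $V$-valued processes $f$ on $[0,\infty)$ with $\mathbb{E}\int_0^\infty e^{2\beta t}|f(t)|^2dt<\infty$; $\mathscr{L}^{2,\beta}_{\mathbb{F}}(0,\infty;\mathbb{R}^{n\times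 d})$ is the set of $\mathcal{F}\otimes\mathcal{B}([0,\infty)^2)$-measurable $f:\Omega\times[0,\infty)^2\to\mathbb{R}^{n\times d}$ such that $f(t,\cdot)$ is adapted for a.e. $t$ and $\mathbb{E}\int_0^\infty e^{2\beta t}\int_0^\infty|f(t,s)|^2ds\,dt<\infty$. $\mathcal{M}^{2,\beta}_{\mathbb{F}}(0,\infty;\mathbb{R}^n\times\mathbb{R}^{n\times d})$ is the set of $(y,z)\in L^{2,\beta}_{\mathbb{F}}(0,\infty;\mathbb{R}^n)\times\mathscr{L}^{2,\beta}_{\mathbb{F}}(0,\infty;\mathbb{R}^{n\times d})$ with $y(t)=\mathbb{E}[y(t)]+\int_0^tz(t,s)\,dW(s)$ for a.e. $t\ge0$, a.s. The adapted M-solution of the adjoint equation is the pair in $\mathcal{M}^{2,-\mu}_{\mathbb{F}}$ satisfying it for a.e. $t\ge0$, a.s.; under the hypotheses of the claim it exists and is unique. Control problem. $U\subset\mathbb{R}^\ell$ is a convex body (convex with nonempty interior) and $\mathcal{U}_{-\mu}:=L^{2,-\mu}_{\mathbb{F}}(0,\infty;U)$. For $u(\cdot)\in\mathcal{U}_{-\mu}$ the state process $X^u$ is the unique solution in $L^{2,-\mu}_{\mathbb{F}}(0,\infty;\mathbb{R}^n)$ (equality for a.e. $t\ge0$, a.s.) of $$X^u(t)=\varphi(t)+\int_0^tb(t,s,X^u(s),u(s))\,ds+\int_0^t\sigma(t,s,X^u(s),u(s))\,dW(s),\quad t\ge0,$$ and $J_\lambda(u(\cdot)):=\mathbb{E}\int_0^\infty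 e^{-\lambda t}h(t,X^u(t),u(t))\,dt$. Assumption (C): (i) $\varphi\in L^{2,-\mu}_{\mathbb{F}}(0,\infty;\mathbb{R}^n)$. (ii) The deterministic maps $b:\Delta^{\mathrm{c}}[0,\infty)\times\mathbb{R}^n\times\mathbb{R}^\ell\to\mathbb{R}^n$ and $\sigma:\Delta^{\mathrm{c}}[0,\infty)\times\mathbb{R}^n\times\mathbb{R}^\ell\to\mathbb{R}^{n\times d}$ are measurable, continuously differentiable in $(x,u)$ for a.e. $(t,s)$, and there exist $K_{b,x},K_{b,u}\in L^{1,*}(0,\infty;\mathbb{R}_+)$, $K_{\sigma,x},K_{\sigma,u}\in L^{2,*}(0,\infty;\mathbb{R}_+)$ with $|b(t,s,x,u)-b(t,s,x',u')|\le K_{b,x}(t-s)|x-x'|+K_{b,u}(t-s)|u-u'|$ and $|\sigma(t,s,x,u)-\sigma(t,s,x',u')|\le K_{\sigma,x}(t-s)|x-x'|+K_{\sigma,u}(t-s)|u-u'|$ for all $x,x',u,u'$ and a.e. $(t,s)\in\Delta^{\mathrm{c}}[0,\infty)$; $b(t,s,0,0)=0$ and $\sigma(t,s,0,0)=0$ for a.e. $(t,s)$. (iii) $h:[0,\infty)\times\mathbb{R}^n\times\mathbb{R}^\ell\to\mathbb{R}$ is measurable, $h(t,\cdot,\cdot)$ is continuously differentiable for a.e. $t$, and there is $C>0$ with $|h(t,x,u)|\le C(1+|x|^2+|u|^2)$, $|\partial_xh(t,x,u)|\le C(1+|x|+|u|)$, $|\partial_uh(t,x,u)|\le C(1+|x|+|u|)$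 for all $(x,u)$ and a.e. $t\ge0$. $\rho_{b,\sigma;x,u}:=\inf\{\rho\in\mathbb{R}_+:[K_{b,u}]_1(\rho)+[K_{\sigma,u}]_2(\rho)<\infty,\ [K_{b,x}]_1(\rho)+[K_{\sigma,x}]_2(\rho)\le1\}$. Notation: $b_x(t,s):=\partial_xb(t,s,\hat X(s),\hat u(s))$, $\sigma^k_x(t,s):=\partial_x\sigma^k(t,s,\hat X(s),\hat u(s))$ for $(t,s)\in\Delta^{\mathrm{c}}[0,\infty)$ ($\sigma^k$ the $k$-th column of $\sigma$), and $h_x(t):=\partial_xh(t,\hat X(t),\hat u(t))$. Hamiltonian: for $t\ge0$, $x\in\mathbb{R}^n$, $u\in U$ and deterministic functions $p(\cdot)$ ($\mathbb{R}^n$-valued) and $q(\cdot)$ ($\mathbb{R}^{n\times d}$-valued), with $\int_0^\infty e^{-2\mu s}(|p(s)|^2+|q(s)|^2)ds<\infty$, $$H_\lambda(t,x,u,p(\cdot),q(\cdot)):=h(t,x,u)+\int_t^\infty e^{-\lambda(s-t)}\Bigl\{\langle b(s,t,x,u),p(s)\rangle+\sum_{k=1}^d\langle\sigma^k(s,t,x,u),q^k(s)\rangle\Bigr\}ds,$$ so that $\partial_uH_\lambda(t,x,u,p,q)=\partial_uh(t,x,u)+\int_t^\infty e^{-\lambda(s-t)}\{\partial_ub(s,t,x,u)^\top p(s)+\sum_k\partial_u\sigma^k(s,t,x,u)^\top q^k(s)\}ds$. In the claim it is evaluated at $p(s)=\mathbb{E}_t[\hat Y(s)]$, $q(s)=\hat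 Z(s,t)$, $s\ge t$. *)

(* Defs.v *)
From HB Require Import structures.
From mathcomp Require Import all_boot all_order all_algebra.
From mathcomp Require Import all_classical all_reals all_analysis.
Set Implicit Arguments.
Unset Strict Implicit.
Unset Printing Implicit Defensive.
Import Order.TTheory GRing.Theory Num.Theory.
Import numFieldNormedType.Exports.
Local Open Scope classical_set_scope.
Local Open Scope ring_scope.

(* Vectors of R^n are columns 'cV[R]_n.  Measurability of matrix-valued maps
   is measurability of every entry, and R^n carries, as the source of a
   measurable map, the product sigma-algebra of n.-tuple R. *)

Section euclidean.
Context {R : realType}.

(* The norm `|A| of the library is the sup norm. *)
Definition fnorm m n (A : 'M[R]_(m, n)) : R :=
  Num.sqrt (\sum_i \sum_j A i j ^+ 2).

Definition dotv n (x y : 'cV[R]_n) : R := \sum_i x i 0 * y i 0.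

Definition vec_of_tuple n (x : n.-tuple R) : 'cV[R]_n := \col_i tnth x i.

Definition grad n (f : 'cV[R]_n -> R) (x : 'cV[R]_n) : 'cV[R]_n :=
  \col_j ('D_(delta_mx j 0) (f : 'cV[R]_n -> R^o) x).

(* The library's jacobian is for row vectors, hence the transpose of this. *)
Definition dmx m n (f : 'cV[R]_n -> 'cV[R]_m) (x : 'cV[R]_n) : 'M[R]_(m, n) :=
  \matrix_(i, j) (('D_(delta_mx j 0) f x) i 0).

Definition C1 (V W : normedModType R) (f : V -> W) : Prop :=
  (forall z, differentiable f z) /\ (forall v, continuous (fun z => 'd f z v)).

Definition convex_body n (U : set 'cV[R]_n) : Prop :=
  convex_set (U : set (convex_lmodType 'cV[R]_n)) /\ interior U !=set0.

End euclidean.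

Section weights.
Context {R : realType}.
Notation leb := (@lebesgue_measure R).

Definition halfline : set (measurableTypeR R) := `[0%R, +oo[%classic.

Definition Lstar (p : nat) (f : R -> R) : Prop :=
  [/\ measurable_fun halfline f,
      forall t, 0 <= t -> 0 <= f t &
      exists beta : R, (\int[leb]_(t in halfline)
        (expR (p%:R * beta * t) * f t ^+ p)%:E < +oo)%E].

Definition bracket (p : nat) (f : R -> R) (rho : R) : \bar R :=
  poweR (\int[leb]_(t in halfline)
          (expR (- (p%:R * rho * t)) * f t ^+ p)%:E)%E
        (p%:R)^-1.

Definition rho_bsigma (Kbx Kbu Ksx Ksu : R -> R) : \bar R :=
  ereal_inf [set rho%:E | rho in [set rho : R |
    [/\ 0 <= rho,
        (bracket 1 Kbu rho + bracket 2 Ksu rho < +oo)%E &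
        (bracket 1 Kbx rho + bracket 2 Ksx rho <= 1)%E]]].

Definition vint n (D : set R) (f : R -> 'cV[R]_n) : 'cV[R]_n :=
  \col_i \int[leb]_(s in D) f s i 0.

End weights.

Section stochastic.
Context {R : realType} {disp : measure_display} {T : measurableType disp}.
Variable P : probability T R.
Notation leb := (@lebesgue_measure R).

(* Processes take the sample point first: f w t, or f w t s. *)

Section brownian.
Context {d : nat}.
Variable W : T -> R -> 'cV[R]_d.

Definition natural_events (t : R) : set (set T) :=
  [set A | exists s i B, [/\ 0 <= s <= t, measurable B &
                             A = (fun w => W w s i 0) @^-1` B]].

Definition natural_filtration (t : R) : set (set T) := <<s natural_events t >>.

Definition aug_filtration (t : R) : set (set T) :=
  <<s natural_events t `|` [set A | P.-negligible A] >>.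

(* The last clause says that, for 0 <= s < t, W(t) - W(s) is independent of
   sigma(W(r), r <= s) and has law N(0, (t - s) I_d). *)
Definition brownian_motion : Prop :=
  [/\ forall t i, 0 <= t -> measurable_fun setT (fun w => W w t i 0),
      {ae P, forall w, W w 0 = 0},
      {ae P, forall w, {within (halfline : set R), continuous (W w)}} &
      forall s t, 0 <= s < t ->
        forall (A : set T) (B : 'I_d -> set R),
          natural_filtration s A -> (forall i, measurable (B i)) ->
          P (A `&` [set w | forall i, B i (W w t i 0 - W w s i 0)])
          = (P A * \prod_i normal_prob 0 (Num.sqrt (t - s)) (B i))%E].

End brownian.

Definition meas_wrt (G : set (set T)) (X : T -> R) : Prop :=
  forall B, measurable B -> G (X @^-1` B).

(* Z is a version of E[X | G]. *)
Definition is_condexp (G : set (set T)) (X Z : T -> R) : Prop :=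
  [/\ P.-integrable setT (EFin \o X), P.-integrable setT (EFin \o Z),
      meas_wrt G Z &
      forall A, G A -> \int[P]_(w in A) Z w = \int[P]_(w in A) X w].

Definition meas_process m n (f : T -> R -> 'M[R]_(m, n)) : Prop :=
  forall i j, measurable_fun ([set: T] `*` halfline)
    (fun q : T * measurableTypeR R => f q.1 q.2 i j).

Definition meas_process2 m n (f : T -> R -> R -> 'M[R]_(m, n)) : Prop :=
  forall i j, measurable_fun ([set: T] `*` (halfline `*` halfline))
    (fun q : T * (measurableTypeR R * measurableTypeR R) =>
       f q.1 q.2.1 q.2.2 i j).

Section filtered.
Context {d : nat}.
Variable W : T -> R -> 'cV[R]_d.
Local Notation F := (aug_filtration W).

Definition adapted m n (f : T -> R -> 'M[R]_(m, n)) : Prop :=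
  forall t, 0 <= t -> forall i j, meas_wrt (F t) (fun w => f w t i j).

Definition L2F (beta : R) m n (V : set 'M[R]_(m, n))
    (f : T -> R -> 'M[R]_(m, n)) : Prop :=
  [/\ meas_process f, adapted f, forall w t, 0 <= t -> V (f w t) &
      (\int[P]_w \int[leb]_(t in halfline)
         (expR (2 * beta * t) * fnorm (f w t) ^+ 2)%:E < +oo)%E].

Definition LL2F (beta : R) m n (f : T -> R -> R -> 'M[R]_(m, n)) : Prop :=
  [/\ meas_process2 f,
      {ae leb, forall t, 0 <= t -> adapted (fun w s => f w t s)} &
      (\int[P]_w \int[leb]_(t in halfline)
         ((expR (2 * beta * t))%:E *
          \int[leb]_(s in halfline) (fnorm (f w t s) ^+ 2)%:E) < +oo)%E].

(* The simple process sum_(j < N) xi_j 1_(t_j, t_(j+1)]. *)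
Record simple_process := SimpleProcess {
  sp_size : nat;
  sp_time : nat -> R;
  sp_val : nat -> T -> R
}.

Definition simple_adapted (S : simple_process) : Prop :=
  [/\ 0 <= sp_time S 0,
      forall j, sp_time S j <= sp_time S j.+1,
      forall j, meas_wrt (F (sp_time S j)) (sp_val S j) &
      exists C, forall j w, `|sp_val S j w| <= C].

Definition simple_path (S : simple_process) (w : T) (s : R) : R :=
  \sum_(j < sp_size S)
    sp_val S j w * ((sp_time S j < s <= sp_time S j.+1)%R)%:R.

Definition simple_integral (k : 'I_d) (S : simple_process) (w : T) : R :=
  \sum_(j < sp_size S)
    sp_val S j w * (W w (sp_time S j.+1) k 0 - W w (sp_time S j) k 0).

(* I is (a version of) the Ito integral of g over [0, +oo[ against W_k: the
   L^2(P)-limit of the integrals of simple processes converging to g in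
   L^2(P (x) dt). *)
Definition is_ito_coord (k : 'I_d) (g : T -> R -> R) (I : T -> R) : Prop :=
  [/\ measurable_fun ([set: T] `*` halfline)
        (fun q : T * measurableTypeR R => g q.1 q.2),
      measurable_fun setT I &
      exists S : nat -> simple_process,
        [/\ forall m, simple_adapted (S m),
            (fun m => \int[P]_w \int[leb]_(s in halfline)
                ((simple_path (S m) w s - g w s) ^+ 2)%:E)%E @ \oo --> 0%E &
            (fun m => \int[P]_w
                ((simple_integral k (S m) w - I w) ^+ 2)%:E)%E @ \oo --> 0%E]].

(* I = int_D z dW = sum_k int_D z^k dW_k, for D included in [0, +oo[. *)
Definition is_ito (D : set R) n (z : T -> R -> 'M[R]_(n, d))
    (I : T -> 'cV[R]_n) : Prop :=
  exists2 J : 'I_n -> 'I_d -> T -> R,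
    forall i k, is_ito_coord k (fun w s => z w s i k * \1_D s) (J i k) &
    forall w, I w = \col_i \sum_k J i k w.

Definition M2F (beta : R) n (y : T -> R -> 'cV[R]_n)
    (z : T -> R -> R -> 'M[R]_(n, d)) : Prop :=
  [/\ L2F beta setT y, LL2F beta z &
      {ae leb, forall t, 0 <= t ->
        exists2 I, is_ito `[0, t] (fun w s => z w t s) I &
          {ae P, forall w,
            y w t = (\col_i \int[P]_w' y w' t i 0) + I w}}].

(* A version, measurable in (w, t, s), of the field E_t[y(s)], t <= s. *)
Definition condexp_field n (y : T -> R -> 'cV[R]_n)
    (Ey : T -> R -> R -> 'cV[R]_n) : Prop :=
  meas_process2 Ey /\
  {ae leb, forall t, 0 <= t -> {ae leb, forall s, t <= s ->
    forall i, is_condexp (F t) (fun w => y w s i 0) (fun w => Ey w t s i 0)}}.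

End filtered.

Section control.
Context {n d l : nat}.
Variable W : T -> R -> 'cV[R]_d.
Variables (phi : T -> R -> 'cV[R]_n)
  (b : R -> R -> 'cV[R]_n -> 'cV[R]_l -> 'cV[R]_n)
  (sigma : R -> R -> 'cV[R]_n -> 'cV[R]_l -> 'M[R]_(n, d))
  (h : R -> 'cV[R]_n -> 'cV[R]_l -> R).

Definition meas_coef m k (f : R -> R -> 'cV[R]_n -> 'cV[R]_l -> 'M[R]_(m, k)) :=
  forall i j, measurable_fun
    [set q : (measurableTypeR R * measurableTypeR R)
             * (n.-tuple (measurableTypeR R) * l.-tuple (measurableTypeR R))
    | 0 <= q.1.2 <= q.1.1]
    (fun q => f q.1.1 q.1.2 (vec_of_tuple q.2.1) (vec_of_tuple q.2.2) i j).

Definition coef_regular m k (f : R -> R -> 'cV[R]_n -> 'cV[R]_l -> 'M[R]_(m, k))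
    (Kx Ku : R -> R) : Prop :=
  meas_coef f /\
  {ae (leb \x leb)%E, forall ts : R * R, 0 <= ts.2 <= ts.1 ->
    [/\ C1 (fun z : 'cV[R]_n * 'cV[R]_l => f ts.1 ts.2 z.1 z.2),
        forall x x' u u',
          fnorm (f ts.1 ts.2 x u - f ts.1 ts.2 x' u') <=
            Kx (ts.1 - ts.2) * fnorm (x - x') +
            Ku (ts.1 - ts.2) * fnorm (u - u') &
        f ts.1 ts.2 0 0 = 0]}.

Definition meas_cost : Prop := measurable_fun
    [set q : measurableTypeR R
             * (n.-tuple (measurableTypeR R) * l.-tuple (measurableTypeR R))
    | 0 <= q.1]
    (fun q => h q.1 (vec_of_tuple q.2.1) (vec_of_tuple q.2.2)).

Definition cost_regular : Prop :=
  [/\ meas_cost,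
      {ae leb, forall t, 0 <= t ->
        C1 (fun z : 'cV[R]_n * 'cV[R]_l => (h t z.1 z.2 : R^o))} &
      exists2 C : R, 0 < C &
        {ae leb, forall t, 0 <= t -> forall x u,
          [/\ `|h t x u| <= C * (1 + fnorm x ^+ 2 + fnorm u ^+ 2),
              fnorm (grad (fun y => h t y u) x) <= C * (1 + fnorm x + fnorm u) &
              fnorm (grad (fun v => h t x v) u) <= C * (1 + fnorm x + fnorm u)]}].

Definition assumptionC (mu : R) (Kbx Kbu Ksx Ksu : R -> R) : Prop :=
  [/\ L2F W (- mu) setT phi,
      [/\ Lstar 1 Kbx, Lstar 1 Kbu, Lstar 2 Ksx & Lstar 2 Ksu],
      coef_regular b Kbx Kbu, coef_regular sigma Ksx Ksu & cost_regular].

Definition is_state (mu : R) (u : T -> R -> 'cV[R]_l)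
    (X : T -> R -> 'cV[R]_n) : Prop :=
  L2F W (- mu) setT X /\
  {ae leb, forall t, 0 <= t ->
    exists2 I, is_ito W `[0, t] (fun w s => sigma t s (X w s) (u w s)) I &
      {ae P, forall w,
        X w t = phi w t + vint `[0, t] (fun s => b t s (X w s) (u w s)) + I w}}.

Definition cost (lambda : R) (u : T -> R -> 'cV[R]_l)
    (X : T -> R -> 'cV[R]_n) : \bar R :=
  (\int[P]_w \int[leb]_(t in halfline)
    (expR (- (lambda * t)) * h t (X w t) (u w t))%:E)%E.

(* A control v has, up to null sets, a single state Xv; the infimum is thus that
   of v |-> J_lambda(v) = cost lambda v Xv over the admissible controls. *)
Definition optimal (mu lambda : R) (U : set 'cV[R]_l)
    (u : T -> R -> 'cV[R]_l) (X : T -> R -> 'cV[R]_n) : Prop :=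
  cost lambda u X = ereal_inf [set c | exists v Xv,
    [/\ L2F W (- mu) U v, is_state mu v Xv & c = cost lambda v Xv]].

Definition adjoint_solution (mu lambda : R) (u : T -> R -> 'cV[R]_l)
    (X : T -> R -> 'cV[R]_n) (Y : T -> R -> 'cV[R]_n)
    (Z : T -> R -> R -> 'M[R]_(n, d)) : Prop :=
  let bx w t s := dmx (fun x => b t s x (u w s)) (X w s) in
  let sx k w t s := dmx (fun x => col k (sigma t s x (u w s))) (X w s) in
  let hx w t := grad (fun x => h t x (u w t)) (X w t) in
  M2F W (- mu) Y Z /\
  {ae leb, forall t, 0 <= t ->
    exists2 I, is_ito W `[t, +oo[ (fun w s => Z w t s) I &
      {ae P, forall w,
        Y w t = hx w t
          + vint `[t, +oo[ (fun s => expR (- (lambda * (s - t))) *: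
              ((bx w s t)^T *m Y w s
               + \sum_k (sx k w s t)^T *m col k (Z w s t)))
          - I w}}.

Definition hamiltonian (lambda t : R) (x : 'cV[R]_n) (u : 'cV[R]_l)
    (p : R -> 'cV[R]_n) (q : R -> 'M[R]_(n, d)) : R :=
  h t x u + \int[leb]_(s in `[t, +oo[)
    (expR (- (lambda * (s - t))) *
     (dotv (b s t x u) (p s)
      + \sum_k dotv (col k (sigma s t x u)) (col k (q s)))).

End control.
End stochastic.

(* Main.v *)
(* Convexity of the Hamiltonian and the minimum condition bound
   h(t, X, v) - h(t, Xhat, uhat) from below by the derivative of the Hamiltonian
   in the direction dX = X - Xhat, minus the increments db and dsigma of the
   coefficients paired with E_t[Y(s)] and Z(s, t).  The adjoint equation turns
   the derivative of h into <Y(t) + I_t, dX(t)>, where I_t is the integral of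
   Z(t, .) dW over [t, oo[, at the price of terms paired with E_t[Y(s)] - Y(s).
   Multiplied by e^(- lambda t) and integrated,
   - the I_t term vanishes, since I_t is orthogonal to the past of t;
   - E_t[Y(s)] is replaced by Y(s), the coefficients being known at time t;
   - E <Y(s), dX(s)> = E int_0^s (<db, Y(s)> + sum_k <dsigma^k, Z^k(s, t)>) dt,
     by the Ito isometry applied to the state equations and to the
     representation of the M-solution, cancels what is left.
   All the pairings are integrable because lambda >= 2 mu and because
   mu > rho makes e^(- mu r) K(r) integrable (square integrable for sigma): for
   the drift, 2 k(s - t) |f(t)| |g(s)| <= k(s - t) (f(t)^2 + g(s)^2). *)
Require Import Defs.
From HB Require Import structures.
From mathcomp Require Import all_boot all_order all_algebra.
From mathcomp Require Import all_classical all_reals all_analysis.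
From mathcomp Require Import finmap measurable_realfun ring lra.
Set Implicit Arguments.
Unset Strict Implicit.
Unset Printing Implicit Defensive.
Import Order.TTheory GRing.Theory Num.Theory.
Import numFieldNormedType.Exports.
Local Open Scope classical_set_scope.
Local Open Scope ring_scope.

(** * Integrable and square-integrable real functions *)

(** The obstacle is regularity. The derivatives of [b] and [sigma] exist for almost all pairs of
    times only and bring neither measurability nor adaptedness, whereas replacing E_t[Y(s)] by Y(s)
    requires an adapted weight with an integrable majorant. They are therefore represented by upper
    limits of difference quotients along X - Xhat, clipped by an explicit majorant: adapted and
    dominated everywhere, equal to the derivatives wherever the coefficients are regular. No
    linearised state equation appears: the derivatives meet only E_t[Y(s)] - Y(s), whose pairing
    with such a weight has mean 0, so that only true increments of the coefficients remain.
    Processes are extended by 0 and multiplied by e^(- mu s), which turns the weighted spaces into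
    plain L^2 spaces. The final cancellation takes place on the sample space times the plane of
    pairs t <= s: at a fixed time, one of the two terms has it as the later time and the other as
    the earlier time, so they cancel only after integration. Ito integrals are given by a relation
    to simple processes; isometry, zero mean and orthogonality to the past are obtained as
    limits. *)

Section real_integrals.
Context d (T : measurableType d) (R : realType).
Variable mu : {measure set T -> \bar R}.
Implicit Types (f g : T -> R).
Local Notation intble f := (mu.-integrable setT (EFin \o f)).

Lemma integrable_measurable f : intble f -> measurable_fun setT f.
Proof. by move=> /(measurable_int mu)/measurable_EFinP. Qed.

Lemma ae_le_integrable f g : measurable_fun setT f -> intble g ->
  {ae mu, forall x, `|f x| <= g x} -> intble f.
Proof.
move=> mf ig fg; apply/integrableP; split; first exact/measurable_EFinP.
have /integrableP[mg] := ig; apply: le_lt_trans.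
apply: ae_ge0_le_integral => //.
- exact/measurableT_comp/measurable_EFinP.
- exact: measurableT_comp.
apply: filterS fg => x fg _ /=; rewrite lee_fin.
by rewrite (le_trans fg)// ler_norm.
Qed.

Lemma le_integrableR f g : measurable_fun setT f -> intble g ->
  (forall x, `|f x| <= g x) -> intble f.
Proof. by move=> mf ig fg; apply: ae_le_integrable ig _ => //; exact: aeW. Qed.

Lemma ae_eq_Rintegral f g : measurable_fun setT f -> measurable_fun setT g ->
  {ae mu, forall x, f x = g x} -> \int[mu]_x f x = \int[mu]_x g x.
Proof.
move=> mf mg fg; congr fine; apply: ae_eq_integral => //.
- exact/measurable_EFinP.
- exact/measurable_EFinP.
- by apply: filterS fg => x -> _.
Qed.

Lemma integrableDR f g : intble f -> intble g -> intble (fun x => f x + g x).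
Proof. by move=> fi gi; have := integrableD measurableT fi gi. Qed.

Lemma integrableBR f g : intble f -> intble g -> intble (fun x => f x - g x).
Proof. by move=> fi gi; have := integrableB measurableT fi gi. Qed.

Lemma integrableZR (k : R) f : intble f -> intble (fun x => k * f x).
Proof. by move=> fi; have := integrableZl measurableT k fi. Qed.

Lemma integrable_normR f : intble f -> intble (fun x => `|f x|).
Proof. by move=> fi; have := integrable_norm fi. Qed.

Lemma ae_le_Rintegral f g : intble f -> intble g ->
  {ae mu, forall x, f x <= g x} -> \int[mu]_x f x <= \int[mu]_x g x.
Proof.
move=> fi gi fg; rewrite -subr_ge0 -RintegralB//.
have gfi := integrableBR gi fi; have mgf := integrable_measurable gfi.
(* The difference is nonnegative only almost everywhere; its absolute value is so everywhere. *)
rewrite (@ae_eq_Rintegral _ (fun x => `|g x - f x|))//.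
- by apply: Rintegral_ge0 => x _.
- exact: measurableT_comp.
- by apply: filterS fg => x fg; rewrite ger0_norm// subr_ge0.
Qed.

Lemma integrable_sumR (I : Type) (s : seq I) (F : I -> T -> R) :
  (forall i, intble (F i)) -> intble (fun x => \sum_(i <- s) F i x).
Proof.
move=> Fi; elim: s => [|i s ih].
  by under eq_fun do rewrite big_nil; exact: integrable0.
by under eq_fun do rewrite big_cons; exact: integrableDR.
Qed.

Lemma Rintegral_sum (I : Type) (s : seq I) (F : I -> T -> R) :
  (forall i, intble (F i)) ->
  \int[mu]_x (\sum_(i <- s) F i x) = \sum_(i <- s) \int[mu]_x F i x.
Proof.
move=> Fi; elim: s => [|i s ih].
  under eq_Rintegral do rewrite big_nil.
  by rewrite big_nil /Rintegral integral0.
under eq_Rintegral do rewrite big_cons.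
by rewrite RintegralD//; [rewrite big_cons ih|exact: integrable_sumR].
Qed.

Lemma EFin_Rintegral f : intble f ->
  (\int[mu]_x f x)%:E = (\int[mu]_x (f x)%:E)%E.
Proof. by move=> fi; rewrite fineK//; exact: integrable_fin_num. Qed.

Lemma Rintegral0_eq f : (forall x, f x = 0) -> \int[mu]_x f x = 0.
Proof. by move=> f0; rewrite /Rintegral integral0_eq// => x _; rewrite f0. Qed.

End real_integrals.

Section square_integrable.
Context d (T : measurableType d) (R : realType).
Variable mu : {measure set T -> \bar R}.
Implicit Types (f g : T -> R).
Local Notation intble f := (mu.-integrable setT (EFin \o f)).

Definition sq_integrable f :=
  measurable_fun setT f /\ (\int[mu]_x (f x ^+ 2)%:E < +oo)%E.

Lemma sq_integrableP f :
  sq_integrable f <-> measurable_fun setT f /\ intble (fun x => f x ^+ 2).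
Proof.
split=> -[mf fi]; split=> //.
  apply/integrableP; split; first exact/measurable_EFinP/measurable_funX.
  by under eq_integral do rewrite /= ger0_norm ?sqr_ge0//.
have /integrableP[_] := fi.
by under eq_integral do rewrite /= ger0_norm ?sqr_ge0//.
Qed.

Lemma le_sq_integrable f g : measurable_fun setT f -> sq_integrable g ->
  (forall x, `|f x| <= `|g x|) -> sq_integrable f.
Proof.
move=> mf /sq_integrableP[mg gi] fg; apply/sq_integrableP; split=> //.
apply: le_integrableR gi _; first exact: measurable_funX.
move=> x; rewrite ger0_norm ?sqr_ge0//.
by rewrite -(real_normK (num_real (f x))) -(real_normK (num_real (g x))) lerXn2r ?nnegrE.
Qed.

(** From [(f + g)^2 >= 0] and [(f - g)^2 >= 0]: [|f g| <= f^2 + g^2]. *)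
Lemma sq_integrable_mul f g : sq_integrable f -> sq_integrable g ->
  intble (fun x => f x * g x).
Proof.
move=> /sq_integrableP[mf fi] /sq_integrableP[mg gi].
apply: le_integrableR (integrableDR fi gi) _; first exact: measurable_funM.
move=> x; have := (sqr_ge0 (f x + g x), sqr_ge0 (f x - g x)).
by rewrite ler_norml !expr2 => -[h1 h2]; apply/andP; split; nra.
Qed.

Lemma sq_integrableD f g : sq_integrable f -> sq_integrable g ->
  sq_integrable (fun x => f x + g x).
Proof.
move=> /sq_integrableP[mf fi] /sq_integrableP[mg gi].
apply/sq_integrableP; split; first exact: measurable_funD.
apply: le_integrableR (integrableZR 2 (integrableDR fi gi)) _.
  by apply: measurable_funX; exact: measurable_funD.
move=> x; rewrite ger0_norm ?sqr_ge0//.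
by have := sqr_ge0 (f x - g x); rewrite !expr2; nra.
Qed.

Lemma sq_integrableZ k f : sq_integrable f -> sq_integrable (fun x => k * f x).
Proof.
move=> /sq_integrableP[mf fi]; apply/sq_integrableP; split.
  exact: measurable_funM.
by under eq_fun do rewrite exprMn; exact: integrableZR.
Qed.

Lemma sq_integrableN f : sq_integrable f -> sq_integrable (fun x => - f x).
Proof. by move=> /(@sq_integrableZ (-1)); under eq_fun do rewrite mulN1r. Qed.

Lemma sq_integrableB f g : sq_integrable f -> sq_integrable g ->
  sq_integrable (fun x => f x - g x).
Proof. by move=> sf sg; apply: sq_integrableD => //; exact: sq_integrableN. Qed.

Lemma sq_integrable0 : sq_integrable (fun=> 0).
Proof. by split=> //; rewrite integral0_eq// => x _; rewrite expr0n. Qed.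

Lemma sq_integrable_sum (I : Type) (s : seq I) (F : I -> T -> R) :
  (forall i, sq_integrable (F i)) -> sq_integrable (fun x => \sum_(i <- s) F i x).
Proof.
move=> Fi; elim: s => [|i s ih].
  by under eq_fun do rewrite big_nil; exact: sq_integrable0.
by under eq_fun do rewrite big_cons; exact: sq_integrableD.
Qed.

(** Pointwise, [|a b| <= e a^2 + e^-1 b^2] is read off from the squares [e^-1 (e a - b)^2] and
    [e^-1 (e a + b)^2]. *)
Lemma Rintegral_mul_le f g (e : R) : 0 < e ->
  sq_integrable f -> sq_integrable g ->
  `|\int[mu]_x (f x * g x)| <=
    e * \int[mu]_x (f x ^+ 2) + e^-1 * \int[mu]_x (g x ^+ 2).
Proof.
move=> e0 sf sg.
have [[mf fi] [mg gi]] := ((sq_integrableP f).1 sf, (sq_integrableP g).1 sg).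
rewrite -!RintegralZl// -RintegralD//; [|exact: integrableZR..].
have fgi := sq_integrable_mul sf sg.
apply: le_trans (le_normr_Rintegral measurableT fgi) _.
apply: le_Rintegral => //; first exact: integrable_normR.
  by apply: integrableDR; exact: integrableZR.
move=> x _; set a := f x; set b := g x.
have e1 : e^-1 * e = 1 by rewrite mulVf// gt_eqF.
have ei : 0 < e^-1 by rewrite invr_gt0.
have h1 : 0 <= e^-1 * (e * a - b) ^+ 2 by rewrite mulr_ge0 ?sqr_ge0// ltW.
have h2 : 0 <= e^-1 * (e * a + b) ^+ 2 by rewrite mulr_ge0 ?sqr_ge0// ltW.
have h3 : 0 <= e^-1 * b ^+ 2 by rewrite mulr_ge0 ?sqr_ge0// ltW.
have h4 : 0 <= e * a ^+ 2 by rewrite mulr_ge0 ?sqr_ge0// ltW.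
have E1 : e^-1 * (e * a - b) ^+ 2 = e * a ^+ 2 - 2 * (a * b) + e^-1 * b ^+ 2.
  transitivity ((e^-1 * e) * e * a ^+ 2 - 2 * (e^-1 * e) * (a * b) + e^-1 * b ^+ 2); first by ring.
  by rewrite e1; ring.
have E2 : e^-1 * (e * a + b) ^+ 2 = e * a ^+ 2 + 2 * (a * b) + e^-1 * b ^+ 2.
  transitivity ((e^-1 * e) * e * a ^+ 2 + 2 * (e^-1 * e) * (a * b) + e^-1 * b ^+ 2); first by ring.
  by rewrite e1; ring.
rewrite ler_norml; apply/andP; split; lra.
Qed.

(* Young's inequality with a parameter [e] replaces the Cauchy-Schwarz
   inequality: the limit follows by letting [e] tend to 0 last. *)
Lemma cvg_Rintegral_mul (f_ g_ : nat -> T -> R) f g :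
  (forall n, sq_integrable (f_ n)) -> (forall n, sq_integrable (g_ n)) ->
  sq_integrable f -> sq_integrable g ->
  (fun n => \int[mu]_x ((f_ n x - f x) ^+ 2)%:E)%E @ \oo --> 0%E ->
  (fun n => \int[mu]_x ((g_ n x - g x) ^+ 2)%:E)%E @ \oo --> 0%E ->
  (fun n => \int[mu]_x (f_ n x * g_ n x)) @ \oo --> \int[mu]_x (f x * g x).
Proof.
move=> sf_ sg_ sf sg cf cg.
pose a n := \int[mu]_x ((f_ n x - f x) ^+ 2).
pose b n := \int[mu]_x ((g_ n x - g x) ^+ 2).
have sfd n := sq_integrableB (sf_ n) sf.
have sgd n := sq_integrableB (sg_ n) sg.
have ca : a @ \oo --> 0 by exact: (@fine_cvg _ _ _ _ _ 0 cf).
have cb : b @ \oo --> 0 by exact: (@fine_cvg _ _ _ _ _ 0 cg).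
set F := \int[mu]_x (f x ^+ 2); set G := \int[mu]_x (g x ^+ 2).
have F0 : 0 <= F by apply: Rintegral_ge0 => x _; exact: sqr_ge0.
have G0 : 0 <= G by apply: Rintegral_ge0 => x _; exact: sqr_ge0.
have key n e : 0 < e -> `|\int[mu]_x (f x * g x) - \int[mu]_x (f_ n x * g_ n x)| <=
    (a n + b n) + e^-1 * (a n + b n) + e * (F + G).
  move=> e0.
  (* The quadratic error gets parameter 1. The two linear errors get [e], which puts [e^-1] on the
     vanishing factor and [e] on the fixed norms [F] and [G]. *)
  have -> : \int[mu]_x (f x * g x) - \int[mu]_x (f_ n x * g_ n x) =
     - (\int[mu]_x ((f_ n x - f x) * (g_ n x - g x)) +
     (\int[mu]_x (f x * (g_ n x - g x)) + \int[mu]_x (g x * (f_ n x - f x)))).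
    rewrite -opprB; congr -%R.
    rewrite -RintegralB//; [|exact: sq_integrable_mul..].
    rewrite -!RintegralD//.
    - by apply: eq_Rintegral => x _; ring.
    - exact: sq_integrable_mul.
    - by apply: integrableDR; exact: sq_integrable_mul.
    - exact: sq_integrable_mul.
    - exact: sq_integrable_mul.
  rewrite normrN; apply: le_trans (ler_normD _ _) _.
  apply: le_trans (lerD (lexx _) (ler_normD _ _)) _.
  have := Rintegral_mul_le ltr01 (sfd n) (sgd n); rewrite invr1 !mul1r -/(a n) -/(b n).
  have := Rintegral_mul_le e0 sf (sgd n); rewrite -/(b n) -/F.
  have := Rintegral_mul_le e0 sg (sfd n); rewrite -/(a n) -/G.
  rewrite !mulrDr; lra.
apply/cvgrPdist_le => e e0.
(* The summand 1 keeps the divisor positive when both norms vanish. *)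
pose e' := e / 2 / (F + G + 1).
have FG : 0 < F + G + 1 by rewrite ltr_wpDl// addr_ge0.
have e'0 : 0 < e' by rewrite !divr_gt0.
have e'e : e' * (F + G) <= e / 2.
  by rewrite -mulrA ler_piMr ?divr_ge0// 1?ltW// mulrC ltr_pdivrMr// mul1r ltrDl.
have cc : (fun n => (a n + b n) + e'^-1 * (a n + b n)) @ \oo --> (0 + 0 + e'^-1 * (0 + 0) : R).
  by apply: cvgD; [exact: cvgD|apply: cvgM; [exact: cvg_cst|exact: cvgD]].
rewrite !addr0 mulr0 in cc.
have e20 : 0 < e / 2 by rewrite divr_gt0.
move/cvgrPdist_le : cc => /(_ _ e20); apply: filterS => n /=.
rewrite addr0 sub0r normrN => h; apply: le_trans (key n _ e'0) _.
rewrite [leRHS](splitr e) lerD//; exact: le_trans (ler_norm _) h.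
Qed.

(** A convergent sequence of extended reals with a finite limit is eventually finite: some
    [f_ n - f] is square integrable, and [f = f_ n - (f_ n - f)]. *)
Lemma cvg_sq_integrable (f_ : nat -> T -> R) f :
  (forall n, sq_integrable (f_ n)) -> measurable_fun setT f ->
  (fun n => \int[mu]_x ((f_ n x - f x) ^+ 2)%:E)%E @ \oo --> 0%E ->
  sq_integrable f.
Proof.
move=> sf_ mf cf.
have /fine_cvgP[[n _ /(_ n (leqnn n))/= fn] _] := cf.
have sd : sq_integrable (fun x => f_ n x - f x).
  split; last by rewrite -ge0_fin_numE// integral_ge0// => x _; rewrite lee_fin sqr_ge0.
  by apply: measurable_funB => //; case: (sf_ n).
have := sq_integrableB (sf_ n) sd.
by under eq_fun do rewrite subKr.
Qed.

End square_integrable.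

(** * Sub-sigma-algebras and conditional expectations *)

Section sub_sigma_algebra.
Context d (T : measurableType d) (R : realType).
Variable mu : {measure set T -> \bar R}.
Variable G : set (set T).
Hypothesis sG : sigma_algebra setT G.
Local Notation intble f := (mu.-integrable setT (EFin \o f)).
Local Notation TG := (g_sigma_algebraType G).
Import HBSimple HBNNSimple.

(** Makes the closure properties of measurable functions available for functions measurable with
    respect to [G]. *)
Lemma meas_wrtP (X : T -> R) :
  meas_wrt G X <-> measurable_fun [set: TG] (X : TG -> R).
Proof.
split=> [mX _ B mB|mX B mB].
  by rewrite setTI; apply: sub_sigma_algebra; exact: mX.
by have := mX measurableT B mB; rewrite setTI /measurable/= sigma_algebra_id.
Qed.

Hypothesis Gm : G `<=` measurable.

Lemma meas_wrt_measurable (X : T -> R) : meas_wrt G X -> measurable_fun setT X.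
Proof. by move=> mX _ B mB; rewrite setTI; exact/Gm/mX. Qed.

(** The simple functions increasing to [xi] have their level sets in [G], so each of them is
    orthogonal to [X]; the limit is dominated by [|xi X|]. *)
Let ge0_orthogonal_meas_wrt (X xi : T -> R) : intble X ->
  (forall A, G A -> \int[mu]_(x in A) X x = 0) ->
  meas_wrt G xi -> (forall x, 0 <= xi x) -> intble (fun x => xi x * X x) ->
  \int[mu]_x (xi x * X x) = 0.
Proof.
move=> iX X0 /meas_wrtP mxi xi0 ixiX.
have mX := integrable_measurable iX.
have mxiE : measurable_fun [set: TG] (EFin \o xi : TG -> \bar R).
  exact/measurable_EFinP.
have xiE0 x : setT x -> (0 <= (EFin \o xi : TG -> \bar R) x)%E.
  by move=> _; rewrite lee_fin.
pose h n : T -> R := (nnsfun_approx measurableT mxiE n : TG -> R).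
have hG n : meas_wrt G (h n) by apply/meas_wrtP; exact: measurable_funP.
have hle n x : 0 <= h n x <= xi x.
  apply/andP; split; first exact: fun_ge0.
  by rewrite /h nnsfun_approxE -lee_fin; exact: le_approx.
have hX n : intble (fun x => h n x * X x).
  apply: le_integrableR (integrable_normR ixiX) _.
    by apply: measurable_funM => //; exact: meas_wrt_measurable (hG n).
  move=> x; rewrite !normrM ler_wpM2r//.
  by have /andP[h0 h1] := hle n x; rewrite !ger0_norm.
have hX0 n : \int[mu]_x (h n x * X x) = 0.
  have fh : finite_set (range (h n)) by exact: (fimfunP (nnsfun_approx measurableT mxiE n)).
  have eh x : h n x * X x =
      \sum_(y <- fset_set (range (h n))) y * (X \_ (h n @^-1` [set y])) x.
    have -> : h n x = \sum_(y \in range (h n)) (y * \1_(h n @^-1` [set y]) x)%R.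
      exact: (fimfunE (nnsfun_approx measurableT mxiE n) x).
    rewrite fsbig_finite//= mulr_suml; apply: eq_bigr => y _.
    by rewrite -mulrA; congr *%R; rewrite patchE indicE; case: ifP;
      rewrite (mul1r,mul0r).
  have iy y : intble (X \_ (h n @^-1` [set y])).
    apply: le_integrableR (integrable_normR iX) _.
      apply/(measurable_restrictT _ _).1; last exact: measurable_funTS.
      by apply: Gm; exact: hG.
    by move=> x; rewrite patchE; case: ifP => _ //; rewrite normr0.
  under eq_Rintegral do rewrite eh.
  rewrite Rintegral_sum; last by move=> y; exact: integrableZR.
  apply: big1 => y _; rewrite RintegralZl// -Rintegral_mkcond X0 ?mulr0//.
  exact: hG.
have cX : {ae mu, forall x, setT x ->
    (fun n => (h n x * X x)%:E) @ \oo --> (xi x * X x)%:E}.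
  apply: aeW => x _; apply/fine_cvgP; split; first exact: nearW.
  have hc : h ^~ x @ \oo --> xi x.
    exact: (fine_cvg (cvg_nnsfun_approx measurableT mxiE xiE0 I)).
  exact: cvgMr_tmp hc.
have bX : {ae mu, forall x n, setT x ->
    (`|(h n x * X x)%:E| <= `|xi x * X x|%:E)%E}.
  apply: aeW => x n _ /=; rewrite lee_fin !normrM ler_wpM2r//.
  by have /andP[h0 h1] := hle n x; rewrite !ger0_norm.
have [_ _] := dominated_convergence measurableT (fun n => measurable_int mu (hX n))
  (measurable_int mu ixiX) cX (integrable_normR ixiX) bX.
have -> : (fun n => \int[mu]_x (h n x * X x)%:E)%E = (fun=> 0%E).
  by apply/funext => n; rewrite /= -(EFin_Rintegral (hX n)) hX0.
move=> /cvg_lim; rewrite lim_cst// => /(_ (@ereal_hausdorff R)) e.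
by rewrite /Rintegral -e.
Qed.

(** Orthogonality tested on events extends to weights, after splitting [xi] into positive and
    negative parts. Conditional expectations, independence, and the orthogonality of Brownian
    increments and of Ito integrals to the past all go through this lemma. *)
Lemma orthogonal_meas_wrt (X xi : T -> R) : intble X ->
  (forall A, G A -> \int[mu]_(x in A) X x = 0) ->
  meas_wrt G xi -> intble (fun x => xi x * X x) ->
  \int[mu]_x (xi x * X x) = 0.
Proof.
move=> iX X0 mxi ixiX.
have mX := integrable_measurable iX.
have mxi' := meas_wrt_measurable mxi.
pose p x := Num.max (xi x) 0; pose q x := Num.max (- xi x) 0.
have mp : meas_wrt G p.
  by apply/meas_wrtP; apply: measurable_maxr => //; exact/meas_wrtP.
have mq : meas_wrt G q.
  apply/meas_wrtP; apply: measurable_maxr => //.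
  by apply: measurableT_comp => //; exact/meas_wrtP.
have p0 x : 0 <= p x by rewrite le_max lexx orbT.
have q0 x : 0 <= q x by rewrite le_max lexx orbT.
have ip : intble (fun x => p x * X x).
  apply: le_integrableR (integrable_normR ixiX) _.
    by apply: measurable_funM => //; exact: meas_wrt_measurable.
  move=> x; rewrite !normrM ler_wpM2r// ger0_norm//.
  by rewrite ge_max ler_norm normr_ge0.
have iq : intble (fun x => q x * X x).
  apply: le_integrableR (integrable_normR ixiX) _.
    by apply: measurable_funM => //; exact: meas_wrt_measurable.
  move=> x; rewrite !normrM ler_wpM2r// ger0_norm//.
  by rewrite ge_max -normrN ler_norm normr_ge0.
transitivity (\int[mu]_x (p x * X x) - \int[mu]_x (q x * X x)).
  rewrite -RintegralB//; apply: eq_Rintegral => x _; rewrite -mulrBl; congr *%R.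
  rewrite /p /q; have [h|h] := orP (le_total 0 (xi x)).
    by rewrite max_l// max_r ?subr0// oppr_le0.
  by rewrite max_r// max_l ?sub0r ?opprK// oppr_ge0.
by rewrite !ge0_orthogonal_meas_wrt// subr0.
Qed.

End sub_sigma_algebra.

Section conditional_expectation.
Context d (T : measurableType d) (R : realType).
Variable P : probability T R.
Variable G : set (set T).
Hypotheses (sG : sigma_algebra setT G) (Gm : G `<=` measurable).
Variables X Z : T -> R.
Hypothesis XZ : is_condexp P G X Z.
Local Notation intble f := (P.-integrable setT (EFin \o f)).
Local Notation TG := (g_sigma_algebraType G).

(** By definition of a conditional expectation, [Z - X] is orthogonal to the events of [G]. *)
Lemma condexp_mul xi : meas_wrt G xi -> intble (fun w => xi w * X w) ->
  intble (fun w => xi w * Z w) ->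
  \int[P]_w (xi w * Z w) = \int[P]_w (xi w * X w).
Proof.
have [iX iZ mZ eXZ] := XZ; move=> mxi ixX ixZ.
apply/eqP; rewrite -subr_eq0 -RintegralB//; apply/eqP.
under eq_Rintegral do rewrite -mulrBr.
apply: (orthogonal_meas_wrt sG Gm) => //.
- exact: integrableBR.
- move=> A GA; have mA := Gm GA.
  by rewrite RintegralB ?eXZ ?subrr//; apply: integrableS (subsetT _) _.
- by under eq_fun do rewrite mulrBr; exact: integrableBR.
Qed.

(* For bounded weights, [E[xi |Z|] = E[xi sgn(Z) X]]; thus no conditional Jensen
   inequality is needed. *)
Lemma condexp_abs_le xi : meas_wrt G xi -> (forall w, 0 <= xi w) ->
  (\int[P]_w (xi w * `|Z w|)%:E <= \int[P]_w (xi w * `|X w|)%:E)%E.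
Proof.
have [iX iZ mZ eXZ] := XZ; move=> mxi xi0.
have mX := integrable_measurable iX; have mZT := integrable_measurable iZ.
have mxiT := meas_wrt_measurable Gm mxi.
(* Truncation makes the weighted product with [X] integrable even when [xi X] is not; monotone
   convergence removes it at the end. *)
pose xn (n : nat) w : R := Num.min (xi w) n%:R.
have xn0 n w : 0 <= xn n w by rewrite le_min xi0 ler0n.
have mxn n : meas_wrt G (xn n).
  by apply/(meas_wrtP sG); apply: measurable_minr => //; exact/meas_wrtP.
have mxnT n := meas_wrt_measurable Gm (mxn n).
(* The sign of [Z], with value 1 at 0: measurable with respect to [G] because [Z] is, and of
   absolute value 1 everywhere. *)
pose s w : R := 2 * \1_(Z @^-1` `[0, +oo[) w - 1.
have sZ w : s w * Z w = `|Z w|.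
  rewrite /s indicE; have [z0|z0] := leP 0 (Z w).
    by rewrite mem_set/= ?in_itv/= ?z0// ger0_norm//; ring.
  by rewrite memNset/= ?in_itv/= ?leNgt ?z0// ltr0_norm//; ring.
have s1 w : `|s w| = 1.
  rewrite /s indicE; case: (_ \in _) => /=.
    by rewrite mulr1 addrK normr1.
  by rewrite mulr0 sub0r normrN1.
have ms : meas_wrt G s.
  apply/(meas_wrtP sG); apply: measurable_funB => //; apply: measurable_funM => //.
  by apply: measurable_indic; apply: sub_sigma_algebra; exact: mZ.
have msT := meas_wrt_measurable Gm ms.
have ib n (f : T -> R) : intble f -> intble (fun w => xn n w * s w * f w).
  move=> fi; apply: le_integrableR (integrableZR n%:R (integrable_normR fi)) _.
    apply: measurable_funM; last exact: integrable_measurable fi.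
    exact: measurable_funM.
  move=> w; rewrite !normrM s1 mulr1 ler_wpM2r// ger0_norm//.
  by rewrite ge_min lexx orbT.
have bound n : (\int[P]_w (xn n w * `|Z w|)%:E <= \int[P]_w (xi w * `|X w|)%:E)%E.
  have -> : (\int[P]_w (xn n w * `|Z w|)%:E)%E = (\int[P]_w (xn n w * s w * X w)%:E)%E.
    rewrite -(EFin_Rintegral (ib n _ iX)) -condexp_mul.
    - rewrite (EFin_Rintegral (ib n _ iZ)).
      by apply: eq_integral => w _; rewrite -mulrA sZ.
    - by apply/(meas_wrtP sG); apply: measurable_funM; exact/meas_wrtP.
    - exact: ib.
    - exact: ib.
  apply: le_trans (le_integral measurableT (ib n _ iX)
    (integrable_normR (ib n _ iX)) _) _.
    by move=> w _; rewrite lee_fin ler_norm.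
  apply: ge0_le_integral => //.
  - by move=> w _; rewrite lee_fin.
  - exact: measurable_int (integrable_normR (ib n _ iX)).
  - by apply/measurable_EFinP; apply: measurable_funM => //; exact: measurableT_comp.
  - move=> w _; rewrite lee_fin !normrM s1 mulr1 ler_wpM2r// ger0_norm//.
    by rewrite ge_min lexx.
have cv : (fun n => \int[P]_w (xn n w * `|Z w|)%:E)%E @ \oo -->
    (\int[P]_w (xi w * `|Z w|)%:E)%E.
  rewrite (_ : (\int[P]_w (xi w * `|Z w|)%:E)%E =
     (\int[P]_w limn (fun n => (xn n w * `|Z w|)%:E))%E); last first.
    apply: eq_integral => w _; apply/esym/cvg_lim => //.
    apply: cvg_near_cst.
    exists (Num.truncn (xi w)).+1 => // n /= hn; rewrite /xn min_l//.
    by rewrite (le_trans (ltW (truncnS_gt _)))// ler_nat.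
  apply: cvg_monotone_convergence => //.
  - move=> n; apply/measurable_EFinP; apply: measurable_funM => //.
    exact: measurableT_comp.
  - by move=> n w _; rewrite lee_fin mulr_ge0.
  - move=> w _ m n mn; rewrite lee_fin ler_wpM2r// /xn le_min !ge_min lexx/=.
    by rewrite ler_nat mn orbT.
rewrite -(cvg_lim (@ereal_hausdorff R) cv); apply: lime_le => //.
  by apply/cvg_ex; eexists; exact: cv.
exact: nearW.
Qed.

End conditional_expectation.

(** * Invariance of Lebesgue measure under translation and reflection *)

Section translation.
Context {R : realType}.
Notation leb := (@lebesgue_measure R).

(** Lebesgue measure is determined by its values on the intervals []a, b]]. *)
Lemma lebesgue_measure_shift (t : R) (A : set R) : measurable A ->
  pushforward leb ((fun s => s - t) : _ -> measurableTypeR R) A = leb A.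
Proof.
move=> mA.
have mphi : measurable_fun setT
    ((fun s => s - t) : measurableTypeR R -> measurableTypeR R).
  exact: measurable_funB.
apply/esym; move: A mA; apply: (lebesgue_measure_unique (mu := pushforward leb _)).
move=> _ [[a b]] _ <-.
have E : (fun s => s - t) @^-1` `]a, b]%classic = `]a + t, b + t]%classic.
  by apply/seteqP; split=> x /=; rewrite !in_itv/= ltrBrDr lerBlDr.
change (leb `]a, b]%classic = leb ((fun s => s - t) @^-1` `]a, b]%classic)).
rewrite E.
rewrite !lebesgue_measure_itv/= !lte_fin ltrD2r.
by case: ifP => // _; rewrite -!EFinD; congr EFin; ring.
Qed.

Lemma ge0_integral_shift (t : R) (f : R -> \bar R) :
  measurable_fun setT f -> (forall x, 0 <= f x)%E ->
  (\int[leb]_s f (s - t)%R = \int[leb]_s f s)%E.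
Proof.
move=> mf f0.
have mphi : measurable_fun setT ((fun s => s - t) : _ -> measurableTypeR R).
  exact: measurable_funB.
have := @ge0_integral_pushforward _ _ (measurableTypeR R) (measurableTypeR R) R _
  mphi leb setT f measurableT mf.
rewrite preimage_setT => <-//.
by apply: eq_measure_integral => A mA _; exact: lebesgue_measure_shift.
Qed.

Lemma ge0_integral_opp (f : R -> \bar R) :
  measurable_fun setT f -> (forall x, 0 <= f x)%E ->
  (\int[leb]_s f (- s)%R = \int[leb]_s f s)%E.
Proof.
move=> mf f0.
have mphi : measurable_fun setT (-%R : _ -> measurableTypeR R).
  exact: oppr_measurable.
have := @ge0_integral_pushforward _ _ (measurableTypeR R) (measurableTypeR R) R _
  mphi leb setT f measurableT mf.
rewrite preimage_setT => <-//.
by apply: eq_measure_integral => A mA _; exact: lebesgue_measureN.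
Qed.

Lemma ge0_integral_reflect (s : R) (f : R -> \bar R) :
  measurable_fun setT f -> (forall x, 0 <= f x)%E ->
  (\int[leb]_t f (s - t)%R = \int[leb]_t f t)%E.
Proof.
move=> mf f0; rewrite -(ge0_integral_opp mf f0).
rewrite -(@ge0_integral_shift s (fun x => f (- x)))//; last first.
  by apply: measurableT_comp => //; exact: oppr_measurable.
by apply: eq_integral => t _; rewrite opprB.
Qed.

End translation.

(** * Delay kernels *)

(* The library's sigma-finite instance on [\x] only fires for subprobabilities,
   whence a separate name for the Lebesgue measure of the plane. *)
Section plane.
Context {R : realType}.
Notation leb := (@lebesgue_measure R).
Notation mR := (measurableTypeR R).

Definition lebesgue2 : set (mR * mR) -> \bar R := (leb \x leb)%E.

HB.instance Definition _ := Measure.on lebesgue2.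

Let lebesgue2_sigma_finite : sigma_finite setT lebesgue2.
Proof.
have /sigma_finiteP[F [TF ndF Foo]] := sigma_finiteT leb.
exists (fun n => F n `*` F n).
  rewrite -setXTT {1 2}TF predeqE => -[x y]; split.
    move=> [/= [n _ Fnx] [k _ Gky]]; exists (maxn n k) => //; split.
    - by move: x Fnx; exact/subsetPset/ndF/leq_maxl.
    - by move: y Gky; exact/subsetPset/ndF/leq_maxr.
  by move=> [n _ []/= ? ?]; split; exists n.
move=> k; have [mF Fk] := Foo k; split; first exact: measurableX.
by rewrite /lebesgue2 product_measure1E// lte_mul_pinfty// ge0_fin_numE.
Qed.

HB.instance Definition _ := Measure_isSigmaFinite.Build _ _ _ lebesgue2
  lebesgue2_sigma_finite.

End plane.

Section delay_kernel.
Context d (T : measurableType d) (R : realType).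
Variable P : probability T R.
Notation leb := (@lebesgue_measure R).
Notation mR := (measurableTypeR R).
Notation leb2 := (@lebesgue2 R).
Notation P2 := (P \x leb)%E.
Notation P3 := (P \x leb2)%E.

Lemma measurable_proj_fst (c : T * mR -> R) : measurable_fun setT c ->
  measurable_fun setT (fun q : T * (mR * mR) => c (q.1, q.2.1)).
Proof.
move=> mc; apply: measurableT_comp mc _; apply: measurable_fun_pair => //.
exact: measurableT_comp measurable_fst measurable_snd.
Qed.

Lemma measurable_proj_snd (c : T * mR -> R) : measurable_fun setT c ->
  measurable_fun setT (fun q : T * (mR * mR) => c (q.1, q.2.2)).
Proof.
move=> mc; apply: measurableT_comp mc _; apply: measurable_fun_pair => //.
exact: measurableT_comp measurable_snd measurable_snd.
Qed.

Lemma measurable_delay (k : mR -> R) : measurable_fun setT k ->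
  measurable_fun setT (fun q : T * (mR * mR) => k (q.2.2 - q.2.1)).
Proof.
move=> mk; apply: measurableT_comp mk _; apply: measurable_funB.
  exact: measurableT_comp measurable_snd measurable_snd.
exact: measurableT_comp measurable_fst measurable_snd.
Qed.

(** Tonelli with [s] innermost: translation by [t] gives the kernel its total mass, whatever [t]
    is. *)
Lemma ge0_integral_delay_fst (k : mR -> R) (c : T * mR -> R) :
  measurable_fun setT k -> (forall r, 0 <= k r) ->
  measurable_fun setT c -> (forall q, 0 <= c q) ->
  (\int[P3]_q (k (q.2.2 - q.2.1) * c (q.1, q.2.1))%:E =
   (\int[leb]_r (k r)%:E) * \int[P2]_q (c q)%:E)%E.
Proof.
move=> mk k0 mc c0.
have mf : measurable_fun setT
    (fun q : T * (mR * mR) => (k (q.2.2 - q.2.1) * c (q.1, q.2.1))%:E).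
  apply/measurable_EFinP; apply: measurable_funM; first exact: measurable_delay.
  exact: measurable_proj_fst.
rewrite fubini_tonelli1//=; last by move=> q; rewrite lee_fin mulr_ge0.
rewrite fubini_tonelli1//=; last exact/measurable_EFinP.
rewrite -ge0_integralZl//=; first last.
- by apply: integral_ge0 => r _; rewrite lee_fin.
- by move=> w _; apply: integral_ge0 => r _; rewrite lee_fin.
- apply: (measurable_fun_fubini_tonelli_F (m2 := leb) (fun q => (c q)%:E)) => //=.
  exact/measurable_EFinP.
apply: eq_integral => w _; rewrite /fubini_F.
rewrite fubini_tonelli1//=; first last.
- by move=> q; rewrite lee_fin mulr_ge0.
- exact: measurableT_comp mf (measurable_pair1 w).
rewrite -ge0_integralZl//=; first last.
- by apply: integral_ge0 => r _; rewrite lee_fin.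
- by move=> t _; rewrite lee_fin.
- by apply/measurable_EFinP; exact: measurableT_comp mc (measurable_pair1 w).
apply: eq_integral => t _; rewrite /fubini_F/=.
under eq_integral do rewrite EFinM.
have mks : measurable_fun setT (fun s : mR => (k (s - t))%:E).
  apply/measurable_EFinP; apply: measurableT_comp mk _; exact: measurable_funB.
rewrite ge0_integralZr//=; last 2 first.
- by move=> s _; rewrite lee_fin.
- by rewrite lee_fin.
congr *%E; apply: (@ge0_integral_shift R t (fun r => (k r)%:E)) => //.
exact/measurable_EFinP.
Qed.

(** Tonelli with [t] innermost: here the kernel is reflected before it is translated. *)
Lemma ge0_integral_delay_snd (k : mR -> R) (c : T * mR -> R) :
  measurable_fun setT k -> (forall r, 0 <= k r) ->
  measurable_fun setT c -> (forall q, 0 <= c q) ->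
  (\int[P3]_q (k (q.2.2 - q.2.1) * c (q.1, q.2.2))%:E =
   (\int[leb]_r (k r)%:E) * \int[P2]_q (c q)%:E)%E.
Proof.
move=> mk k0 mc c0.
have mf : measurable_fun setT
    (fun q : T * (mR * mR) => (k (q.2.2 - q.2.1) * c (q.1, q.2.2))%:E).
  apply/measurable_EFinP; apply: measurable_funM; first exact: measurable_delay.
  exact: measurable_proj_snd.
rewrite fubini_tonelli1//=; last by move=> q; rewrite lee_fin mulr_ge0.
rewrite fubini_tonelli1//=; last exact/measurable_EFinP.
rewrite -ge0_integralZl//=; first last.
- by apply: integral_ge0 => r _; rewrite lee_fin.
- by move=> w _; apply: integral_ge0 => r _; rewrite lee_fin.
- apply: (measurable_fun_fubini_tonelli_F (m2 := leb) (fun q => (c q)%:E)) => //=.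
  exact/measurable_EFinP.
apply: eq_integral => w _; rewrite /fubini_F.
rewrite fubini_tonelli2//=; first last.
- by move=> q; rewrite lee_fin mulr_ge0.
- exact: measurableT_comp mf (measurable_pair1 w).
rewrite -ge0_integralZl//=; first last.
- by apply: integral_ge0 => r _; rewrite lee_fin.
- by move=> t _; rewrite lee_fin.
- by apply/measurable_EFinP; exact: measurableT_comp mc (measurable_pair1 w).
apply: eq_integral => s _; rewrite /fubini_G/=.
under eq_integral do rewrite EFinM.
have mks : measurable_fun setT (fun t : mR => (k (s - t))%:E).
  apply/measurable_EFinP; apply: measurableT_comp mk _; exact: measurable_funB.
rewrite ge0_integralZr//=; last 2 first.
- by move=> t _; rewrite lee_fin.
- by rewrite lee_fin.
congr *%E; apply: (@ge0_integral_reflect R s (fun r => (k r)%:E)) => //.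
exact/measurable_EFinP.
Qed.

Let integrable_delay_of (F : T * (mR * mR) -> R) (k : mR -> R) (c : T * mR -> R) :
  measurable_fun setT F -> (forall q, 0 <= F q) ->
  leb.-integrable setT (EFin \o k) -> (forall r, 0 <= k r) ->
  P2.-integrable setT (EFin \o c) -> (forall q, 0 <= c q) ->
  (\int[P3]_q (F q)%:E = (\int[leb]_r (k r)%:E) * \int[P2]_q (c q)%:E)%E ->
  P3.-integrable setT (EFin \o F).
Proof.
move=> mF F0 ik k0 ic c0 FE; apply/integrableP; split; first exact/measurable_EFinP.
under eq_integral do rewrite gee0_abs ?lee_fin//.
by rewrite FE -(EFin_Rintegral ik) -(EFin_Rintegral ic) -EFinM ltry.
Qed.

Lemma integrable_delay_fst (k : mR -> R) (c : T * mR -> R) :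
  leb.-integrable setT (EFin \o k) -> (forall r, 0 <= k r) ->
  P2.-integrable setT (EFin \o c) -> (forall q, 0 <= c q) ->
  P3.-integrable setT (EFin \o (fun q => k (q.2.2 - q.2.1) * c (q.1, q.2.1))).
Proof.
move=> ik k0 ic c0; have [mk mc] := (integrable_measurable ik, integrable_measurable ic).
apply: (integrable_delay_of _ _ ik k0 ic c0).
- apply: measurable_funM; first exact: measurable_delay.
  exact: measurable_proj_fst.
- by move=> q; rewrite mulr_ge0.
- exact: ge0_integral_delay_fst.
Qed.

Lemma integrable_delay_snd (k : mR -> R) (c : T * mR -> R) :
  leb.-integrable setT (EFin \o k) -> (forall r, 0 <= k r) ->
  P2.-integrable setT (EFin \o c) -> (forall q, 0 <= c q) ->
  P3.-integrable setT (EFin \o (fun q => k (q.2.2 - q.2.1) * c (q.1, q.2.2))).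
Proof.
move=> ik k0 ic c0; have [mk mc] := (integrable_measurable ik, integrable_measurable ic).
apply: (integrable_delay_of _ _ ik k0 ic c0).
- apply: measurable_funM; first exact: measurable_delay.
  exact: measurable_proj_snd.
- by move=> q; rewrite mulr_ge0.
- exact: ge0_integral_delay_snd.
Qed.

Lemma integrable_young1 (k : mR -> R) (a b : T * mR -> R) :
  leb.-integrable setT (EFin \o k) -> (forall r, 0 <= k r) ->
  sq_integrable P2 a -> sq_integrable P2 b ->
  P3.-integrable setT
    (EFin \o (fun q => k (q.2.2 - q.2.1) * (a (q.1, q.2.1) * b (q.1, q.2.2)))).
Proof.
move=> ik k0 /sq_integrableP[ma ia] /sq_integrableP[mb ib].
have mk := integrable_measurable ik.
apply: le_integrableR (integrableDR
  (integrable_delay_fst ik k0 ia (fun q => sqr_ge0 (a q)))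
  (integrable_delay_snd ik k0 ib (fun q => sqr_ge0 (b q)))) _.
  apply: measurable_funM; first exact: measurable_delay.
  by apply: measurable_funM; [exact: measurable_proj_fst|exact: measurable_proj_snd].
move=> q; rewrite -mulrDr normrM ger0_norm// ler_wpM2l//.
set x := a _; set y := b _.
have := (sqr_ge0 (x + y), sqr_ge0 (x - y)).
by rewrite ler_norml !expr2 => -[h1 h2]; apply/andP; split; nra.
Qed.

(** For the diffusion, whose kernel is only square integrable: the square of the product is again a
    delay product, with the integrable kernel [k^2]. *)
Lemma sq_integrable_delay (k : mR -> R) (a : T * mR -> R) :
  sq_integrable leb k -> sq_integrable P2 a ->
  sq_integrable P3 (fun q => k (q.2.2 - q.2.1) * a (q.1, q.2.1)).
Proof.
move=> /sq_integrableP[mk ik] /sq_integrableP[ma ia]; apply/sq_integrableP; split.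
  by apply: measurable_funM; [exact: measurable_delay|exact: measurable_proj_fst].
under eq_fun do rewrite exprMn.
exact: integrable_delay_fst ik (fun r => sqr_ge0 (k r)) ia (fun q => sqr_ge0 (a q)).
Qed.

End delay_kernel.

(** * Gaussian moments *)

Section density.
Context d (T : measurableType d) (R : realType).
Variables (mu nu : {measure set T -> \bar R}) (g : T -> R).
Hypotheses (mg : measurable_fun setT g) (g0 : forall x, 0 <= g x).
Hypothesis nuE : forall A, measurable A -> nu A = (\int[mu]_(x in A) (g x)%:E)%E.
Import HBNNSimple.

(** Both sides are monotone limits of their values on simple functions, where the formula for sets
    applies level by level. *)
Lemma ge0_integral_density (f : T -> R) : measurable_fun setT f ->
  (forall x, 0 <= f x) ->
  (\int[nu]_x (f x)%:E = \int[mu]_x (f x * g x)%:E)%E.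
Proof.
move=> mf f0.
have mfE : measurable_fun setT (EFin \o f) by exact/measurable_EFinP.
have fE0 x : setT x -> (0 <= (EFin \o f) x)%E by move=> _; rewrite lee_fin.
pose h n : {nnsfun T >-> R} := nnsfun_approx measurableT mfE n.
have hc x : (fun n => (h n x)%:E) @ \oo --> (f x)%:E.
  exact: (cvg_nnsfun_approx measurableT mfE fE0 I).
have hnd x : nondecreasing_seq (fun n => h n x).
  by move=> m n mn; exact/lefP/nd_nnsfun_approx.
have mh n : measurable_fun setT (h n) by exact: measurable_funP.
transitivity (limn (fun n => \int[nu]_x (h n x)%:E)%E).
  rewrite -monotone_convergence//.
  - by apply: eq_integral => x _; apply/esym/cvg_lim.
  - by move=> n; exact/measurable_EFinP.
  - by move=> n x _; rewrite lee_fin.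
  - by move=> x _ m n mn; rewrite lee_fin; exact: hnd.
transitivity (limn (fun n => \int[mu]_x (h n x * g x)%:E)%E); last first.
  rewrite -monotone_convergence//.
  - apply: eq_integral => x _; apply/cvg_lim => //.
    apply/fine_cvgP; split; first exact: nearW.
    by have := cvgMr_tmp (fine_cvg (hc x)); apply.
  - by move=> n; apply/measurable_EFinP; exact: measurable_funM.
  - by move=> n x _; rewrite lee_fin mulr_ge0.
  - by move=> x _ m n mn; rewrite lee_fin ler_wpM2r//; exact: hnd.
congr (limn _); apply/funext => n.
have mA y : measurable (h n @^-1` [set y]) by [].
transitivity (\sum_(y \in range (h n))
    \int[nu]_x (y * \1_(h n @^-1` [set y]) x)%:E)%E.
  under eq_integral do rewrite fimfunE -fsumEFin//.
  rewrite ge0_integral_fsum//.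
  - by move=> y; exact/measurable_EFinP/measurable_funM.
  - by move=> y x _; rewrite nnfun_muleindic_ge0.
transitivity (\sum_(y \in range (h n))
    \int[mu]_x ((y * \1_(h n @^-1` [set y]) x) * g x)%:E)%E; last first.
  rewrite -ge0_integral_fsum//.
  - apply: eq_integral => x _; rewrite fsumEFin//; congr EFin.
    by rewrite -[LHS]mulr_fsuml -fimfunE.
  - by move=> y; apply/measurable_EFinP; do 2 apply: measurable_funM => //.
  - move=> y x _; rewrite EFinM mule_ge0// ?lee_fin//.
    by have := nnfun_muleindic_ge0 (h n) y x; rewrite -EFinM lee_fin.
apply: eq_fsbigr => y /set_mem[z _ <-].
have hz : 0 <= h n z by [].
under eq_integral do rewrite EFinM.
under [in RHS]eq_integral do rewrite -mulrA EFinM.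
rewrite !ge0_integralZl//.
- congr (_ * _)%E; rewrite integral_indic// setIT nuE//.
  rewrite integral_mkcond; apply: eq_integral => x _.
  by rewrite patchE indicE; case: ifP; rewrite (mul1r,mul0r).
- by apply/measurable_EFinP; exact: measurable_funM.
- by move=> x _; rewrite lee_fin mulr_ge0.
- exact/measurable_EFinP.
Qed.
End density.

Section gaussian_moments.
Context {R : realType}.
Variable s : R.
Hypothesis s0 : 0 < s.
Notation leb := (@lebesgue_measure R).
Local Notation g := (normal_pdf 0 s).

Let s2 : s ^+ 2 *+ 2 = 2 * s ^+ 2. Proof. by rewrite mulr2n; ring. Qed.

Let gE x : g x = normal_peak s * expR (- x ^+ 2 / (s ^+ 2 *+ 2)).
Proof. by rewrite normal_pdfE ?gt_eqF// /normal_fun subr0. Qed.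

Let dg (x : R) : is_derive x 1 g (- (x / s ^+ 2) * g x).
Proof.
have -> : g = (fun x => normal_peak s * expR (- x ^+ 2 / (s ^+ 2 *+ 2))).
  by apply/funext => y; exact: gE.
pose u (y : R) : R := - y ^+ 2 / (s ^+ 2 *+ 2).
have du : is_derive x 1 u (- (x / s ^+ 2)).
  apply: is_derive_eq; rewrite /GRing.scale/= s2.
  by field; rewrite gt_eqF.
have de : is_derive x 1 (expR \o u) (expR (u x) * - (x / s ^+ 2)).
  exact: is_derive1_comp.
have dz := is_deriveZ (normal_peak s) de.
rewrite (_ : - (x / s ^+ 2) * _ = normal_peak s *: (expR (u x) * - (x / s ^+ 2))).
  exact: dz.
by rewrite /GRing.scale/= -/(u x); ring.
Qed.

(** Integration by parts in the form of an antiderivative: the second moment minus [s^2] times the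
    mass is a boundary term. *)
Let dxg (x : R) : is_derive x 1 (fun y => - (s ^+ 2 * (y * g y))) ((x ^+ 2 - s ^+ 2) * g x).
Proof.
have dg' := dg x.
apply: is_derive_eq; rewrite /GRing.scale/=.
by field; rewrite gt_eqF.
Qed.

Let cg : continuous g. Proof. by apply: continuous_normal_pdf; rewrite gt_eqF. Qed.

Let cx2g : continuous (fun x : R => x ^+ 2 * g x).
Proof. by move=> x; apply: cvgM; [exact: exprn_continuous|exact: cg]. Qed.

Let cf : continuous (fun x : R => (x ^+ 2 - s ^+ 2) * g x).
Proof.
move=> x; apply: cvgM; last exact: cg.
by apply: cvgB; [exact: exprn_continuous|exact: cvg_cst].
Qed.

Let itvn (n : nat) : set R := `[(- n%:R)%R, n%:R]%classic.

Let integrable_itvn n (f : R -> R) : continuous f ->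
  leb.-integrable (itvn n) (EFin \o f).
Proof.
move=> cf'; apply: continuous_compact_integrable; first exact: segment_compact.
by apply: continuous_subspaceT => x; exact: cf'.
Qed.

(** Since [g] is even, the two ends of the interval contribute equally to the boundary term. *)
Let ftc n : (0 < n)%N -> (\int[leb]_(x in itvn n) (x ^+ 2 * g x)%:E =
  (s ^+ 2)%:E * \int[leb]_(x in itvn n) (g x)%:E - (2 * s ^+ 2 * (n%:R * g n%:R))%:E)%E.
Proof.
move=> n0; have n0' : (- n%:R < n%:R :> R) by rewrite gtrN// ltr0n.
have H := @continuous_FTC2 R (fun x : R => (x ^+ 2 - s ^+ 2) * g x)
  (fun y => - (s ^+ 2 * (y * g y))) _ _ n0'.
have gN x : g (- x) = g x by rewrite !gE sqrrN.
have -> : (- (2 * s ^+ 2 * (n%:R * g n%:R))%:E =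
    (- (s ^+ 2 * (n%:R * g n%:R)))%:E - (- (s ^+ 2 * (- n%:R * g (- n%:R))))%:E)%E.
  by rewrite -!EFinN -EFinD gN; congr EFin; ring.
rewrite -integralZl//; last exact: integrable_itvn.
rewrite -H.
- have i1 := integrable_itvn n cx2g; have i2 := integrable_itvn n cg.
  have i3 := integrable_itvn n cf.
  under [X in (X + _)%E]eq_integral do rewrite -EFinM.
  rewrite -(integralD_EFin _ (integrableZl _ (s ^+ 2) i2) i3)//.
  by apply: eq_integral => x _; rewrite -EFinD; congr EFin; ring.
- exact: measurable_itv.
- exact: measurable_itv.
- by apply: continuous_subspaceT => x; exact: cf.
- have cF : continuous (fun y : R => - (s ^+ 2 * (y * g y))).
    move=> x; apply: cvgN; apply: cvgM; first exact: cvg_cst.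
    by apply: cvgM; [exact: cvg_id|exact: cg].
  split.
  + by move=> x _; by have [] := dxg x.
  + by apply: cvg_at_right_filter; exact: cF.
  + by apply: cvg_at_left_filter; exact: cF.
- by move=> x _; rewrite derive1E; have [_ ->] := dxg x.
- exact: measurable_itv.
Qed.

Let itvn_cvg (f : R -> R) : continuous f -> (forall x, 0 <= f x) ->
  (fun n => \int[leb]_(x in itvn n) (f x)%:E)%E @ \oo --> (\int[leb]_x (f x)%:E)%E.
Proof.
move=> cf' f0.
have -> : [set: R] = \bigcup_n itvn n.
  apply/seteqP; split=> // x _; exists (Num.truncn `|x|).+1 => //.
  by rewrite /itvn/= in_itv/= -ler_norml ltW// truncnS_gt.
apply: ge0_nondecreasing_set_cvg_integral => //.
- move=> m n mn; apply/subsetPset => x; rewrite /itvn/= !in_itv/= => /andP[a b].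
  have mn' : (m%:R <= n%:R :> R) by rewrite ler_nat.
  by rewrite (le_trans _ a) ?lerN2// (le_trans b).
- by move=> n; exact: measurable_itv.
- move=> n; apply/measurable_EFinP; apply: measurable_funTS.
  exact: continuous_measurable_fun.
- by move=> n x _; rewrite lee_fin.
Qed.

(** With [z = n^2 / (2 s^2)], the bound [expR (- z) <= z^-1] gives [n g(n) <= c / n]. *)
Let ng0 : (fun n => 2 * s ^+ 2 * (n%:R * g n%:R)) @ \oo --> (0 : R).
Proof.
have np0 : 0 <= normal_peak s by exact: normal_peak_ge0.
have h : (fun n : nat => 4 * s ^+ 4 * normal_peak s * n.+1%:R^-1) @ \oo --> (0 : R).
  rewrite -[X in _ --> X](mulr0 (4 * s ^+ 4 * normal_peak s)).
  by apply: cvgMl_tmp; exact: cvg_harmonic.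
(* The shift by one avoids the division by 0 at the first index. *)
rewrite -(cvg_shiftS).
apply: (@squeeze_cvgr _ _ _ _ (fun=> 0) (fun n : nat => 4 * s ^+ 4 * normal_peak s * n.+1%:R^-1)).
- apply: nearW => n; apply/andP; split.
    by apply: mulr_ge0; [exact: mulr_ge0 (sqr_ge0 _)|exact: mulr_ge0 (normal_pdf_ge0 _ _ _)].
  rewrite /= gE; set y := n.+1%:R; have y0 : 0 < y by rewrite ltr0n.
  have z0 : 0 < y ^+ 2 / (s ^+ 2 *+ 2).
    by rewrite divr_gt0 ?exprn_gt0// s2 mulr_gt0 ?exprn_gt0.
  have e1 : expR (- y ^+ 2 / (s ^+ 2 *+ 2)) <= (y ^+ 2 / (s ^+ 2 *+ 2))^-1.
    by rewrite mulNr expRN lef_pV2 ?posrE ?expR_gt0// (le_trans _ (expR_ge1Dx _))// lerDr.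
  have -> : 4 * s ^+ 4 * normal_peak s * y^-1 =
      2 * s ^+ 2 * (y * (normal_peak s * (y ^+ 2 / (s ^+ 2 *+ 2))^-1)).
    by rewrite s2; field; rewrite !gt_eqF.
  by rewrite !ler_wpM2l// ?mulr_ge0 ?sqr_ge0// ltW.
- exact: cvg_cst.
- exact: h.
Qed.

Lemma integral_normal_pdf_sqr : (\int[leb]_x (x ^+ 2 * g x)%:E = (s ^+ 2)%:E)%E.
Proof.
have c1 := itvn_cvg cx2g (fun x => mulr_ge0 (sqr_ge0 x) (normal_pdf_ge0 0 s x)).
have c2 := itvn_cvg cg (normal_pdf_ge0 0 s).
rewrite integral_normal_pdf in c2.
have c3 : (fun n => (s ^+ 2)%:E * \int[leb]_(x in itvn n) (g x)%:E -
    (2 * s ^+ 2 * (n%:R * g n%:R))%:E)%E @ \oo --> ((s ^+ 2)%:E * 1 - 0%:E)%E.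
  apply: cvgeB => //; first by apply: cvgeZl.
  by apply/fine_cvgP; split; [exact: nearW|exact: ng0].
rewrite mule1 sube0 in c3.
apply: (cvg_unique (@ereal_hausdorff R) c1); apply: cvg_trans c3.
apply: near_eq_cvg; exists 1%N => // n /= n0; rewrite ftc//.
Qed.

End gaussian_moments.

Section gaussian_variable.
Context d (T : measurableType d) (R : realType).
Variable P : probability T R.
Notation leb := (@lebesgue_measure R).
Notation mR := (measurableTypeR R).
Local Notation intble f := (P.-integrable setT (EFin \o f)).

Lemma sq_integrable_cst (k : R) : sq_integrable P (fun=> k).
Proof.
split=> //; have := integral_cst P (@measurableT _ T) (k ^+ 2)%:E.
by rewrite /cst => ->; rewrite [X in (_ * X)%E]probability_setT mule1 ltry.
Qed.

Lemma sq_integrable_integrable (f : T -> R) : sq_integrable P f -> intble f.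
Proof.
move=> sf; have := sq_integrable_mul sf (sq_integrable_cst 1).
by under eq_fun do rewrite mulr1.
Qed.

Lemma normal_prob_opp (s : R) (A : set R) : 0 < s -> measurable A ->
  normal_prob 0 s (-%R @^-1` A) = normal_prob 0 s A.
Proof.
move=> s0 mA; rewrite /normal_prob.
rewrite integral_mkcond [RHS]integral_mkcond.
rewrite -[RHS]ge0_integral_opp.
- apply: eq_integral => x _; rewrite !patchE.
  have -> : (x \in -%R @^-1` A) = (- x \in A) by apply/idP/idP => /set_mem h; exact/mem_set.
  by case: ifP => // _; rewrite !normal_pdfE ?gt_eqF// /normal_fun !subr0 sqrrN.
- apply/(measurable_restrictT _ _).1 => //; apply/measurable_EFinP.
  by apply: measurable_funTS; exact: measurable_normal_pdf.
- move=> x; rewrite patchE; case: ifP => _ //.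
  by rewrite lee_fin normal_pdf_ge0.
Qed.

Variables (X : T -> R) (s : R).
Hypotheses (s0 : 0 < s) (mX : measurable_fun setT X).
Hypothesis XN : forall B : set mR, measurable B -> P (X @^-1` B) = normal_prob 0 s B.

Lemma integral_gaussian_sqr : (\int[P]_w (X w ^+ 2)%:E = (s ^+ 2)%:E)%E.
Proof.
have mX' : measurable_fun setT (X : T -> mR) by [].
have msq : measurable_fun setT (fun x : mR => (x ^+ 2)%:E).
  by apply/measurable_EFinP; exact: exprn_measurable.
have := ge0_integral_pushforward mX' P measurableT msq.
rewrite preimage_setT => /(_ _)/esym/= ->; last first.
  by move=> x _; rewrite lee_fin sqr_ge0.
rewrite -(integral_normal_pdf_sqr s0) -(@ge0_integral_density _ mR R leb (normal_prob 0 s)).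
- by apply: eq_measure_integral => A mA _; exact: XN.
- exact: measurable_normal_pdf.
- exact: normal_pdf_ge0.
- by [].
- exact: exprn_measurable.
- by move=> x; exact: sqr_ge0.
Qed.

Lemma gaussian_sq_integrable : sq_integrable P X.
Proof. by split=> //; rewrite integral_gaussian_sqr ltry. Qed.

(** The law is symmetric, so the mean equals its own opposite. *)
Lemma integral_gaussian : \int[P]_w X w = 0.
Proof.
have iX := sq_integrable_integrable gaussian_sq_integrable.
have mX' : measurable_fun setT (X : T -> mR) by [].
have mid : measurable_fun setT (fun x : mR => x%:E) by exact/measurable_EFinP.
have mN : measurable_fun setT (-%R : mR -> mR) by exact: oppr_measurable.
pose nu := pushforward P (X : T -> mR).
have inu : (pushforward P (X : T -> mR)).-integrable setT (fun x : mR => x%:E).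
  by apply: integrable_pushforward.
have e1 := @integral_pushforward _ _ _ _ R _ mX' P setT _ mid iX measurableT.
have sy (A : set mR) : measurable A -> pushforward nu (-%R : mR -> mR) A = nu A.
  move=> mA; change (P (X @^-1` (-%R @^-1` A)) = P (X @^-1` A)).
  have mA' : measurable (-%R @^-1` A : set mR).
    by rewrite -[X in measurable X]setTI; exact: mN.
  by rewrite XN// XN// normal_prob_opp.
have iN : (pushforward P (X : T -> mR)).-integrable setT (fun x : mR => (- x)%:E).
  exact: (integrableN inu).
have e2 := @integral_pushforward _ _ mR mR R _ mN _ setT _ mid iN measurableT.
have e3 : (\int[pushforward nu (-%R : mR -> mR)]_x x%:E = \int[nu]_x x%:E)%E.
  by apply: eq_measure_integral => A mA _; exact: sy.
rewrite preimage_setT/= in e1 e2.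
have e4 : (\int[nu]_x (- x)%:E = - \int[nu]_x x%:E)%E.
  rewrite -[RHS]mulN1e -EFinN -(integralZl measurableT inu).
  by apply: eq_integral => x _; rewrite -EFinM mulN1r.
have : (\int[P]_w (X w)%:E = - \int[P]_w (X w)%:E)%E.
  transitivity (\int[nu]_x x%:E)%E; first exact/esym/e1.
  transitivity (\int[nu]_x (- x)%:E)%E; first by rewrite -e3; exact: e2.
  by rewrite e4; congr oppe; exact: e1.
by rewrite -(EFin_Rintegral iX) -EFinN => -[h]; lra.
Qed.

End gaussian_variable.

(** * Brownian increments *)

Section filtration.
Context {R : realType} {disp : measure_display} {T : measurableType disp}.
Variables (P : probability T R) (d : nat) (W : T -> R -> 'cV[R]_d).
Hypotheses (cP : measure_is_complete P) (bm : brownian_motion P W).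
Notation mR := (measurableTypeR R).
Notation F := (aug_filtration P W).
Local Notation intble f := (P.-integrable setT (EFin \o f)).

Let mW t i : 0 <= t -> measurable_fun setT (fun w => W w t i 0).
Proof. by have [h _ _ _] := bm; exact: h. Qed.

Lemma natural_events_measurable t A : natural_events W t A -> measurable A.
Proof.
move=> [s [i [B [/andP[s0 _] mB ->]]]].
by rewrite -[X in measurable X]setTI; exact: mW.
Qed.

Lemma natural_filtration_measurable t : natural_filtration W t `<=` measurable.
Proof.
apply: smallest_sub; first exact: sigma_algebra_measurable.
exact: natural_events_measurable.
Qed.

Lemma aug_filtration_measurable t : F t `<=` measurable.
Proof.
apply: smallest_sub; first exact: sigma_algebra_measurable.
by move=> A [/natural_events_measurable//|]; exact: cP.
Qed.

Lemma aug_filtration_sigma t : sigma_algebra setT (F t).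
Proof. exact: smallest_sigma_algebra. Qed.

Lemma aug_filtrationS s t : s <= t -> F s `<=` F t.
Proof.
move=> st; apply: smallest_sub; first exact: aug_filtration_sigma.
move=> A nA; apply: sub_sigma_algebra; case: nA => [|nA]; last by right.
move=> [r [i [B [/andP[r0 rs] mB ->]]]]; left; exists r, i, B; split=> //.
by rewrite r0 (le_trans rs).
Qed.

Lemma meas_wrt_aug t s i : 0 <= s <= t -> meas_wrt (F t) (fun w => W w s i 0).
Proof. by move=> st B mB; apply: sub_sigma_algebra; left; exists s, i, B. Qed.

(** The sets that differ from a natural event by a negligible set form a sigma-algebra, which
    contains both kinds of generators of the augmentation. *)
Let aug_approx t A : F t A -> exists2 A', natural_filtration W t A' &
  P.-negligible ((A `\` A') `|` (A' `\` A)).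
Proof.
pose S := [set A | exists2 A', natural_filtration W t A' &
  P.-negligible ((A `\` A') `|` (A' `\` A))].
have [n0 nC nU] : sigma_algebra setT (natural_filtration W t).
  exact: smallest_sigma_algebra.
suff : F t `<=` S by exact.
apply: smallest_sub; last first.
  move=> B [nB|nB].
    exists B; first exact: sub_sigma_algebra.
    by rewrite !setDv setU0; exact: negligible_set0.
  exists set0 => //; apply: negligibleS nB.
  by rewrite setD0 set0D setU0.
split.
- by exists set0 => //; rewrite !setDv setU0; exact: negligible_set0.
- move=> B [B' nB' BB']; exists (setT `\` B'); first exact: nC.
  apply: negligibleS BB' => x /= [[[_ nBx] nB'x]|[[_ nB'x] nBx]].
    right; split=> //; apply: contrapT => h; exact: nB'x.
  left; split=> //; apply: contrapT => h; exact: nBx.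
- move=> B nB; have /choice[B' hB'] n : exists X, natural_filtration W t X /\
     P.-negligible ((B n `\` X) `|` (X `\` B n)).
    by have [X ? ?] := nB n; exists X.
  exists (\bigcup_n B' n); first by apply: nU => n; exact: (hB' n).1.
  apply: negligibleS (negligible_bigcup (fun n => (hB' n).2)) => x /=.
  move=> [[[n _ Bx] nB'x]|[[n _ B'x] nBx]]; exists n => //.
    by left; split=> // h; apply: nB'x; exists n.
  by right; split=> // h; apply: nBx; exists n.
Qed.

(** A Brownian motion is defined by independence from its natural filtration. Replacing an event by
    a natural event at null distance changes neither probability. *)
Lemma aug_filtration_increment s t : 0 <= s < t ->
  forall (A : set T) (B : 'I_d -> set R), F s A -> (forall i, measurable (B i)) ->
    P (A `&` [set w | forall i, B i (W w t i 0 - W w s i 0)])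
    = (P A * \prod_i normal_prob 0 (Num.sqrt (t - s)) (B i))%E.
Proof.
move=> /[dup] st /andP[s0 /ltW s_t] A B FA mB.
have [_ _ _ /(_ _ _ st) inc] := bm.
have [A' nA' N0] := aug_approx FA.
have mA := aug_filtration_measurable FA.
have mA' := natural_filtration_measurable nA'.
have mN : measurable ((A `\` A') `|` (A' `\` A)).
  by apply: measurableU; exact: measurableD.
have PN : P ((A `\` A') `|` (A' `\` A)) = 0%E by apply: measure_negligible.
have mE : measurable [set w | forall i, B i (W w t i 0 - W w s i 0)].
  rewrite (_ : [set w | _] = \bigcap_(i in [set: 'I_d])
      ((fun w => W w t i 0 - W w s i 0) @^-1` B i)); last first.
    by apply/seteqP; split=> [w h i _|w h i]; [exact: h|exact: (h i I)].
  apply: fin_bigcap_measurable => // i _.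
  rewrite -[X in measurable X]setTI.
  by apply: measurable_funB => //; apply: mW => //; exact: le_trans s_t.
(* [X] cut by [E] lies in [Y] cut by [E] together with the null symmetric difference; used in both
   directions, with the increment event and with the whole space. *)
have sub X Y E : measurable X -> measurable Y -> measurable E ->
    P ((X `\` Y) `|` (Y `\` X)) = 0%E -> (P (X `&` E) <= P (Y `&` E))%E.
  move=> mX mY mE' P0.
  have mD : measurable ((X `\` Y) `|` (Y `\` X)).
    by apply: measurableU; exact: measurableD.
  rewrite -[leRHS]adde0 -P0.
  apply: (@le_trans _ _ (P ((Y `&` E) `|` ((X `\` Y) `|` (Y `\` X))))).
    apply: le_measure.
    - by apply/mem_set; exact: measurableI.
    - by apply/mem_set; apply: measurableU => //; exact: measurableI.
    move=> w [Xw Ew]; have [Yw|nYw] := pselect (Y w); first by left.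
    by right; left.
  by apply: measureU2 => //; exact: measurableI.
have PN' : P ((A' `\` A) `|` (A `\` A')) = 0%E by rewrite setUC.
have h1 := sub A A' _ mA mA' mE PN; have h2 := sub A' A _ mA' mA mE PN'.
have h3 := sub A A' _ mA mA' measurableT PN.
have h4 := sub A' A _ mA' mA measurableT PN'.
rewrite !setIT in h3 h4.
have -> : P A = P A' by apply/eqP; rewrite eq_le h3 h4.
by rewrite -inc//; apply/eqP; rewrite eq_le h1 h2.
Qed.

End filtration.

Section independence.
Context d (T : measurableType d) (R : realType).
Variable P : probability T R.
Notation mR := (measurableTypeR R).
Local Notation intble f := (P.-integrable setT (EFin \o f)).

Lemma Rintegral_indic (A E : set T) : measurable A -> measurable E ->
  \int[P]_(w in E) \1_A w = fine (P (A `&` E)).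
Proof. by move=> mA mE; rewrite /Rintegral integral_indic. Qed.

Lemma integrable_indicR (A : set T) : measurable A -> intble (\1_A : T -> R).
Proof.
move=> mA; apply: (@le_integrableR _ _ _ P _ (fun=> 1)).
- exact: measurable_indic.
- exact: (sq_integrable_integrable (sq_integrable_cst P 1)).
- by move=> w; rewrite indicE; case: (_ \in _); rewrite ?normr1 ?normr0.
Qed.

(** Independence says that [\1_A - P A] is orthogonal to the events generated by [X], hence to the
    weight [f(X)]. *)
Lemma Rintegral_independent (A : set T) (X : T -> R) (f : R -> R) :
  measurable A -> measurable_fun setT X -> measurable_fun setT f ->
  (forall B : set mR, measurable B ->
     P (A `&` X @^-1` B) = P A * P (X @^-1` B))%E ->
  intble (f \o X) ->
  \int[P]_(w in A) f (X w) = fine (P A) * \int[P]_w f (X w).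
Proof.
move=> mA mX mf indep ifX.
pose G := preimage_set_system setT X measurable.
have sG : sigma_algebra setT G by exact/sigma_algebra_preimage/sigma_algebra_measurable.
have Gm : G `<=` measurable by move=> _ [B mB <-]; exact: mX.
have iA := integrable_indicR mA.
have mfX : meas_wrt G (f \o X).
  move=> B mB; rewrite -[(f \o X) @^-1` B]setTI; exists (f @^-1` B) => //.
  by rewrite -[X in measurable X]setTI; exact: mf.
have mAf : measurable_fun setT (\1_A : T -> R) by exact: measurable_indic.
have icst : intble (fun=> fine (P A)).
  exact: (sq_integrable_integrable (sq_integrable_cst P _)).
have i1 : intble (fun w => \1_A w * f (X w)).
  apply: le_integrableR (integrable_normR ifX) _.
    by apply: measurable_funM => //; exact: integrable_measurable ifX.
  move=> w; rewrite normrM ler_piMl// indicE; case: (_ \in _);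
    by rewrite ?normr1 ?normr0.
have i2 := integrableZR (fine (P A)) ifX.
have E : (fun w => (f \o X) w * (\1_A w - fine (P A))) =
    (fun w => \1_A w * f (X w) - fine (P A) * f (X w)).
  by apply/funext => w /=; ring.
have : \int[P]_w ((f \o X) w * (\1_A w - fine (P A))) = 0.
  apply: (orthogonal_meas_wrt sG Gm (integrableBR iA icst) _ mfX).
    move=> _ [B mB <-].
    have mE : measurable (X @^-1` B) by rewrite -[X in measurable X]setTI; exact: mX.
    rewrite setTI RintegralB//; last 2 first.
    - exact: integrableS (subsetT _) iA.
    - exact: integrableS (subsetT _) icst.
    rewrite Rintegral_indic// indep// Rintegral_cst//.
    by rewrite fineM ?fin_num_measure// subrr.
  by rewrite E; exact: integrableBR.
rewrite E RintegralB// => /eqP; rewrite subr_eq0 RintegralZl// => /eqP <-.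
rewrite Rintegral_mkcond; apply: eq_Rintegral => w _.
by rewrite patchE indicE; case: ifP; rewrite (mul1r,mul0r).
Qed.

End independence.

Section increments.
Context {R : realType} {disp : measure_display} {T : measurableType disp}.
Variables (P : probability T R) (d : nat) (W : T -> R -> 'cV[R]_d).
Hypotheses (cP : measure_is_complete P) (bm : brownian_motion P W).
Notation mR := (measurableTypeR R).
Notation F := (aug_filtration P W).
Local Notation intble f := (P.-integrable setT (EFin \o f)).

Definition increment (k : 'I_d) (s t : R) (w : T) : R := W w t k 0 - W w s k 0.
Local Notation dW := increment.

Lemma increment_addition k s r t w : dW k s t w = dW k s r w + dW k r t w.
Proof. by rewrite /increment; ring. Qed.

Lemma increment_refl k s w : dW k s s w = 0.
Proof. by rewrite /increment subrr. Qed.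

Lemma meas_wrt_increment k s t : 0 <= s <= t -> meas_wrt (F t) (dW k s t).
Proof.
move=> /andP[s0 st]; apply/(meas_wrtP (aug_filtration_sigma P W t)).
apply: measurable_funB; apply/(meas_wrtP (aug_filtration_sigma P W t)).
  by apply: meas_wrt_aug; rewrite lexx (le_trans s0).
by apply: meas_wrt_aug; rewrite s0.
Qed.

Lemma measurable_increment k s t : 0 <= s <= t -> measurable_fun setT (dW k s t).
Proof.
move=> st; have Fm : F t `<=` measurable by exact: aug_filtration_measurable.
exact: (meas_wrt_measurable Fm (meas_wrt_increment k st)).
Qed.

Section strict.
Variables s t : R.
Hypothesis st : 0 <= s < t.
Let st' : 0 <= s <= t. Proof. by case/andP: st => -> /ltW ->. Qed.
Local Notation N := (normal_prob 0 (Num.sqrt (t - s))).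

(** The joint law of all coordinates is used with the whole line, of probability 1, in every
    coordinate other than [k] and [j]. *)
Let increment_law2 k j A (B B' : set mR) : k != j -> F s A ->
  measurable B -> measurable B' ->
  P (A `&` dW k s t @^-1` B `&` dW j s t @^-1` B') = (P A * N B * N B')%E.
Proof.
move=> kj FA mB mB'.
pose C i := if i == k then B else if i == j then B' else setT.
have mC i : measurable (C i) by rewrite /C; do 2 case: ifP => //.
have := aug_filtration_increment cP bm st FA mC.
rewrite (bigD1 k)//= (bigD1 j) 1?eq_sym//= big1 ?mule1; last first.
  by move=> i /andP[/negbTE h1 /negbTE h2]; rewrite /C h1 h2; exact: probability_setT.
rewrite {2 3}/C !eqxx eq_sym (negbTE kj) -muleA => <-.
congr (P _); rewrite -setIA; congr (_ `&` _); apply/seteqP; split=> w /=.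
  by move=> [hk hj] i; rewrite /C; case: eqP => [->//|_]; case: eqP => [->//|].
move=> h; split; first by have := h k; rewrite /C eqxx.
by have := h j; rewrite /C eq_sym (negbTE kj) eqxx.
Qed.

Let increment_law k A (B : set mR) : F s A -> measurable B ->
  P (A `&` dW k s t @^-1` B) = (P A * N B)%E.
Proof.
move=> FA mB.
pose C i := if i == k then B else setT.
have mC i : measurable (C i) by rewrite /C; case: ifP.
have := aug_filtration_increment cP bm st FA mC.
rewrite (bigD1 k)//= big1 ?mule1; last first.
  by move=> i /negbTE h; rewrite /C h; exact: probability_setT.
rewrite {2}/C eqxx => <-.
congr (P _); congr (_ `&` _); apply/seteqP; split=> w /=.
  by move=> hk i; rewrite /C; case: eqP => [->//|].
by move=> h; have := h k; rewrite /C eqxx.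
Qed.

Let FT : F s setT.
Proof.
have [h0 hC _] := aug_filtration_sigma P W s.
by have := hC _ h0; rewrite setD0.
Qed.

Let increment_law0 k (B : set mR) : measurable B -> P (dW k s t @^-1` B) = N B.
Proof.
move=> mB; have := increment_law k FT mB.
by rewrite setTI => ->; rewrite [X in (X * _)%E]probability_setT mul1e.
Qed.

Let sd0 : 0 < Num.sqrt (t - s).
Proof. by rewrite sqrtr_gt0 subr_gt0; case/andP: st. Qed.

Let mdW k : measurable_fun setT (dW k s t). Proof. exact: measurable_increment. Qed.

Lemma increment_sq_integrable_lt k : sq_integrable P (dW k s t).
Proof. exact: gaussian_sq_integrable sd0 (mdW k) (increment_law0 k). Qed.

(** Stated for any event independent of the increment, and not only for events of [F s]: it is also
    applied to events that involve another coordinate of the same increment. *)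
Let Rintegral_increment_set k A : measurable A ->
  (forall B : set mR, measurable B -> P (A `&` dW k s t @^-1` B) = (P A * N B)%E) ->
  \int[P]_(w in A) dW k s t w = 0.
Proof.
move=> mA h; rewrite (@Rintegral_independent _ _ _ P A (dW k s t) idfun)//.
- by rewrite (integral_gaussian sd0 (mdW k) (increment_law0 k)) mulr0.
- exact: measurable_id.
- by move=> B mB; apply: etrans (h B mB) _; rewrite -(increment_law0 k).
- exact: sq_integrable_integrable (increment_sq_integrable_lt k).
Qed.

Lemma Rintegral_increment_lt k A : F s A -> \int[P]_(w in A) dW k s t w = 0.
Proof.
move=> FA; apply: Rintegral_increment_set.
  exact: aug_filtration_measurable FA.
by move=> B; exact: increment_law.
Qed.

(** Equal coordinates: Gaussian second moment and independence of the past. Distinct ones: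
    orthogonality. *)
Lemma Rintegral_increment_mul_lt k j A : F s A ->
  \int[P]_(w in A) (dW k s t w * dW j s t w) = (k == j)%:R * (t - s) * fine (P A).
Proof.
move=> FA; have mA := aug_filtration_measurable cP bm FA.
have sk := increment_sq_integrable_lt k; have sj := increment_sq_integrable_lt j.
have [<-{j sj}|kj] := eqVneq k j.
  rewrite (@Rintegral_independent _ _ _ P A (dW k s t) (fun x => x * x))//.
  - rewrite mul1r mulrC; congr *%R; apply/EFin_inj.
    rewrite EFin_Rintegral; last exact: sq_integrable_mul.
    under eq_integral do rewrite -expr2.
    rewrite (integral_gaussian_sqr sd0 (mdW k) (increment_law0 k)) sqr_sqrtr//.
    by rewrite subr_ge0; case/andP: st => _ /ltW.
  - exact: measurable_funM.
  - by move=> B mB; apply: etrans (increment_law k FA mB) _; rewrite -(increment_law0 k).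
  - exact: sq_integrable_mul.
rewrite !mul0r Rintegral_mkcond.
(* [dW j] serves as a weight for its own sigma-algebra [G]. The events [A] cut by a condition on
   [dW j] are still independent of [dW k], so [dW k] restricted to [A] is orthogonal to [G]. *)
pose G := preimage_set_system setT (dW j s t) measurable.
have sG : sigma_algebra setT G by exact/sigma_algebra_preimage/sigma_algebra_measurable.
have Gm : G `<=` measurable by move=> _ [B mB <-]; exact: mdW.
have iA : intble (dW k s t \_ A).
  rewrite -restrict_EFin; apply/integrable_restrict => //; rewrite setTI.
  by apply: integrableS (subsetT _) (sq_integrable_integrable sk).
rewrite (_ : _ \_ A = fun w => dW j s t w * (dW k s t \_ A) w); last first.
  by apply/funext => w; rewrite !patchE; case: ifP => _; [exact: mulrC|rewrite mulr0].
apply: (orthogonal_meas_wrt sG Gm iA).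
- move=> _ [B' mB' <-]; rewrite setTI -Rintegral_mkcondr.
  have mB'' : measurable (dW j s t @^-1` B').
    by rewrite -[X in measurable X]setTI; exact: mdW.
  apply: Rintegral_increment_set; first exact: measurableI.
  move=> B mB; rewrite [_ `&` A]setIC setIAC increment_law2//.
  by rewrite increment_law// muleAC.
- by move=> B mB; exists B => //; rewrite setTI.
- apply: le_integrableR (integrable_normR (sq_integrable_mul sk sj)) _.
    apply: measurable_funM => //; exact: integrable_measurable iA.
  move=> w; rewrite patchE; case: ifP => _; last by rewrite mulr0 normr0.
  by rewrite mulrC.
Qed.

End strict.
End increments.

(** * The Ito isometry *)

Section product_integral.
Context d (T : measurableType d) (R : realType).
Variable P : probability T R.
Notation leb := (@lebesgue_measure R).
Notation mR := (measurableTypeR R).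

Lemma integrable_prod_mul (f : T -> R) (g : mR -> R) :
  P.-integrable setT (EFin \o f) -> leb.-integrable setT (EFin \o g) ->
  (P \x leb)%E.-integrable setT (EFin \o (fun q => f q.1 * g q.2)).
Proof.
move=> fi gi; have [mf mg] := (integrable_measurable fi, integrable_measurable gi).
have mfg : measurable_fun setT (fun q : T * mR => (f q.1 * g q.2)%:E).
  apply/measurable_EFinP; apply: measurable_funM.
    exact: measurableT_comp mf measurable_fst.
  exact: measurableT_comp mg measurable_snd.
have [fi' gi'] := (integrable_normR fi, integrable_normR gi).
apply/(integrable12ltyP P leb mfg).
have -> : (\int[P]_w \int[leb]_s `|(f w * g s)%:E| =
    \int[P]_w (`|f w| * \int[leb]_s `|g s|)%:E)%E.
  apply: eq_integral => w _; under eq_integral do rewrite abse_EFin normrM EFinM.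
  by rewrite (integralZl measurableT gi') EFinM EFin_Rintegral.
under eq_integral do rewrite mulrC.
by rewrite -(EFin_Rintegral (integrableZR _ fi')) ltry.
Qed.

Lemma Rintegral_prod_mul (f : T -> R) (g : mR -> R) :
  P.-integrable setT (EFin \o f) -> leb.-integrable setT (EFin \o g) ->
  \int[(P \x leb)%E]_q (f q.1 * g q.2) = \int[P]_w f w * \int[leb]_s g s.
Proof.
move=> fi gi; have fgi := integrable_prod_mul fi gi.
apply: EFin_inj; rewrite (EFin_Rintegral fgi).
have := integral12_prod_meas1 fgi => /= <-.
rewrite -RintegralZr//; rewrite EFin_Rintegral; last first.
  by under eq_fun do rewrite mulrC; exact: integrableZR.
apply: eq_integral => w _; rewrite /fubini_F/=.
by rewrite EFinM (EFin_Rintegral gi) -(integralZl measurableT gi).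
Qed.

End product_integral.

Section simple_integrals.
Context {R : realType} {disp : measure_display} {T : measurableType disp}.
Variables (P : probability T R) (d : nat) (W : T -> R -> 'cV[R]_d).
Hypotheses (cP : measure_is_complete P) (bm : brownian_motion P W).
Notation mR := (measurableTypeR R).
Notation leb := (@lebesgue_measure R).
Notation F := (aug_filtration P W).
Local Notation intble f := (P.-integrable setT (EFin \o f)).
Local Notation dW := (increment W).

Let Fm t : F t `<=` measurable. Proof. exact: aug_filtration_measurable. Qed.
Let Fs t : sigma_algebra setT (F t). Proof. exact: aug_filtration_sigma. Qed.

Lemma meas_wrtS s t (f : T -> R) : s <= t -> meas_wrt (F s) f -> meas_wrt (F t) f.
Proof. by move=> st mf B mB; apply: aug_filtrationS st _ _; exact: mf. Qed.

Lemma meas_wrtM (t : R) (f g : T -> R) : meas_wrt (F t) f -> meas_wrt (F t) g ->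
  meas_wrt (F t) (fun w => f w * g w).
Proof.
move=> mf mg; apply/(meas_wrtP (Fs t)).
by apply: measurable_funM; exact/(meas_wrtP (Fs t)).
Qed.

Lemma bounded_sq_integrable (f g : T -> R) (C : R) : measurable_fun setT f ->
  (forall w, `|f w| <= C) -> sq_integrable P g ->
  sq_integrable P (fun w => f w * g w).
Proof.
move=> mf fC sg; have [mg _] := sg.
apply: le_sq_integrable (sq_integrableZ C sg) _; first exact: measurable_funM.
move=> w; rewrite !normrM ler_wpM2r//.
by rewrite (le_trans (fC w))// ler_norm.
Qed.

Lemma increment_sq_integrable k s t : 0 <= s <= t -> sq_integrable P (dW k s t).
Proof.
move=> /andP[s0]; rewrite le_eqVlt => /predU1P[<-|st].
  by rewrite /increment; under eq_fun do rewrite subrr; exact: sq_integrable0.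
by apply: increment_sq_integrable_lt => //; rewrite s0.
Qed.

(** Extends the orthogonality on events of [F s] to weights. On a degenerate interval the increment
    is 0. *)
Lemma increment_orthogonal k s t (xi : T -> R) : 0 <= s <= t ->
  meas_wrt (F s) xi -> intble (fun w => xi w * dW k s t w) ->
  \int[P]_w (xi w * dW k s t w) = 0.
Proof.
move=> /[dup] st /andP[s0]; rewrite le_eqVlt => /predU1P[<- _ _|st' mxi ixi].
  by apply: Rintegral0_eq => w; rewrite increment_refl mulr0.
apply: (orthogonal_meas_wrt (Fs s) (@Fm s)) => //.
  exact: sq_integrable_integrable (increment_sq_integrable k st).
by move=> A FA; apply: Rintegral_increment_lt => //; rewrite s0.
Qed.

Lemma increment_covariance k j s t (xi : T -> R) (C : R) : 0 <= s <= t ->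
  meas_wrt (F s) xi -> (forall w, `|xi w| <= C) ->
  \int[P]_w (xi w * (dW k s t w * dW j s t w)) =
  (k == j)%:R * (t - s) * \int[P]_w xi w.
Proof.
move=> /[dup] st /andP[s0]; rewrite le_eqVlt => /predU1P[<- _ _|st' mxi xiC].
  rewrite subrr mulr0 mul0r; apply: Rintegral0_eq => w.
  by rewrite !increment_refl !mulr0.
have mxiT := meas_wrt_measurable (@Fm s) mxi.
have sk := increment_sq_integrable k st; have sj := increment_sq_integrable j st.
have ikj := sq_integrable_mul sk sj.
set c := _ * (t - s).
have ic : intble (fun=> c) by exact: sq_integrable_integrable (sq_integrable_cst P c).
have i1 : intble xi.
  apply: le_integrableR (sq_integrable_integrable (sq_integrable_cst P C)) _ => //.
have i2 : intble (fun w => xi w * (dW k s t w * dW j s t w)).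
  have := sq_integrable_mul (bounded_sq_integrable mxiT xiC sk) sj.
  by under eq_fun do rewrite -mulrA.
have E : (fun w => xi w * (dW k s t w * dW j s t w - c)) =
   (fun w => xi w * (dW k s t w * dW j s t w) - c * xi w).
  by apply/funext => w; ring.
have : \int[P]_w (xi w * (dW k s t w * dW j s t w - c)) = 0.
  apply: (orthogonal_meas_wrt (Fs s) (@Fm s) (integrableBR ikj ic)) => //.
    move=> A FA; have mA := Fm FA.
    rewrite RintegralB//; last 2 first.
    - exact: integrableS (subsetT _) ikj.
    - exact: integrableS (subsetT _) ic.
    by rewrite Rintegral_increment_mul_lt// ?s0// Rintegral_cst// subrr.
  by rewrite E; apply: integrableBR => //; exact: integrableZR.
rewrite E RintegralB//; last exact: integrableZR.
by move=> /eqP; rewrite subr_eq0 => /eqP ->; rewrite RintegralZl.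
Qed.

(** The intervals are ordered, so [xi dW_k(a, b) eta] is known at time [c], where the second
    increment starts. *)
Lemma increment_orthogonal_mul k j (xi eta : T -> R) (C D a b c e : R) :
  0 <= a <= b -> b <= c <= e -> meas_wrt (F a) xi -> meas_wrt (F c) eta ->
  (forall w, `|xi w| <= C) -> (forall w, `|eta w| <= D) ->
  \int[P]_w (xi w * dW k a b w * (eta w * dW j c e w)) = 0.
Proof.
move=> ab /andP[bc ce] mxi meta xiC etaD.
have /andP[a0 ab'] := ab.
have c0 : 0 <= c by rewrite (le_trans a0)// (le_trans ab').
have s1 := bounded_sq_integrable (meas_wrt_measurable (@Fm _) mxi) xiC
  (increment_sq_integrable k ab).
have ce0 : 0 <= c <= e by rewrite c0.
have s2 := bounded_sq_integrable (meas_wrt_measurable (@Fm _) meta) etaD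
  (increment_sq_integrable j ce0).
under eq_Rintegral do rewrite mulrA.
apply: increment_orthogonal => //.
  apply: meas_wrtM => //; apply: meas_wrtM.
    exact: (meas_wrtS (le_trans ab' bc) mxi).
  exact: (meas_wrtS bc (meas_wrt_increment k ab)).
by under eq_fun do rewrite -mulrA; exact: sq_integrable_mul.
Qed.

(** The length of the intersection of []a, b]] and []c, e]]. *)
Definition overlap (a b c e : R) : R := Num.max 0 (Num.min b e - Num.max a c).

Lemma overlapC a b c e : overlap a b c e = overlap c e a b.
Proof. by rewrite /overlap minC (maxC a). Qed.

Let increment_isometry_le k j (xi eta : T -> R) (C D a b c e : R) :
  0 <= a <= b -> a <= c <= e -> meas_wrt (F a) xi -> meas_wrt (F c) eta ->
  (forall w, `|xi w| <= C) -> (forall w, `|eta w| <= D) ->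
  \int[P]_w (xi w * dW k a b w * (eta w * dW j c e w)) =
  (k == j)%:R * (overlap a b c e * \int[P]_w (xi w * eta w)).
Proof.
move=> ab /andP[ac ce] mxi meta xiC etaD; have /andP[a0 ab'] := ab.
rewrite /overlap (max_r ac).
have [bc|/ltW cb] := leP b c.
  rewrite (increment_orthogonal_mul _ _ _ _ mxi meta xiC etaD)//; last by rewrite bc.
  rewrite max_l ?mul0r ?mulr0// subr_le0 ge_min bc//.
(* The overlap is []c, m]]; beyond [m] at most one of the two intervals continues. *)
set m := Num.min b e.
have cm : c <= m by rewrite le_min cb.
have mb : m <= b by rewrite ge_min lexx.
have me : m <= e by rewrite ge_min lexx orbT.
have c0 : 0 <= c by rewrite (le_trans a0).
have m0 : 0 <= m by rewrite (le_trans c0).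
rewrite max_r ?subr_ge0//.
have [mxi' meta'] := (meas_wrt_measurable (@Fm _) mxi, meas_wrt_measurable (@Fm _) meta).
have sx s t : 0 <= s <= t -> sq_integrable P (fun w => xi w * dW k s t w).
  by move=> st; apply: bounded_sq_integrable xiC _ => //; exact: increment_sq_integrable.
have se s t : 0 <= s <= t -> sq_integrable P (fun w => eta w * dW j s t w).
  by move=> st; apply: bounded_sq_integrable etaD _ => //; exact: increment_sq_integrable.
have [h1 h2 h3 h4 h5] : [/\ 0 <= a <= c, 0 <= c <= m, 0 <= c <= e, 0 <= m <= b & 0 <= m <= e].
  by split; apply/andP.
(* Cutting at [c] and [m] leaves one product on the common interval, [A2], and three products over
   successive intervals, which have mean 0. *)
pose A1 w := xi w * dW k a c w * (eta w * dW j c e w).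
pose A2 w := xi w * dW k c m w * (eta w * dW j c m w).
pose A3 w := xi w * dW k c m w * (eta w * dW j m e w).
pose A4 w := eta w * dW j c m w * (xi w * dW k m b w).
have i1 : intble A1 by apply: sq_integrable_mul; [exact: sx|exact: se].
have i2 : intble A2 by apply: sq_integrable_mul; [exact: sx|exact: se].
have i3 : intble A3 by apply: sq_integrable_mul; [exact: sx|exact: se].
have i4 : intble A4 by apply: sq_integrable_mul; [exact: se|exact: sx].
have -> : \int[P]_w (xi w * dW k a b w * (eta w * dW j c e w)) =
    \int[P]_w (A1 w + (A2 w + (A3 w + A4 w))).
  apply: eq_Rintegral => w _; rewrite /A1 /A2 /A3 /A4.
  rewrite (increment_addition W k a c b) (increment_addition W k c m b).
  rewrite (increment_addition W j c m e).
  (* One of []m, b]] and []m, e]] is empty, so this product vanishes identically. *)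
  have : dW k m b w * dW j m e w = 0.
    rewrite /m; have [be|eb] := orP (le_total b e).
      by rewrite (min_l be) increment_refl mul0r.
    by rewrite (min_r eb) increment_refl mulr0.
  set u := dW k m b w; set v := dW j m e w => uv.
  transitivity (xi w * eta w * (u * v) + (xi w * dW k a c w * (eta w * (dW j c m w + v)) +
   (xi w * dW k c m w * (eta w * dW j c m w) +
    (xi w * dW k c m w * (eta w * v) + eta w * dW j c m w * (xi w * u))))); first by ring.
  by rewrite uv mulr0 add0r.
have i34 := integrableDR i3 i4; have i234 := integrableDR i2 i34.
rewrite RintegralD// RintegralD// RintegralD//.
have mxic := meas_wrtS ac mxi.
rewrite /A1 (increment_orthogonal_mul _ _ _ _ mxi meta xiC etaD)//; last by rewrite lexx.
rewrite /A3 (increment_orthogonal_mul _ _ _ _ mxic (meas_wrtS cm meta) xiC etaD)//;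
  last by rewrite lexx.
rewrite /A4 (increment_orthogonal_mul _ _ _ _ meta (meas_wrtS cm mxic) etaD xiC)//;
  last by rewrite lexx.
rewrite add0r !addr0 mulrA -(@increment_covariance k j c m _ (C * D))//.
- by apply: eq_Rintegral => w _; rewrite /A2; ring.
- exact: meas_wrtM.
- by move=> w; rewrite normrM ler_pM.
Qed.

Lemma increment_isometry k j (xi eta : T -> R) (C D a b c e : R) :
  0 <= a <= b -> 0 <= c <= e -> meas_wrt (F a) xi -> meas_wrt (F c) eta ->
  (forall w, `|xi w| <= C) -> (forall w, `|eta w| <= D) ->
  \int[P]_w (xi w * dW k a b w * (eta w * dW j c e w)) =
  (k == j)%:R * (overlap a b c e * \int[P]_w (xi w * eta w)).
Proof.
move=> ab ce mxi meta xiC etaD.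
have [ac|ca] := orP (le_total a c).
  apply: increment_isometry_le => //; rewrite ac/=; by case/andP: ce.
under eq_Rintegral do rewrite mulrC.
rewrite (increment_isometry_le _ _ _ _ meta mxi etaD xiC)//; last first.
  by rewrite ca/=; case/andP: ab.
rewrite eq_sym overlapC; congr (_ * (_ * _)).
by apply: eq_Rintegral => w _; rewrite mulrC.
Qed.

End simple_integrals.

Section ito.
Context {R : realType} {disp : measure_display} {T : measurableType disp}.
Variables (P : probability T R) (d : nat) (W : T -> R -> 'cV[R]_d).
Hypotheses (cP : measure_is_complete P) (bm : brownian_motion P W).
Notation mR := (measurableTypeR R).
Notation leb := (@lebesgue_measure R).
Notation F := (aug_filtration P W).
Notation P2 := (P \x leb)%E.
Local Notation intble f := (P.-integrable setT (EFin \o f)).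
Local Notation dW := (increment W).

Let Fm t : F t `<=` measurable. Proof. exact: aug_filtration_measurable. Qed.
Let Fs t : sigma_algebra setT (F t). Proof. exact: aug_filtration_sigma. Qed.

Let itv_oc (S : simple_process (R := R) (T := T)) j : set mR :=
  `]sp_time S j, sp_time S j.+1]%classic.

Lemma integral_overlap (a b c e : R) :
  \int[leb]_s (\1_(`]a, b]%classic : set mR) s * \1_(`]c, e]%classic : set mR) s) = overlap a b c e.
Proof.
have -> : (fun s : mR => \1_(`]a, b]%classic : set mR) s * \1_(`]c, e]%classic : set mR) s)
    = (\1_(`]Num.max a c, Num.min b e]%classic : set mR) : mR -> R).
  apply/funext => s; rewrite -[LHS]/((\1_(`]a, b]%classic : set mR) \*
    \1_(`]c, e]%classic : set mR)) s).
  rewrite -indicI; congr (\1_ _ s); apply/seteqP; split=> x /=; rewrite !in_itv/=.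
    by move=> [/andP[? ?] /andP[? ?]]; rewrite gt_max le_min; apply/andP; split; apply/andP.
  by rewrite gt_max le_min => /andP[/andP[-> ->] /andP[-> ->]].
transitivity (fine (leb `]Num.max a c, Num.min b e]%classic)).
  by rewrite /Rintegral integral_indic// setIT.
rewrite lebesgue_measure_itv/= lte_fin /overlap.
case: ltP => h.
  by rewrite -EFinD/= [RHS]max_r// subr_ge0 ltW.
by rewrite [RHS]max_l// subr_le0.
Qed.

Lemma integrable_indic_oc (a b : R) :
  leb.-integrable setT (EFin \o (\1_(`]a, b]%classic : set mR) : mR -> R)).
Proof.
apply/integrableP; split; first exact/measurable_EFinP/measurable_indic.
under eq_integral do rewrite /= ger0_norm//.
rewrite integral_indic// setIT.
apply: (@le_lt_trans _ _ (leb `]a, b]%classic)) => //.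
by rewrite lebesgue_measure_itv/= lte_fin; case: ifP => _; rewrite -?EFinB ltry.
Qed.

Section simple.
Variable S : simple_process (R := R) (T := T).
Hypothesis aS : simple_adapted P W S.

Let mS j : meas_wrt (F (sp_time S j)) (sp_val S j).
Proof. by have [_ _ h _] := aS; exact: h. Qed.

Let mST j : measurable_fun setT (sp_val S j).
Proof. exact: (meas_wrt_measurable (@Fm _) (@mS j)). Qed.

Lemma sp_time_ge0 j : 0 <= sp_time S j.
Proof.
have [h0 h _ _] := aS; elim: j => [//|j ih]; exact: le_trans ih (h j).
Qed.

Lemma sp_time_itv j : 0 <= sp_time S j <= sp_time S j.+1.
Proof. by rewrite sp_time_ge0/=; have [_ h _ _] := aS; exact: h. Qed.

Lemma simple_integralE k w : simple_integral W k S w =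
  \sum_(j < sp_size S) sp_val S j w * dW k (sp_time S j) (sp_time S j.+1) w.
Proof. exact: eq_bigr. Qed.

Lemma simple_pathE w s : simple_path S w s =
  \sum_(j < sp_size S) sp_val S j w * \1_(itv_oc S j) s.
Proof.
apply: eq_bigr => j _; congr (_ * _); rewrite indicE; congr ((nat_of_bool _)%:R).
by apply/idP/idP => [h|/set_mem]; [apply/mem_set|]; rewrite /itv_oc/= in_itv.
Qed.

Lemma simple_path_lt0 w s : s < 0 -> simple_path S w s = 0.
Proof.
move=> s0; apply: big1 => j _; rewrite ltNge (le_trans (ltW s0)) ?sp_time_ge0//.
by rewrite mulr0.
Qed.

Lemma simple_integral_sq_integrable k : sq_integrable P (simple_integral W k S).
Proof.
have [_ _ _ [C SC]] := aS.
have -> : simple_integral W k S = (fun w => \sum_(j < sp_size S)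
    sp_val S j w * dW k (sp_time S j) (sp_time S j.+1) w).
  by apply/funext => w; exact: simple_integralE.
apply: sq_integrable_sum => j; apply: bounded_sq_integrable (SC j) _ => //.
by apply: increment_sq_integrable => //; exact: sp_time_itv.
Qed.

Lemma simple_path_sq_integrable : sq_integrable P2 (fun q => simple_path S q.1 q.2).
Proof.
have [_ _ _ [C SC]] := aS.
under eq_fun do rewrite simple_pathE.
apply: sq_integrable_sum => j; apply/sq_integrableP.
have m1 : measurable_fun setT (fun q : T * mR => sp_val S j q.1 * \1_(itv_oc S j) q.2).
  apply: measurable_funM; first exact: measurableT_comp (mST j) measurable_fst.
  have mi : measurable_fun setT (\1_(itv_oc S j) : mR -> R).
    by apply: measurable_indic; exact: measurable_itv.
  exact: measurableT_comp mi measurable_snd.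
split=> //.
have iC : intble (fun=> C ^+ 2) by exact: sq_integrable_integrable (sq_integrable_cst P _).
apply: le_integrableR (integrable_prod_mul iC
  (integrable_indic_oc (sp_time S j) (sp_time S j.+1))) _.
  exact: measurable_funX.
move=> q; rewrite exprMn normrM [X in X <= _]mulrC [X in _ <= X]mulrC.
rewrite ger0_norm ?sqr_ge0// indicE.
case: (_ \in _); last by rewrite expr0n/= !mul0r.
rewrite expr1n !mul1r ger0_norm ?sqr_ge0// -(real_normK (num_real (sp_val S j q.1))).
by rewrite lerXn2r ?nnegrE// (le_trans _ (SC j q.1)).
Qed.

End simple.

(** Both sides are bilinear in the steps, and for a single pair of steps the claim is
    [increment_isometry]. *)
Lemma simple_isometry k j S S' : simple_adapted P W S -> simple_adapted P W S' ->
  \int[P]_w (simple_integral W k S w * simple_integral W j S' w) =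
  (k == j)%:R * \int[P2]_q (simple_path S q.1 q.2 * simple_path S' q.1 q.2).
Proof.
move=> aS aS'.
have [_ _ mS [C SC]] := aS; have [_ _ mS' [C' SC']] := aS'.
have mT i := meas_wrt_measurable (@Fm _) (mS i).
have mT' i := meas_wrt_measurable (@Fm _) (mS' i).
pose g i w := sp_val S i w * dW k (sp_time S i) (sp_time S i.+1) w.
pose g' i w := sp_val S' i w * dW j (sp_time S' i) (sp_time S' i.+1) w.
have sg i : sq_integrable P (g i).
  apply: bounded_sq_integrable (SC i) _ => //.
  by apply: increment_sq_integrable => //; exact: sp_time_itv.
have sg' i : sq_integrable P (g' i).
  apply: bounded_sq_integrable (SC' i) _ => //.
  by apply: increment_sq_integrable => //; exact: sp_time_itv.
have E1 w : simple_integral W k S w * simple_integral W j S' w =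
    \sum_(i < sp_size S) \sum_(i' < sp_size S') g i w * g' i' w.
  by rewrite !simple_integralE mulr_suml; apply: eq_bigr => i _; rewrite mulr_sumr.
under eq_Rintegral do rewrite E1.
rewrite Rintegral_sum; last first.
  by move=> i; apply: integrable_sumR => i'; exact: sq_integrable_mul.
have ivv i i' : intble (fun w => sp_val S i w * sp_val S' i' w).
  apply: (@le_integrableR _ _ _ P _ (fun=> C * C')).
  - exact: measurable_funM.
  - exact: sq_integrable_integrable (sq_integrable_cst P _).
  - by move=> w; rewrite normrM ler_pM.
have i11 i i' : leb.-integrable setT (EFin \o
    (fun s : mR => \1_(itv_oc S i) s * \1_(itv_oc S' i') s)).
  apply: le_integrableR (integrable_indic_oc (sp_time S i) (sp_time S i.+1)) _.
    by apply: measurable_funM; apply: measurable_indic; exact: measurable_itv.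
  by move=> s; rewrite ger0_norm ?mulr_ge0// ler_piMr.
have E2 q : simple_path S q.1 q.2 * simple_path S' q.1 q.2 =
    \sum_(i < sp_size S) \sum_(i' < sp_size S')
     (sp_val S i q.1 * sp_val S' i' q.1) * (\1_(itv_oc S i) q.2 * \1_(itv_oc S' i') q.2).
  rewrite !simple_pathE mulr_suml; apply: eq_bigr => i _; rewrite mulr_sumr.
  by apply: eq_bigr => i' _; ring.
under [in RHS]eq_Rintegral do rewrite E2.
rewrite [in RHS]Rintegral_sum; last first.
  move=> i; apply: integrable_sumR => i'.
  exact: (integrable_prod_mul (ivv i i') (i11 i i')).
rewrite mulr_sumr; apply: eq_bigr => i _.
rewrite Rintegral_sum; last by move=> i'; exact: sq_integrable_mul.
rewrite Rintegral_sum; last first.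
  by move=> i'; exact: (integrable_prod_mul (ivv i i') (i11 i i')).
rewrite mulr_sumr; apply: eq_bigr => i' _.
rewrite (Rintegral_prod_mul (ivv i i') (i11 i i')) integral_overlap.
rewrite (increment_isometry cP bm k j (sp_time_itv aS i) (sp_time_itv aS' i')
  (mS i) (mS' i') (SC i) (SC' i')).
by rewrite [X in _ = _ * X]mulrC.
Qed.

End ito.

Section ito_integral.
Context {R : realType} {disp : measure_display} {T : measurableType disp}.
Variables (P : probability T R) (d : nat) (W : T -> R -> 'cV[R]_d).
Hypotheses (cP : measure_is_complete P) (bm : brownian_motion P W).
Notation mR := (measurableTypeR R).
Notation leb := (@lebesgue_measure R).
Notation F := (aug_filtration P W).
Notation P2 := (P \x leb)%E.
Local Notation intble f := (P.-integrable setT (EFin \o f)).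
Local Notation dW := (increment W).

Let Fm t : F t `<=` measurable. Proof. exact: aug_filtration_measurable. Qed.
Let Fs t : sigma_algebra setT (F t). Proof. exact: aug_filtration_sigma. Qed.

(** Processes matter only at nonnegative times; extended by 0 they are functions on the whole
    product space, where Fubini needs no domain. *)
Definition half_extension (g : T -> R -> R) (q : T * mR) : R :=
  g q.1 q.2 * \1_(halfline : set mR) q.2.

Lemma measurable_halfline : measurable (halfline : set mR).
Proof. exact: measurable_itv. Qed.

Lemma halflineE (s : mR) : (s \in (halfline : set mR)) = (0 <= s).
Proof.
by apply/idP/idP => [/set_mem|h]; [|apply/mem_set]; rewrite /halfline/= in_itv/= andbT.
Qed.

Lemma half_extensionE g w s :
  half_extension g (w, s) = if 0 <= s then g w s else 0.
Proof.
by rewrite /half_extension/= indicE halflineE; case: ifP; rewrite (mulr1,mulr0).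
Qed.

Lemma measurable_half_extension g :
  measurable_fun ([set: T] `*` halfline) (fun q : T * mR => g q.1 q.2) ->
  measurable_fun setT (half_extension g).
Proof.
move=> mg.
have -> : half_extension g = (fun q : T * mR => g q.1 q.2) \_ ([set: T] `*` halfline).
  apply/funext => -[w s]; rewrite half_extensionE patchE.
  have -> : ((w, s) \in [set: T] `*` (halfline : set mR)) = (0 <= s).
    rewrite -halflineE.
    by apply/idP/idP => [/set_mem[_ h]|/set_mem h]; apply/mem_set.
  by case: ifP.
apply/(measurable_restrictT _ _).1 => //.
by apply: measurableX => //; exact: measurable_halfline.
Qed.

Lemma integral_half_extension (f : T * mR -> \bar R) :
  measurable_fun setT f -> (forall q, (0 <= f q)%E) ->
  (forall w s, s < 0 -> f (w, s) = 0%E) ->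
  (\int[P]_w \int[leb]_(s in halfline) f (w, s) = \int[P2]_q f q)%E.
Proof.
move=> mf f0 fneg.
rewrite (@fubini_tonelli1 _ _ _ _ _ P leb f mf f0); apply: eq_integral => w _.
rewrite /fubini_F [LHS]integral_mkcond; apply: eq_integral => s _.
rewrite patchE halflineE; case: leP => // s0.
by rewrite fneg.
Qed.

Lemma is_ito_coordP k (g : T -> R -> R) I : is_ito_coord P W k g I ->
  exists S : nat -> simple_process (R := R) (T := T),
    [/\ forall m, simple_adapted P W (S m),
        (fun m => \int[P2]_q ((simple_path (S m) q.1 q.2 - half_extension g q) ^+ 2)%:E)%E
          @ \oo --> 0%E &
        (fun m => \int[P]_w ((simple_integral W k (S m) w - I w) ^+ 2)%:E)%E
          @ \oo --> 0%E].
Proof.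
move=> [mg mI [S [aS cS cI]]]; exists S; split=> //.
apply: cvg_trans cS; apply: near_eq_cvg; apply: nearW => m /=.
have mh := measurable_half_extension mg.
rewrite -integral_half_extension.
- apply: eq_integral => w _ /=; apply: eq_integral => s.
  by rewrite halflineE half_extensionE => ->.
- apply/measurable_EFinP; apply: measurable_funX; apply: measurable_funB => //.
  by have [] := simple_path_sq_integrable cP bm (aS m).
- by move=> q; rewrite lee_fin sqr_ge0.
- move=> w s s0; rewrite half_extensionE leNgt s0/=.
  by rewrite (simple_path_lt0 (aS m))// subr0 expr0n.
Qed.

Lemma ito_sq_integrable k (g : T -> R -> R) I : is_ito_coord P W k g I ->
  sq_integrable P I /\ sq_integrable P2 (half_extension g).
Proof.
move=> /[dup] [[mg mI _]] /is_ito_coordP[S [aS cS cI]]; split.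
  apply: (cvg_sq_integrable _ mI cI) => m.
  exact: simple_integral_sq_integrable.
apply: (cvg_sq_integrable _ _ cS); last exact: measurable_half_extension.
by move=> m; exact: (simple_path_sq_integrable cP bm (aS m)).
Qed.

(** The isometry for simple processes passes to the limit on both sides, by convergence of products
    in L^2. *)
Lemma ito_isometry k j (g g' : T -> R -> R) I J :
  is_ito_coord P W k g I -> is_ito_coord P W j g' J ->
  \int[P]_w (I w * J w) =
  (k == j)%:R * \int[P2]_q (half_extension g q * half_extension g' q).
Proof.
move=> hI hJ.
have [sI sg] := ito_sq_integrable hI; have [sJ sg'] := ito_sq_integrable hJ.
have [S [aS cS cI]] := is_ito_coordP hI; have [S' [aS' cS' cJ]] := is_ito_coordP hJ.
have c1 := cvg_Rintegral_mul (fun m => simple_integral_sq_integrable cP bm (aS m) k)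
  (fun m => simple_integral_sq_integrable cP bm (aS' m) j) sI sJ cI cJ.
have c2 := cvg_Rintegral_mul (fun m => simple_path_sq_integrable cP bm (aS m))
  (fun m => simple_path_sq_integrable cP bm (aS' m)) sg sg' cS cS'.
apply: (cvg_unique (@Rhausdorff R) c1).
rewrite (_ : (fun m => _) = fun m => (k == j)%:R *
    \int[P2]_q (simple_path (S m) q.1 q.2 * simple_path (S' m) q.1 q.2)).
  exact: cvgMl_tmp c2.
by apply/funext => m; exact: (simple_isometry cP bm k j (aS m) (aS' m)).
Qed.

(** Stops a simple process at [t]. The value of a step that starts after [t] is replaced by 0: its
    interval has become empty, and the value would not be known at the new starting time [t]. *)
Let truncate (t : R) (S : simple_process (R := R) (T := T)) := SimpleProcess (sp_size S)
  (fun j => Num.min (sp_time S j) t)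
  (fun j w => if sp_time S j <= t then sp_val S j w else 0).

Let truncate_adapted t S : 0 <= t -> simple_adapted P W S ->
  simple_adapted P W (truncate t S).
Proof.
move=> t0 [h0 h1 h2 [C hC]]; split=> /=.
- by rewrite le_min h0.
- by move=> j; rewrite le_min !ge_min h1 lexx orbT.
- move=> j; have [h|h] := leP (sp_time S j) t; first exact: h2.
  by apply/(meas_wrtP (Fs t)).
- exists (Num.max C 0) => j w; case: ifP => _; first by rewrite le_max hC.
  by rewrite normr0 le_max lexx orbT.
Qed.

Let truncate_path t S w s :
  simple_path (truncate t S) w s = if s <= t then simple_path S w s else 0.
Proof.
rewrite /simple_path/=; case: ifP => st.
  apply: eq_bigr => j _; rewrite le_min st andbT.
  have [h|h] := leP (sp_time S j) t; first by [].
  rewrite mul0r; have -> : (sp_time S j < s) = false.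
    by apply/negbTE; rewrite -leNgt (le_trans st (ltW h)).
  by rewrite mulr0.
apply: big1 => j _; rewrite le_min st !andbF mulr0//.
Qed.

(** What truncation removes are increments over intervals after [t], with weights known at their
    left ends. *)
Let truncate_orthogonal k t S (xi : T -> R) (C : R) : 0 <= t ->
  simple_adapted P W S -> meas_wrt (F t) xi -> (forall w, `|xi w| <= C) ->
  \int[P]_w (xi w * simple_integral W k S w) =
  \int[P]_w (xi w * simple_integral W k (truncate t S) w).
Proof.
move=> t0 aS mxi xiC.
have mxiT := meas_wrt_measurable (@Fm t) mxi.
have aS' := truncate_adapted t0 aS.
have sx S0 : simple_adapted P W S0 ->
    intble (fun w => xi w * simple_integral W k S0 w).
  move=> aS0; apply: sq_integrable_integrable; apply: bounded_sq_integrable xiC _ => //.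
  exact: simple_integral_sq_integrable.
apply/eqP; rewrite -subr_eq0 -RintegralB ?sx//; apply/eqP.
have [_ _ mS [D SD]] := aS.
pose g j w := sp_val S j w * dW k (sp_time S j) (sp_time S j.+1) w -
  (if sp_time S j <= t then sp_val S j w else 0) *
   dW k (Num.min (sp_time S j) t) (Num.min (sp_time S j.+1) t) w.
have E w : xi w * simple_integral W k S w - xi w * simple_integral W k (truncate t S) w
   = \sum_(j < sp_size S) xi w * g j w.
  by rewrite -mulrBr -mulr_sumr /simple_integral -sumrB.
under eq_Rintegral do rewrite E.
(* The part of the step after [t] is the increment between the two times raised to at least [t], in
   each position of [t] relative to the step. *)
have gE j : (fun w => xi w * g j w) = fun w => (xi w * sp_val S j w) *
    dW k (Num.max (sp_time S j) t) (Num.max (sp_time S j.+1) t) w.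
  apply/funext => w; rewrite /g; have [_ h _ _] := aS; have hj := h j.
  have [h1|h1] := leP (sp_time S j) t; have [h2|h2] := leP (sp_time S j.+1) t.
  - by rewrite increment_refl subrr !mulr0.
  - by rewrite (increment_addition W k _ t); ring.
  - by have := lt_le_trans h1 hj; rewrite ltNge h2.
  - by rewrite mul0r; ring.
have mx0 j : 0 <= Num.max (sp_time S j) t <= Num.max (sp_time S j.+1) t.
  have [_ h _ _] := aS; have hj := h j.
  by rewrite le_max t0 orbT/= ge_max !le_max hj lexx !orbT.
have ig j : intble (fun w => xi w * g j w).
  rewrite gE; apply: sq_integrable_integrable.
  apply: (@bounded_sq_integrable _ _ _ P _ _ (C * D)); last exact: increment_sq_integrable.
    by apply: measurable_funM => //; exact: (meas_wrt_measurable (@Fm _) (mS j)).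
  by move=> w; rewrite normrM ler_pM.
rewrite Rintegral_sum//; apply: big1 => j _; rewrite gE.
apply: increment_orthogonal => //; last by rewrite -gE.
apply: meas_wrtM; apply: meas_wrtS; [|exact: mxi| |exact: mS].
  by rewrite le_max lexx orbT.
by rewrite le_max lexx.
Qed.

(* Approximants of [g] are only small, not zero, before [t]: their parts before
   [t] tend to 0 and their parts after [t] are orthogonal to [F t]. *)
Let ito_orthogonal_bounded k t (g : T -> R -> R) I (xi : T -> R) (C : R) : 0 <= t ->
  is_ito_coord P W k g I -> (forall w s, 0 <= s < t -> g w s = 0) ->
  meas_wrt (F t) xi -> (forall w, `|xi w| <= C) ->
  \int[P]_w (xi w * I w) = 0.
Proof.
move=> t0 hI g0 mxi xiC.
have mxiT := meas_wrt_measurable (@Fm t) mxi.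
have [sI sg] := ito_sq_integrable hI.
have [S [aS cS cI]] := is_ito_coordP hI.
have aS' m := truncate_adapted t0 (aS m).
have sxi : sq_integrable P xi.
  have := bounded_sq_integrable mxiT xiC (sq_integrable_cst P 1).
  by under eq_fun do rewrite mulr1.
have sI' m := simple_integral_sq_integrable cP bm (aS' m) k.
have cc : (fun m => \int[P]_w ((xi w - xi w) ^+ 2)%:E)%E @ \oo --> 0%E.
  under eq_fun do under eq_integral do rewrite subrr expr0n.
  by under eq_fun do rewrite integral0; exact: cvg_cst.
have c1 := cvg_Rintegral_mul (fun=> sxi)
  (fun m => simple_integral_sq_integrable cP bm (aS m) k) sxi sI cc cI.
(* By the isometry, the second moment of the truncated integral is the squared norm of the truncated
   path, which is at most the approximation error because [g] vanishes before [t]. *)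
have cI' : (fun m => \int[P]_w ((simple_integral W k (truncate t (S m)) w - 0) ^+ 2)%:E)%E
    @ \oo --> 0%E.
  apply: (squeeze_cvge _ (cvg_cst 0%E) cS); apply: nearW => m.
  apply/andP; split; first by apply: integral_ge0 => w _; rewrite lee_fin sqr_ge0.
  under eq_integral do rewrite subr0.
  have sp := simple_path_sq_integrable cP bm (aS' m).
  have [_ ip] := (sq_integrableP P2 _).1 sp.
  have [_ iI] := (sq_integrableP P _).1 (sI' m).
  have iso := simple_isometry cP bm k k (aS' m) (aS' m); rewrite eqxx mul1r in iso.
  rewrite -(EFin_Rintegral iI); under eq_Rintegral do rewrite expr2.
  rewrite iso; under eq_Rintegral do rewrite -expr2.
  rewrite (EFin_Rintegral ip).
  have mS : measurable_fun setT (fun q : T * mR => simple_path (S m) q.1 q.2).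
    by have [] := simple_path_sq_integrable cP bm (aS m).
  apply: ae_ge0_le_integral => //.
  - by move=> q _; rewrite lee_fin sqr_ge0.
  - exact: measurable_int ip.
  - by move=> q _; rewrite lee_fin sqr_ge0.
  - apply/measurable_EFinP; apply: measurable_funX; apply: measurable_funB => //.
    by case: sg.
  (* At time [t] itself the truncated path is kept while [g] need not vanish; this line is a null
     set. *)
  exists ([set: T] `*` [set t]); split.
  - by apply: measurableX => //; exact: measurable_set1.
  - apply: etrans (product_measure1E P leb measurableT (measurable_set1 t)) _.
    by rewrite [X in (_ * X)%E](_ : _ = 0%E) ?mule0//; exact: lebesgue_measure_set1.
  move=> [w s] /= hq; split=> //; apply: contrapT => st; apply: hq => _.
  rewrite lee_fin truncate_path; case: (leP s t) => h; last first.
    by rewrite expr0n/= sqr_ge0.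
  rewrite half_extensionE; case: ifP => s0; last by rewrite subr0.
  by rewrite g0 ?subr0// s0 lt_neqAle h andbT; apply/eqP.
have c2 := cvg_Rintegral_mul (fun=> sxi) sI' sxi (sq_integrable0 P) cc cI'.
apply: (cvg_unique (@Rhausdorff R) c1).
rewrite (_ : (fun m => _) = fun m =>
    \int[P]_w (xi w * simple_integral W k (truncate t (S m)) w)); last first.
  by apply/funext => m; exact: (truncate_orthogonal k t0 (aS m) mxi xiC).
rewrite (_ : 0 = \int[P]_w (xi w * 0)) //.
by rewrite Rintegral0_eq// => w; rewrite mulr0.
Qed.

(** Indicators of events of [F t] are bounded weights, and orthogonality on events extends to all
    weights. *)
Lemma ito_orthogonal k t (g : T -> R -> R) I (xi : T -> R) : 0 <= t ->
  is_ito_coord P W k g I -> (forall w s, 0 <= s < t -> g w s = 0) ->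
  meas_wrt (F t) xi -> intble (fun w => xi w * I w) ->
  \int[P]_w (xi w * I w) = 0.
Proof.
move=> t0 hI g0 mxi ixi; have [sI _] := ito_sq_integrable hI.
apply: (orthogonal_meas_wrt (Fs t) (@Fm t)) => //.
  exact: sq_integrable_integrable.
move=> A FA; have mA := Fm FA; rewrite Rintegral_mkcond.
rewrite -[RHS](@ito_orthogonal_bounded k t g I (\1_A) 1 t0 hI g0).
- apply: eq_Rintegral => w _; rewrite patchE indicE.
  by case: ifP; rewrite (mul1r,mul0r).
- by apply/(meas_wrtP (Fs t)); apply: measurable_indic; exact: sub_sigma_algebra.
- by move=> w; rewrite indicE; case: (w \in A); rewrite ?normr1 ?normr0.
Qed.

(** Orthogonality to the constant 1, which is known at time 0. *)
Lemma ito_mean k (g : T -> R -> R) I : is_ito_coord P W k g I ->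
  \int[P]_w I w = 0.
Proof.
move=> hI; have [sI _] := ito_sq_integrable hI.
rewrite -[RHS](@ito_orthogonal k 0 g I (fun=> 1) (lexx 0) hI).
- by apply: eq_Rintegral => w _; rewrite mul1r.
- by move=> w s /andP[s0 /(le_lt_trans s0)]; rewrite ltxx.
- by apply/(meas_wrtP (Fs 0)).
- by under eq_fun do rewrite mul1r; exact: sq_integrable_integrable.
Qed.

End ito_integral.

(** * Differentiation under the integral sign and convexity *)

Section limsup.
Context d (T : measurableType d) (R : realType).
Variable f_ : nat -> T -> R.

(** The upper limit is measurable whether or not the sequence converges, and equals the limit when
    it does; [fine] sends infinite values to 0. *)
Definition real_limsup (x : T) : R := fine (limn_esup (fun n => (f_ n x)%:E)).

Lemma measurable_real_limsup : (forall n, measurable_fun setT (f_ n)) ->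
  measurable_fun setT real_limsup.
Proof.
move=> mf; apply: (measurableT_comp (fine_measurable measurableT)).
by apply: measurable_fun_limn_esup => n; exact/measurable_EFinP.
Qed.

Lemma real_limsupE x l : (fun n => f_ n x) @ \oo --> l -> real_limsup x = l.
Proof.
move=> fl; rewrite /real_limsup.
have fl' : (fun n => (f_ n x)%:E) @ \oo --> l%:E.
  by apply/fine_cvgP; split; [exact: nearW|exact: fl].
by rewrite limn_esup_lim (cvg_lim _ (cvg_esups fl')).
Qed.

Lemma real_limsup_norm_le x (C : R) : (forall n, `|f_ n x| <= C) ->
  `|real_limsup x| <= C.
Proof.
move=> fC.
have C0 : 0 <= C by rewrite (le_trans _ (fC 0%N)).
have h1 n : (esups (fun n => (f_ n x)%:E) n <= C%:E)%E.
  apply: ge_ereal_sup => _ [m _ <-]; rewrite lee_fin.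
  exact: le_trans (ler_norm _) (fC m).
have h2 n : ((- C)%:E <= esups (fun n => (f_ n x)%:E) n)%E.
  apply: (@le_trans _ _ (f_ n x)%:E).
    by rewrite lee_fin lerNl (le_trans _ (fC n))// -normrN ler_norm.
  by apply: ereal_sup_ubound; exists n => /=.
rewrite /real_limsup limn_esup_lim.
have cv : cvgn (esups (fun n => (f_ n x)%:E)) by exact: is_cvg_esups.
set l := limn _.
have l1 : (l <= C%:E)%E by apply: lime_le => //; exact: nearW.
have l2 : ((- C)%:E <= l)%E by apply: lime_ge => //; exact: nearW.
have lfin : l \is a fin_num.
  by rewrite fin_numElt (lt_le_trans (ltNyr _) l2) (le_lt_trans l1 (ltry _)).
by rewrite ler_norml -!lee_fin !fineK// l2.
Qed.

End limsup.

Section ae_eq_integral_any.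
Context d (T : measurableType d) (R : realType).
Variable mu : {measure set T -> \bar R}.
Import HBNNSimple.

(** Holds without measurability, since the integral of a nonnegative function is a supremum over
    simple functions below it: such a function may be set to 0 on the null set. The derivatives in
    the adjoint equation are integrated through this. *)
Lemma ge0_ae_le_integral_any (f g : T -> \bar R) :
  (forall x, 0 <= f x)%E -> (forall x, 0 <= g x)%E ->
  {ae mu, forall x, (f x <= g x)%E} -> (\int[mu]_x f x <= \int[mu]_x g x)%E.
Proof.
move=> f0 g0 [N [mN N0 fgN]].
rewrite !ge0_integralTE//; apply: ge_ereal_sup => _ [h hf <-].
have mC : measurable (~` N) by exact: measurableC.
pose h' := mul_nnsfun h (indic_nnsfun R mC).
apply: (@le_trans _ _ (sintegral mu h')).
  rewrite -!integralT_nnsfun le_eqVlt; apply/orP; left; apply/eqP.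
  apply: ae_eq_integral => //; [exact/measurable_EFinP..|].
  exists N; split=> // x /=; apply: contra_notP => Nx _.
  by rewrite /h'/= /mindic indicE mem_set// mulr1.
apply: ereal_sup_ubound; exists h' => // x.
rewrite /h'/= /mindic indicE; case: (boolP (x \in ~` N)) => [|_]; last by rewrite mulr0.
move=> /set_mem Nx; rewrite mulr1.
apply: le_trans (hf x) _.
by apply: contrapT => /= fg; apply: Nx; exact: fgN.
Qed.

Lemma ae_eq_integral_any (f g : T -> \bar R) :
  {ae mu, forall x, f x = g x} -> (\int[mu]_x f x = \int[mu]_x g x)%E.
Proof.
move=> fg; have ge0 (u v : T -> \bar R) : (forall x, 0 <= u x)%E ->
    (forall x, 0 <= v x)%E -> {ae mu, forall x, u x = v x} ->
    (\int[mu]_x u x = \int[mu]_x v x)%E.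
  move=> u0 v0 uv; apply/eqP; rewrite eq_le !ge0_ae_le_integral_any//.
  - by apply: filterS uv => x ->.
  - by apply: filterS uv => x ->.
rewrite integralE [RHS]integralE; congr (_ - _)%E; apply: ge0 => //.
- by apply: filterS fg => x fgx; rewrite !funeposE fgx.
- by apply: filterS fg => x fgx; rewrite !funenegE fgx.
Qed.

Lemma ae_eq_Rintegral_any (f g : T -> R) :
  {ae mu, forall x, f x = g x} -> \int[mu]_x f x = \int[mu]_x g x.
Proof.
move=> fg; congr fine; apply: ae_eq_integral_any.
by apply: filterS fg => x ->.
Qed.

End ae_eq_integral_any.

Section derivative_under_integral.
Context d (T : measurableType d) (R : realType) (V : normedModType R).
Variable mu : {measure set T -> \bar R}.
Variables (f : T -> V -> R) (k : T -> R) (z : V).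
Local Notation intble f := (mu.-integrable setT (EFin \o f)).
Hypothesis mf : forall y, measurable_fun setT (f ^~ y).
Hypothesis ik : intble k.
Hypothesis f0 : {ae mu, forall s, f s 0 = 0}.
Hypothesis flip : {ae mu, forall s, forall y y', `|f s y - f s y'| <= k s * `|y - y'|}.
Hypothesis fdiff : {ae mu, forall s, differentiable (f s : V -> R^o) z}.

Lemma integrable_lipschitz y : intble (f ^~ y).
Proof.
apply: ae_le_integrable (integrableZR `|y| ik) _ => //.
apply: filterS2 f0 flip => s f0s /(_ y 0).
by rewrite f0s !subr0 mulrC.
Qed.

Let quot (v : V) (e : R) (s : T) := e^-1 * (f s (e *: v + z) - f s z).

Let mquot v e : measurable_fun setT (quot v e).
Proof. by apply: measurable_funM => //; exact: measurable_funB. Qed.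

Let quot_cvg s v : differentiable (f s : V -> R^o) z ->
  quot v e s @[e --> 0^'] --> ('d (f s : V -> R^o) z v : R).
Proof.
move=> dfs; have := @diff_derivable _ _ _ _ _ v dfs.
by rewrite -deriveE.
Qed.

Let quot_le s v e : (forall y y', `|f s y - f s y'| <= k s * `|y - y'|) -> e != 0 ->
  `|quot v e s| <= k s * `|v|.
Proof.
move=> fl e0; rewrite /quot normrM normfV ler_pdivrMl ?normr_gt0//.
by apply: le_trans (fl _ _) _; rewrite addrK normrZ mulrCA.
Qed.

(** Dominated convergence along a sequence: the Lipschitz bound dominates every difference quotient
    by [|v| k]. The upper limit of the quotients stands for the differential. *)
Let seq_cvg v (u : nat -> R) : (forall n, u n != 0) -> u @ \oo --> (0 : R) ->
  intble (fun s => real_limsup (fun n => quot v (u n)) s) /\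
  (fun n => \int[mu]_s quot v (u n) s) @ \oo -->
    \int[mu]_s ('d (f s : V -> R^o) z v : R).
Proof.
move=> u0 ucv.
pose g s := real_limsup (fun n => quot v (u n)) s.
have mg : measurable_fun setT g by apply: measurable_real_limsup => n.
have cq : {ae mu, forall s, (fun n => quot v (u n) s) @ \oo --> ('d (f s : V -> R^o) z v : R)}.
  apply: filterS fdiff => s dfs.
  by have /cvgr_dnbhsP := @quot_cvg s v dfs; apply; split.
have gE : {ae mu, forall s, ('d (f s : V -> R^o) z v : R) = g s}.
  by apply: filterS cq => s h; rewrite /g (@real_limsupE _ _ _ _ _ _ h).
have cqE : {ae mu, forall s, setT s -> (fun n => (quot v (u n) s)%:E) @ \oo --> (g s)%:E}.
  apply: filterS2 cq gE => s h1 h2 _; apply/fine_cvgP; split; first exact: nearW.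
  by rewrite -h2; exact: h1.
have bd : {ae mu, forall s n, setT s -> (`|(quot v (u n) s)%:E| <= (`|v| * k s)%:E)%E}.
  by apply: filterS flip => s h n _; rewrite abse_EFin lee_fin mulrC quot_le.
have mqE n : measurable_fun setT (fun s => (quot v (u n) s)%:E).
  by apply/measurable_EFinP.
have mgE : measurable_fun setT (fun s => (g s)%:E) by apply/measurable_EFinP.
have [ig _ cI] := dominated_convergence measurableT mqE mgE cqE (integrableZR `|v| ik) bd.
split; first exact: ig.
rewrite (ae_eq_Rintegral_any gE).
apply: (@fine_cvg _ _ _ _ _ (\int[mu]_x g x)).
rewrite (EFin_Rintegral ig); exact: cI.
Qed.

Let invS_neq0 (n : nat) : (n.+1%:R^-1 : R) != 0. Proof. by rewrite invr_eq0 pnatr_eq0. Qed.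

(* The differential need not be measurable in [s] on the exceptional null set,
   whence a measurable version. *)
Lemma measurable_version_diff v : exists2 g : T -> R,
  intble g & {ae mu, forall s, ('d (f s : V -> R^o) z v : R) = g s}.
Proof.
have [ig _] := seq_cvg v invS_neq0 (@cvg_harmonic R).
exists (real_limsup (fun n => quot v n.+1%:R^-1)) => //.
apply: filterS fdiff => s dfs; apply/esym/real_limsupE.
by have /cvgr_dnbhsP := @quot_cvg s v dfs; apply; split; [exact: invS_neq0|exact: cvg_harmonic].
Qed.

Lemma derive_integral v :
  e^-1 * (\int[mu]_s f s (e *: v + z) - \int[mu]_s f s z) @[e --> 0^'] -->
  \int[mu]_s ('d (f s : V -> R^o) z v : R).
Proof.
apply/cvgr_dnbhsP => u [u0 ucv].
have [_ c] := seq_cvg v u0 ucv.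
rewrite (_ : (fun n => _) = fun n => \int[mu]_s quot v (u n) s)//.
apply/funext => n; rewrite -RintegralB; [|by []|exact: integrable_lipschitz..].
by rewrite -RintegralZl//; apply: integrableBR; exact: integrable_lipschitz.
Qed.

Lemma Rintegral_diffD v v' : \int[mu]_s ('d (f s : V -> R^o) z (v + v') : R) =
  \int[mu]_s ('d (f s : V -> R^o) z v : R) + \int[mu]_s ('d (f s : V -> R^o) z v' : R).
Proof.
have [g ig gE] := measurable_version_diff v.
have [g' ig' gE'] := measurable_version_diff v'.
rewrite (ae_eq_Rintegral_any gE) (ae_eq_Rintegral_any gE') -RintegralD//.
by apply: ae_eq_Rintegral_any; apply: filterS2 gE gE' => s <- <-; rewrite linearD.
Qed.

Lemma Rintegral_diffZ (c : R) v : \int[mu]_s ('d (f s : V -> R^o) z (c *: v) : R) =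
  c * \int[mu]_s ('d (f s : V -> R^o) z v : R).
Proof.
have [g ig gE] := measurable_version_diff v.
rewrite (ae_eq_Rintegral_any gE) -RintegralZl//.
by apply: ae_eq_Rintegral_any; apply: filterS gE => s <-; rewrite linearZ.
Qed.

End derivative_under_integral.

Section first_order_convexity.
Local Open Scope convex_scope.
Context d (T : measurableType d) (R : realType) (n l : nat).
Variable mu : {measure set T -> \bar R}.
Notation V := ('cV[R]_n * 'cV[R]_l)%type.
Variables (f : T -> V -> R) (k : T -> R) (h : V -> R) (F : 'cV[R]_n -> 'cV[R]_l -> R).
Variables (U : set 'cV[R]_l) (x x' : 'cV[R]_n) (u u' : 'cV[R]_l).
Local Notation z' := (x', u').
Local Notation intble f := (mu.-integrable setT (EFin \o f)).
Hypothesis mf : forall y, measurable_fun setT (f ^~ y).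
Hypothesis ik : intble k.
Hypothesis f0 : {ae mu, forall s, f s 0 = 0}.
Hypothesis flip : {ae mu, forall s, forall y y', `|f s y - f s y'| <= k s * `|y - y'|}.
Hypothesis fdiff : {ae mu, forall s, differentiable (f s : V -> R^o) z'}.
Hypothesis hdiff : differentiable (h : V -> R^o) z'.
Hypothesis FE : forall y v, F y v = h (y, v) + \int[mu]_s f s (y, v).

Let dh (v : V) : R := 'd (h : V -> R^o) z' v.

Let dhD v v' : dh (v + v') = dh v + dh v'. Proof. exact: linearD. Qed.

Let dhZ c v : dh (c *: v) = c * dh v. Proof. exact: linearZ. Qed.

Let DF (v : V) : R :=
  dh v + \int[mu]_s ('d (f s : V -> R^o) z' v : R).

Let FE' (y : V) : F y.1 y.2 = h y + \int[mu]_s f s y.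
Proof. by rewrite FE; case: y. Qed.

Let DF_cvg v : e^-1 * (F (e *: v + z').1 (e *: v + z').2 - F x' u') @[e --> 0^'] --> DF v.
Proof.
rewrite (_ : (fun e => _) = fun e => e^-1 * (h (e *: v + z') - h z') +
   e^-1 * (\int[mu]_s f s (e *: v + z') - \int[mu]_s f s z')); last first.
  apply/funext => e; rewrite (FE' (e *: v + z')) FE; ring.
apply: cvgD; last exact: derive_integral flip fdiff _.
have := @diff_derivable _ _ _ _ _ v hdiff.
by rewrite /dh -deriveE.
Qed.

Let DFD v v' : DF (v + v') = DF v + DF v'.
Proof.
rewrite /DF (Rintegral_diffD mf ik flip fdiff).
rewrite dhD.
by ring.
Qed.

Let DFZ c v : DF (c *: v) = c * DF v.
Proof.
rewrite /DF (Rintegral_diffZ mf ik flip fdiff).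
rewrite dhZ.
by ring.
Qed.

(** The gradient consists of partial derivatives only; additivity and homogeneity of [DF] extend the
    formula to all directions. *)
Let DF_grad (v : 'cV[R]_l) : DF (0, v) = dotv (grad (F x') u') v.
Proof.
have gradE j : grad (F x') u' j 0 = DF (0, delta_mx j 0).
  rewrite /grad mxE; apply: cvg_lim => //.
  rewrite (_ : (fun e => _) = fun e => e^-1 * (F (e *: ((0 : 'cV[R]_n), delta_mx j 0) + z').1
     (e *: ((0 : 'cV[R]_n), delta_mx j 0) + z').2 - F x' u')).
    exact: DF_cvg.
  by apply/funext => e /=; rewrite scaler0 add0r.
rewrite /dotv; under eq_bigr do rewrite gradE mulrC -DFZ.
have -> : (0, v) = \sum_j (v j 0 *: ((0 : 'cV[R]_n), delta_mx j 0)) :> V.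
  rewrite [LHS](_ : _ = ((\sum_j (v j 0 *: ((0 : 'cV[R]_n), delta_mx j 0 : 'cV[R]_l))).1,
    (\sum_j (v j 0 *: ((0 : 'cV[R]_n), delta_mx j 0 : 'cV[R]_l))).2)); last first.
    rewrite (big_morph fst (id1 := 0) (op1 := +%R))//.
    rewrite (big_morph snd (id1 := 0) (op1 := +%R))//=.
    congr (_, _); first by rewrite big1// => j _; rewrite scaler0.
    rewrite {1}(matrix_sum_delta v); apply: eq_bigr => j _.
    by rewrite big_ord1.
  by case: (\sum_j _).
elim: (index_enum _) => [|j s ih]; last by rewrite !big_cons DFD ih.
rewrite !big_nil; have := DFZ 0 0.
by rewrite scale0r mul0r.
Qed.

(** Directional derivatives of [F] that are linear in the direction suffice. By convexity
    [F(z) - F(z')] dominates the quotients at steps [1/(m+1)], hence the derivative along [z - z'];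
    the part of that derivative along the control is nonnegative by the minimum condition. *)
Lemma convex_first_order :
  convex_function ([set: 'cV[R]_n] `*` U : set (convex_lmodType V)) (fun z => F z.1 z.2) ->
  U u -> U u' -> 0 <= dotv (grad (F x') u') (u - u') ->
  ('d (h : V -> R^o) z' (x - x', 0) : R) +
    \int[mu]_s ('d (f s : V -> R^o) z' (x - x', 0) : R) <= F x u - F x' u'.
Proof.
move=> cF Uu Uu' g0.
rewrite -/(DF (x - x', 0)); apply: (@le_trans _ _ (DF ((x, u) - z'))).
  have -> : (x, u) - z' = (x - x', 0) + (0, u - u') :> V.
    by congr (_, _) => /=; rewrite ?addr0 ?add0r.
  by rewrite DFD DF_grad lerDl.
have c : (fun m : nat => (m.+1%:R^-1)^-1 * (F (m.+1%:R^-1 *: ((x, u) - z') + z').1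
    (m.+1%:R^-1 *: ((x, u) - z') + z').2 - F x' u')) @ \oo --> DF ((x, u) - z').
  have /cvgr_dnbhsP := @DF_cvg ((x, u) - z'); apply; split.
    by move=> m; rewrite invr_eq0 pnatr_eq0.
  exact: cvg_harmonic.
rewrite -(cvg_lim (@Rhausdorff R) c); apply: limr_le.
  by apply/cvg_ex; eexists; exact: c.
apply: nearW => m; set e : R := m.+1%:R^-1.
have e0 : 0 < e by rewrite invr_gt0 ltr0n.
have e1 : e <= 1 by rewrite invf_le1 ?ltr0n// ler1n.
have xU : (x, u) \in ([set: 'cV[R]_n] `*` U : set (convex_lmodType V)) by apply/mem_set.
have xU' : z' \in ([set: 'cV[R]_n] `*` U : set (convex_lmodType V)) by apply/mem_set.
have := cF (Itv01 (ltW e0) e1) (x, u) z' xU xU'.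
rewrite convRE.
have -> : ((x, u) : convex_lmodType V) <| Itv01 (ltW e0) e1 |> z' =
    e *: ((x, u) - z') + z' :> V.
  rewrite scalerBr -addrA; congr (_ + _).
  rewrite [LHS](_ : _ = (1 - e) *: (z' : V))//.
  by rewrite scalerBl scale1r addrC.
rewrite [X in _ <= X](_ : _ = e * F x u + (1 - e) * F x' u')// => h1.
have -> : F x u - F x' u' = e^-1 * (e * (F x u - F x' u')).
  by rewrite mulrA mulVf ?mul1r// gt_eqF.
apply: ler_wpM2l; first by rewrite invr_ge0 ltW.
rewrite lerBlDr; apply: le_trans h1 _.
by lra.
Qed.

End first_order_convexity.

Section weighted_sum.
Context d (T : measurableType d) (R : realType) (n l : nat) (J : finType).
Variable mu : {measure set T -> \bar R}.
Notation V := ('cV[R]_n * 'cV[R]_l)%type.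
Variables (e : T -> R) (beta : J -> T -> V -> R) (L : J -> T -> R) (z' : V).
Local Notation intble f := (mu.-integrable setT (EFin \o f)).

(** Common integrand of the Hamiltonian and of the adjoint equation: discount [e], coefficients
    [beta], dual variables [p]. The two differ only in [p]. *)
Definition weighted_sum (p : J -> T -> R) (s : T) (z : V) : R :=
  e s * \sum_a beta a s z * p a s.

Hypothesis e0 : forall s, 0 <= e s.
Hypothesis beta0 : {ae mu, forall s, forall a, beta a s 0 = 0}.
Hypothesis beta_lip : {ae mu, forall s, forall a y y',
  `|beta a s y - beta a s y'| <= L a s * `|y - y'|}.
Hypothesis beta_diff : {ae mu, forall s, forall a,
  differentiable (beta a s : V -> R^o) z'}.

Section coefficient.
Variable p : J -> T -> R.
Hypothesis mp : forall a z, measurable_fun setT (fun s => e s * beta a s z * p a s).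
Hypothesis ip : forall a, intble (fun s => e s * L a s * `|p a s|).

Let kernel s := \sum_a e s * L a s * `|p a s|.

Lemma integrable_weight : intble kernel.
Proof. exact: integrable_sumR. Qed.

Lemma measurable_weighted_sum z : measurable_fun setT (weighted_sum p ^~ z).
Proof.
rewrite (_ : weighted_sum p ^~ z = fun s => \sum_a e s * beta a s z * p a s).
  exact: measurable_sum.
by apply/funext => s; rewrite /weighted_sum mulr_sumr; apply: eq_bigr => a _; rewrite mulrA.
Qed.

Lemma weighted_sum0 : {ae mu, forall s, weighted_sum p s 0 = 0}.
Proof.
apply: filterS beta0 => s b0; rewrite /weighted_sum big1 ?mulr0// => a _.
by rewrite b0 mul0r.
Qed.

Lemma weighted_sum_lip : {ae mu, forall s, forall y y',
  `|weighted_sum p s y - weighted_sum p s y'| <= kernel s * `|y - y'|}.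
Proof.
apply: filterS beta_lip => s bl y y'.
rewrite /weighted_sum -mulrBr -sumrB normrM ger0_norm// /kernel mulr_suml.
under [leRHS]eq_bigr do rewrite -!mulrA.
rewrite -mulr_sumr ler_wpM2l//; apply: le_trans (ler_norm_sum _ _ _) _.
by apply: ler_sum => a _; rewrite -mulrBl normrM mulrCA mulrC ler_wpM2l.
Qed.

Let weighted_sum_fun s : (weighted_sum p s : V -> R^o) =
  e s \*: (\sum_(i < #|J|) (p (enum_val i) s \*: (beta (enum_val i) s : V -> R^o))).
Proof.
apply/funext => z; rewrite /weighted_sum /=; congr (_ * _).
rewrite fct_sumE (reindex (@enum_val J predT))/=; last first.
  by apply: onW_bij; exact: enum_val_bij.
by apply: eq_bigr => i _; rewrite mulrC.
Qed.

Lemma weighted_sum_diff : {ae mu, forall s,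
  differentiable (weighted_sum p s : V -> R^o) z'}.
Proof.
apply: filterS beta_diff => s bd; rewrite weighted_sum_fun.
by apply: differentiableZ; apply: differentiable_sum => i; exact: differentiableZ.
Qed.

Lemma diff_weighted_sum : {ae mu, forall s, forall v,
  ('d (weighted_sum p s : V -> R^o) z' v : R) =
  e s * \sum_a ('d (beta a s : V -> R^o) z' v : R) * p a s}.
Proof.
apply: filterS2 weighted_sum_diff beta_diff => s ws bd v.
have c1 := @diff_derivable _ _ _ _ _ v ws.
have q a : e^-1 * (beta a s (e *: v + z') - beta a s z') @[e --> 0^'] -->
    ('d (beta a s : V -> R^o) z' v : R).
  by have := @diff_derivable _ _ _ _ _ v (bd a); rewrite -deriveE.
rewrite -deriveE//; apply: cvg_lim => //.
rewrite (_ : (fun h => _) = fun h => e s * \sum_(a <- index_enum J)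
    (h^-1 * (beta a s (h *: v + z') - beta a s z')) * p a s); last first.
  apply/funext => h; rewrite /weighted_sum /= /GRing.scale/= -mulrBr -sumrB mulrCA.
  by congr (_ * _); rewrite mulr_sumr; apply: eq_bigr => a _; rewrite -mulrBl mulrA.
apply: cvgMl_tmp; elim: (index_enum J) => [|a r ih].
  by rewrite big_nil; under eq_fun do rewrite big_nil; exact: cvg_cst.
rewrite big_cons; under eq_fun do rewrite big_cons.
by apply: cvgD; [exact: cvgMr_tmp (q a)|exact: ih].
Qed.

End coefficient.

Variables (p p' : J -> T -> R).
Hypothesis mp : forall a z, measurable_fun setT (fun s => e s * beta a s z * p a s).
Hypothesis ip : forall a, intble (fun s => e s * L a s * `|p a s|).
Hypothesis mp' : forall a z, measurable_fun setT (fun s => e s * beta a s z * p' a s).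
Hypothesis ip' : forall a, intble (fun s => e s * L a s * `|p' a s|).
Variables (h : V -> R) (F : 'cV[R]_n -> 'cV[R]_l -> R).
Variables (U : set 'cV[R]_l) (x : 'cV[R]_n) (u : 'cV[R]_l) (eta : 'cV[R]_n).
Hypothesis hdiff : differentiable (h : V -> R^o) z'.
Hypothesis FE : forall y v, F y v = h (y, v) + \int[mu]_s weighted_sum p s (y, v).
Hypothesis etaE : forall j, eta j 0 =
  ('d (h : V -> R^o) z' (delta_mx j 0, 0) : R) +
  \int[mu]_s ('d (weighted_sum p' s : V -> R^o) z' (delta_mx j 0, 0) : R).

(** [etaE] covers the coordinate directions, and its right-hand side is linear in the direction. *)
Let adjoint_direction (v : 'cV[R]_n) : dotv eta v =
  ('d (h : V -> R^o) z' (v, 0) : R) +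
  \int[mu]_s ('d (weighted_sum p' s : V -> R^o) z' (v, 0) : R).
Proof.
pose dh (y : V) : R := 'd (h : V -> R^o) z' y.
have dhD y y' : dh (y + y') = dh y + dh y' by exact: linearD.
have dhZ c y : dh (c *: y) = c * dh y by exact: linearZ.
pose D (y : V) : R := dh y +
  \int[mu]_s ('d (weighted_sum p' s : V -> R^o) z' y : R).
have mw := measurable_weighted_sum mp'.
have iw := integrable_weight ip'.
have DD y y' : D (y + y') = D y + D y'.
  rewrite /D (Rintegral_diffD mw iw (weighted_sum_lip p') (weighted_sum_diff p')).
  rewrite dhD.
  by ring.
have DZ c y : D (c *: y) = c * D y.
  rewrite /D (Rintegral_diffZ mw iw (weighted_sum_lip p') (weighted_sum_diff p')).
  rewrite dhZ.
  by ring.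
rewrite /dotv; under eq_bigr do rewrite etaE -/(D _) mulrC -DZ.
have -> : (v, 0) = \sum_j (v j 0 *: (delta_mx j 0, (0 : 'cV[R]_l))) :> V.
  rewrite [LHS](_ : _ = ((\sum_j (v j 0 *: (delta_mx j 0 : 'cV[R]_n, (0 : 'cV[R]_l)))).1,
    (\sum_j (v j 0 *: (delta_mx j 0 : 'cV[R]_n, (0 : 'cV[R]_l)))).2)); last first.
    rewrite (big_morph fst (id1 := 0) (op1 := +%R))//.
    rewrite (big_morph snd (id1 := 0) (op1 := +%R))//=.
    congr (_, _); last by rewrite big1// => j _; rewrite scaler0.
    rewrite {1}(matrix_sum_delta v); apply: eq_bigr => j _.
    by rewrite big_ord1.
  by case: (\sum_j _).
rewrite -/(D _); elim: (index_enum _) => [|j s ih]; last by rewrite !big_cons DD ih.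
rewrite !big_nil; have := DZ 0 0.
by rewrite scale0r mul0r.
Qed.

(** First-order convexity involves the dual [p] of the Hamiltonian, whereas [eta] expresses the
    derivative of [h] through the dual [p'] of the adjoint equation. Eliminating that derivative
    leaves the derivatives of the coefficients paired with [p - p']. *)
Lemma hamiltonian_gap (x' : 'cV[R]_n) (u' : 'cV[R]_l) : z' = (x', u') ->
  convex_function ([set: 'cV[R]_n] `*` U : set (convex_lmodType V)) (fun z => F z.1 z.2) ->
  U u -> U u' -> 0 <= dotv (grad (F x') u') (u - u') ->
  dotv eta (x - x') + \int[mu]_s (e s * \sum_a
    (('d (beta a s : V -> R^o) z' (x - x', 0) : R) * (p a s - p' a s) -
     (beta a s (x, u) - beta a s (x', u')) * p a s)) <= h (x, u) - h (x', u').
Proof.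
move=> zE cF Uu Uu' g0.
have mw := measurable_weighted_sum mp; have iw := integrable_weight ip.
have mw' := measurable_weighted_sum mp'; have iw' := integrable_weight ip'.
have wl := weighted_sum_lip p; have wd := weighted_sum_diff p.
have w0 := weighted_sum0 p.
have wl' := weighted_sum_lip p'; have wd' := weighted_sum_diff p'.
have [g ig gE] := measurable_version_diff mw iw wl wd (x - x', 0).
have [g' ig' gE'] := measurable_version_diff mw' iw' wl' wd' (x - x', 0).
have i1 := integrable_lipschitz mw iw w0 wl (x, u).
have i2 := integrable_lipschitz mw iw w0 wl (x', u').
have fo : ('d (h : V -> R^o) z' (x - x', 0) : R) +
    \int[mu]_s ('d (weighted_sum p s : V -> R^o) z' (x - x', 0) : R) <= F x u - F x' u'.
  move: wd hdiff; rewrite zE => wd1 hd1.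
  exact: (convex_first_order x mw iw w0 wl wd1 hd1 FE cF Uu Uu' g0).
rewrite adjoint_direction (ae_eq_Rintegral_any gE').
rewrite (ae_eq_Rintegral_any gE) !FE in fo.
have -> : \int[mu]_s (e s * \sum_a
    (('d (beta a s : V -> R^o) z' (x - x', 0) : R) * (p a s - p' a s) -
     (beta a s (x, u) - beta a s (x', u')) * p a s)) =
   \int[mu]_s (g s - g' s - (weighted_sum p s (x, u) - weighted_sum p s (x', u'))).
  apply: ae_eq_Rintegral_any.
  have dw := diff_weighted_sum p; have dw' := diff_weighted_sum p'.
  apply: filterS (filterI (filterI gE gE') (filterI dw dw')) => s [[e1 e2] [e3 e4]].
  rewrite (etrans (esym e1) (e3 (x - x', 0))) (etrans (esym e2) (e4 (x - x', 0))).
  rewrite /weighted_sum -!mulrBr -!sumrB; congr (_ * _); apply: eq_bigr => a _; ring.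
rewrite RintegralB//; [|exact: integrableBR..].
by rewrite !RintegralB//; lra.
Qed.

End weighted_sum.

(** * Products and adapted fields *)

Section almost_everywhere_product.
Context d1 d2 (T1 : measurableType d1) (T2 : measurableType d2) (R : realType).
Variables (m1 : {sigma_finite_measure set T1 -> \bar R})
  (m2 : {sigma_finite_measure set T2 -> \bar R}).

Let ae_section0 d (T : measurableType d) (m : {measure set T -> \bar R})
    (f : T -> \bar R) : measurable_fun setT f -> (forall x, (0 <= f x)%E) ->
  (\int[m]_x f x = 0)%E -> {ae m, forall x, f x = 0%E}.
Proof.
move=> mf f0 If0.
have : (\int[m]_x `|f x| = 0)%E.
  by rewrite -If0; apply: eq_integral => x _; rewrite gee0_abs.
by move=> /(ae_eq_integral_abs m measurableT mf); apply: filterS => x /(_ I).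
Qed.

Lemma ae_prod1 (Q : T1 * T2 -> Prop) : {ae (m1 \x m2)%E, forall q, Q q} ->
  {ae m1, forall x, {ae m2, forall y, Q (x, y)}}.
Proof.
move=> [N [mN N0 QN]].
have := @ae_section0 _ _ m1 (fun x => m2 (xsection N x))
  (measurable_fun_xsection m2 mN) (fun x => measure_ge0 _ _) N0.
apply: filterS => x Nx; exists (xsection N x); split => //.
  exact: measurable_xsection.
by move=> y /= nQ; rewrite /xsection/=; apply/mem_set/QN.
Qed.

Lemma ae_prod2 (Q : T1 * T2 -> Prop) : {ae (m1 \x m2)%E, forall q, Q q} ->
  {ae m2, forall y, {ae m1, forall x, Q (x, y)}}.
Proof.
move=> [N [mN N0 QN]].
(* The product measure is defined by sections in one direction; those in the other give the same
   measure, by uniqueness on rectangles. *)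
have N0' : (\int[m2]_y m1 (ysection N y) = 0)%E.
  transitivity ((m1 \x m2)%E N) => //.
  apply: esym; apply: (@product_measure_unique _ _ _ _ _ m1 m2 (m1 \x^ m2)%E) => //.
  by move=> A B mA mB; exact: product_measure2E.
have := @ae_section0 _ _ m2 (fun y => m1 (ysection N y))
  (measurable_fun_ysection m1 mN) (fun x => measure_ge0 _ _) N0'.
apply: filterS => y Ny; exists (ysection N y); split => //.
  exact: measurable_ysection.
by move=> x /= nQ; rewrite /ysection/=; apply/mem_set/QN.
Qed.

Lemma ae_prod_snd (Q : T2 -> Prop) : {ae m2, forall y, Q y} ->
  {ae (m1 \x m2)%E, forall q, Q q.2}.
Proof.
move=> [N [mN N0 QN]]; exists (setT `*` N); split.
- exact: measurableX.
- by rewrite product_measure1E// N0 mule0.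
- by move=> [x y] /= nQ; split => //; exact: QN.
Qed.

Local Notation intble m f := (m.-integrable setT (EFin \o f)).

Section real_fubini.
Variable f : T1 * T2 -> R.
Hypothesis fi : intble (m1 \x m2)%E f.

Lemma ae_integrable_fst : {ae m1, forall x, intble m2 (fun y => f (x, y))}.
Proof. exact: ae_integrable1 fi. Qed.

Lemma ae_integrable_snd : {ae m2, forall y, intble m1 (fun x => f (x, y))}.
Proof. exact: ae_integrable2 fi. Qed.

Let integrable_fine d (T : measurableType d) (m : {measure set T -> \bar R})
    (F : T -> \bar R) : m.-integrable setT F -> intble m (fine \o F).
Proof.
move=> /integrableP[mF iF]; apply/integrableP; split.
  by apply/measurable_EFinP; apply: measurableT_comp mF; exact: fine_measurable.
apply: le_lt_trans iF; apply: ge0_le_integral => //.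
- apply: measurableT_comp => //; apply/measurable_EFinP.
  by apply: measurableT_comp mF; exact: fine_measurable.
- exact: measurableT_comp.
- by move=> x _ /=; case: (F x) => [r| |]//=; rewrite normr0 leey.
Qed.

Let Rintegral_fine d (T : measurableType d) (m : {measure set T -> \bar R})
    (F : T -> \bar R) : m.-integrable setT F ->
  \int[m]_x fine (F x) = fine (\int[m]_x F x)%E.
Proof.
move=> iF; rewrite /Rintegral; congr fine; apply: ae_eq_integral_any.
by apply: filterS (integrable_ae measurableT iF) => x /(_ I) /fineK.
Qed.

Let integrable_fubini_G : m2.-integrable setT (fubini_G m1 (EFin \o f)).
Proof.
have mf := measurable_int _ fi.
apply/integrableP; split; first exact: measurable_fubini_G fi.
apply: le_lt_trans ((integrable21ltyP m1 m2 mf).1 fi); apply: ge0_le_integral => //.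
- by apply: measurableT_comp => //; exact: measurable_fubini_G fi.
- apply: (measurable_fun_fubini_tonelli_G (m1 := m1) (fun q => `|(f q)%:E|%E)) => //.
  exact: measurableT_comp.
- move=> y _; apply: le_abse_integral => //.
  by apply: measurableT_comp => //; exact: measurable_pair2.
Qed.

Lemma integrable_Rintegral_snd : intble m1 (fun x => \int[m2]_y f (x, y)).
Proof. exact: integrable_fine (integrable_fubini_F fi). Qed.

Lemma integrable_Rintegral_fst : intble m2 (fun y => \int[m1]_x f (x, y)).
Proof. exact: integrable_fine integrable_fubini_G. Qed.

Lemma Rintegral_prod_fst : \int[m1]_x \int[m2]_y f (x, y) = \int[(m1 \x m2)%E]_q f q.
Proof.
rewrite (Rintegral_fine (integrable_fubini_F fi)).
by rewrite (integral12_prod_meas1 fi).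
Qed.

Lemma Rintegral_prod_snd : \int[m2]_y \int[m1]_x f (x, y) = \int[(m1 \x m2)%E]_q f q.
Proof.
rewrite (Rintegral_fine integrable_fubini_G).
by rewrite (integral21_prod_meas1 fi).
Qed.

End real_fubini.
End almost_everywhere_product.

(* Same remark as for [lebesgue2]. *)
Section process_measure.
Context d (T : measurableType d) (R : realType) (P : probability T R).
Notation leb := (@lebesgue_measure R).
Notation mR := (measurableTypeR R).

Definition process_measure : set (T * mR) -> \bar R := (P \x leb)%E.

HB.instance Definition _ := Measure.on process_measure.

Let process_measure_sigma_finite : sigma_finite setT process_measure.
Proof.
have /sigma_finiteP[F [TF ndF Foo]] := sigma_finiteT leb.
exists (fun n => setT `*` F n).
  by rewrite -setXTT TF; apply/seteqP; split => -[x y] /=;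
    [move=> [_ [n _ h]]|move=> [n _ [_ h]]; split => //]; exists n.
move=> k; have [mF Fk] := Foo k; split; first exact: measurableX.
rewrite /process_measure product_measure1E//.
apply: lte_mul_pinfty => //; exact: fin_num_measure.
Qed.

HB.instance Definition _ := Measure_isSigmaFinite.Build _ _ _ process_measure
  process_measure_sigma_finite.

Notation P2 := process_measure.
Notation P3 := (P \x @lebesgue2 R)%E.
Local Notation intble m f := (m.-integrable setT (EFin \o f)).

(** Brings the second time outermost, so that it can be frozen while the process measure in the
    sample point and the other time remains. *)
Lemma ge0_integral_time2 (G : T * (mR * mR) -> \bar R) :
  measurable_fun setT G -> (forall q, (0 <= G q)%E) ->
  (\int[(leb \x P2)%E]_q G (q.2.1, (q.2.2, q.1)) = \int[P3]_q G q)%E.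
Proof.
move=> mG G0.
have mphi : measurable_fun setT (fun q : mR * (T * mR) => (q.2.1, (q.2.2, q.1))).
  apply: measurable_fun_pair; first exact: measurableT_comp measurable_fst measurable_snd.
  by apply: measurable_fun_pair => //; exact: measurableT_comp measurable_snd measurable_snd.
rewrite fubini_tonelli1//=; last exact: measurableT_comp.
rewrite [RHS]fubini_tonelli2//= fubini_tonelli2//=; last first.
- by move=> q; apply: integral_ge0.
- exact: (measurable_fun_fubini_tonelli_G (m1 := P)).
apply: eq_integral => t _; rewrite /fubini_F/=.
rewrite [LHS]fubini_tonelli2//=.
apply: measurableT_comp => //; apply: measurable_fun_pair => //.
by apply: measurable_fun_pair.
Qed.

Lemma ge0_integral_time1 (G : T * (mR * mR) -> \bar R) :
  measurable_fun setT G -> (forall q, (0 <= G q)%E) ->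
  (\int[(leb \x P2)%E]_q G (q.2.1, (q.1, q.2.2)) = \int[P3]_q G q)%E.
Proof.
move=> mG G0.
have mphi : measurable_fun setT (fun q : mR * (T * mR) => (q.2.1, (q.1, q.2.2))).
  apply: measurable_fun_pair; first exact: measurableT_comp measurable_fst measurable_snd.
  by apply: measurable_fun_pair => //; exact: measurableT_comp measurable_snd measurable_snd.
rewrite fubini_tonelli1//=; last exact: measurableT_comp.
rewrite [RHS]fubini_tonelli2//= fubini_tonelli1//=; last first.
- by move=> q; apply: integral_ge0.
- exact: (measurable_fun_fubini_tonelli_G (m1 := P)).
apply: eq_integral => t _; rewrite /fubini_F/=.
rewrite [LHS]fubini_tonelli2//=.
apply: measurableT_comp => //; apply: measurable_fun_pair => //.
by apply: measurable_fun_pair.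
Qed.

Section reorder.
Variable f : T * (mR * mR) -> R.
Hypothesis fi : intble P3 f.

Let mf := integrable_measurable fi.

Let time1 (q : mR * (T * mR)) : T * (mR * mR) := (q.2.1, (q.1, q.2.2)).
Let time2 (q : mR * (T * mR)) : T * (mR * mR) := (q.2.1, (q.2.2, q.1)).

Let measurable_time1 : measurable_fun setT time1.
Proof.
apply: measurable_fun_pair; first exact: measurableT_comp measurable_fst measurable_snd.
by apply: measurable_fun_pair => //; exact: measurableT_comp measurable_snd measurable_snd.
Qed.

Let measurable_time2 : measurable_fun setT time2.
Proof.
apply: measurable_fun_pair; first exact: measurableT_comp measurable_fst measurable_snd.
by apply: measurable_fun_pair => //; exact: measurableT_comp measurable_snd measurable_snd.
Qed.

(** A change of variables known for nonnegative functions preserves integrability and, through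
    positive and negative parts, the integral. *)
Let transfer (phi : mR * (T * mR) -> T * (mR * mR)) :
  measurable_fun setT phi ->
  (forall G : T * (mR * mR) -> \bar R, measurable_fun setT G -> (forall q, (0 <= G q)%E) ->
    (\int[(leb \x P2)%E]_q G (phi q) = \int[P3]_q G q)%E) ->
  intble (leb \x P2)%E (f \o phi) /\ \int[(leb \x P2)%E]_q f (phi q) = \int[P3]_q f q.
Proof.
move=> mphi phiE; have /integrableP[mfE fi'] := fi.
split.
  apply/integrableP; split; first exact: measurableT_comp mfE mphi.
  rewrite (phiE (fun q => `|(f q)%:E|%E))//.
  exact: measurableT_comp.
congr fine; rewrite integralE [RHS]integralE.
rewrite -(phiE (fun q => ((EFin \o f)^\+ q)%E)) -?(phiE (fun q => ((EFin \o f)^\- q)%E))//.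
- by congr (_ - _)%E; apply: eq_integral => q _; rewrite ?funeposE ?funenegE.
- exact: measurable_funeneg.
- exact: measurable_funepos.
Qed.

Let transfer1 := transfer measurable_time1 ge0_integral_time1.
Let transfer2 := transfer measurable_time2 ge0_integral_time2.

Lemma ae_integrable_time1 :
  {ae leb, forall t, intble P2 (fun q => f (q.1, (t, q.2)))}.
Proof. exact: (ae_integrable_fst transfer1.1). Qed.

Lemma ae_integrable_time2 :
  {ae leb, forall s, intble P2 (fun q => f (q.1, (q.2, s)))}.
Proof. exact: (ae_integrable_fst transfer2.1). Qed.

Lemma integrable_Rintegral_time1 :
  intble leb (fun t => \int[P2]_q f (q.1, (t, q.2))).
Proof. exact: (integrable_Rintegral_snd transfer1.1). Qed.

Lemma integrable_Rintegral_time2 :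
  intble leb (fun s => \int[P2]_q f (q.1, (q.2, s))).
Proof. exact: (integrable_Rintegral_snd transfer2.1). Qed.

Lemma Rintegral_time1 :
  \int[leb]_t \int[P2]_q f (q.1, (t, q.2)) = \int[P3]_q f q.
Proof. by rewrite -transfer1.2 -(Rintegral_prod_fst transfer1.1). Qed.

Lemma Rintegral_time2 :
  \int[leb]_s \int[P2]_q f (q.1, (q.2, s)) = \int[P3]_q f q.
Proof. by rewrite -transfer2.2 -(Rintegral_prod_fst transfer2.1). Qed.

End reorder.
End process_measure.

(* Unlike [filterS] and [filterI], [aeS] and [aeI] do not need the inference of
   a filter instance, which fails on some forms of the Lebesgue measure. *)
Section almost_everywhere.
Context d (T : measurableType d) (R : realType).

Lemma aeS (mu : set T -> \bar R) (Q Q' : T -> Prop) : (forall x, Q x -> Q' x) ->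
  {ae mu, forall x, Q x} -> {ae mu, forall x, Q' x}.
Proof.
move=> QQ' [N [mN N0 QN]]; exists N; split=> // x nQ'.
by apply: QN => /= /QQ'.
Qed.

Lemma aeI (mu : {measure set T -> \bar R}) (Q Q' : T -> Prop) :
  {ae mu, forall x, Q x} -> {ae mu, forall x, Q' x} ->
  {ae mu, forall x, Q x /\ Q' x}.
Proof. exact: filterI. Qed.

Lemma ae_finite (mu : {measure set T -> \bar R}) (I : finType) (Q : I -> T -> Prop) :
  (forall i, {ae mu, forall x, Q i x}) -> {ae mu, forall x, forall i, Q i x}.
Proof. by move=> h; apply: filter_forall. Qed.

End almost_everywhere.

(** * Replacing E_t[Y(s)] by Y(s) under an adapted weight *)

Section conditional_exchange.
Context {R : realType} {disp : measure_display} {T : measurableType disp}.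
Variables (P : probability T R) (d : nat) (W : T -> R -> 'cV[R]_d).
Hypotheses (cP : measure_is_complete P) (bm : brownian_motion P W).
Notation mR := (measurableTypeR R).
Notation leb := (@lebesgue_measure R).
Notation P2 := (process_measure P).
Notation P3 := (P \x @lebesgue2 R)%E.
Notation F := (aug_filtration P W).
Local Notation intble m f := (m.-integrable setT (EFin \o f)).

Let Fm t : F t `<=` measurable. Proof. exact: aug_filtration_measurable. Qed.
Let Fs t : sigma_algebra setT (F t). Proof. exact: aug_filtration_sigma. Qed.

(** Adapted in the first, earlier time, at every such time without exception; the later time is a
    mere parameter. *)
Definition adapted_field (xi : T * (mR * mR) -> R) : Prop :=
  measurable_fun setT xi /\
  forall t s, 0 <= t -> meas_wrt (F t) (fun w => xi (w, (t, s))).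

Definition causal (xi : T * (mR * mR) -> R) : Prop :=
  forall w t s, ~~ (0 <= t <= s) -> xi (w, (t, s)) = 0.

(** This order of integration matches [eyP], which holds for almost every [t] and then for almost
    every [s]. *)
Lemma ge0_integral_iterated (G : T * (mR * mR) -> \bar R) :
  measurable_fun setT G -> (forall q, (0 <= G q)%E) ->
  (\int[P3]_q G q = \int[leb]_t \int[leb]_s \int[P]_w G (w, (t, s)))%E.
Proof.
move=> mG G0; rewrite fubini_tonelli2// fubini_tonelli1//.
  exact: (measurable_fun_fubini_tonelli_G (m1 := P)).
by move=> q; apply: integral_ge0.
Qed.

Lemma Rintegral_iterated (f : T * (mR * mR) -> R) : intble P3 f ->
  \int[P3]_q f q = \int[leb]_t \int[leb]_s \int[P]_w f (w, (t, s)).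
Proof.
move=> fi; rewrite -(Rintegral_time1 fi); apply: ae_eq_Rintegral_any.
apply: filterS (ae_integrable_time1 fi) => t it.
by rewrite (@Rintegral_prod_snd _ _ _ _ _ P leb _ it).
Qed.

Lemma ae_integrable_iterated (f : T * (mR * mR) -> R) : intble P3 f ->
  {ae leb, forall t, {ae leb, forall s, intble P (fun w => f (w, (t, s)))}}.
Proof.
move=> fi; apply: filterS (ae_integrable_time1 fi) => t it.
exact: (@ae_integrable_snd _ _ _ _ _ P leb _ it).
Qed.

Variables (y : T * mR -> R) (ey xi : T * (mR * mR) -> R).
Hypothesis mey : measurable_fun setT ey.
Hypothesis eyP : {ae leb, forall t, 0 <= t -> {ae leb, forall s, t <= s ->
  is_condexp P (F t) (fun w => y (w, s)) (fun w => ey (w, (t, s)))}}.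
Hypotheses (axi : adapted_field xi) (cxi : causal xi).
Hypothesis iy : intble P3 (fun q => xi q * y (q.1, q.2.2)).

(** Section by section, a conditional expectation does not increase the L^1 norm for a nonnegative
    known weight, here [|xi|]. *)
Lemma integrable_condexp_field : intble P3 (fun q => xi q * ey q).
Proof.
have [mxi wxi] := axi.
have my := integrable_measurable iy.
have mf : measurable_fun setT (fun q => (xi q * ey q)%:E).
  by apply/measurable_EFinP; exact: measurable_funM.
apply/integrableP; split=> //.
have /integrableP[_] := iy; apply: le_lt_trans.
rewrite ge0_integral_iterated//; last exact: measurableT_comp.
have mgy : measurable_fun setT (fun q => `|(xi q * y (q.1, q.2.2))%:E|%E).
  by apply: measurableT_comp => //; exact/measurable_EFinP.
have e2 := ge0_integral_iterated mgy (fun=> abse_ge0 _).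
apply: (@le_trans _ _ (\int[leb]_t \int[leb]_s \int[P]_w
  `|(xi (w, (t, s)) * y (w, s))%:E|)%E); last by rewrite le_eqVlt e2 eqxx.
(* The iterated integrals are compared for almost all times only; negative times and pairs with
   [s < t] contribute 0 by causality. *)
apply: ge0_ae_le_integral_any => [t|t|].
- by apply: integral_ge0 => s _; exact: integral_ge0.
- by apply: integral_ge0 => s _; exact: integral_ge0.
apply: aeS eyP => t eyt.
apply: ge0_ae_le_integral_any => [s|s|].
- exact: integral_ge0.
- exact: integral_ge0.
have [t0|t0] := leP 0 t; last first.
  apply: aeW => s /=.
  under eq_integral do rewrite cxi ?mul0r ?leNgt ?t0//.
  by under [X in (_ <= X)%E]eq_integral do rewrite cxi ?mul0r ?leNgt ?t0//.
apply: aeS (eyt t0) => s eys /=.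
have [ts|ts] := leP t s; last first.
  under eq_integral do rewrite cxi ?mul0r ?leNgt ?ts ?andbF//.
  by under [X in (_ <= X)%E]eq_integral do rewrite cxi ?mul0r ?leNgt ?ts ?andbF//.
have mn : meas_wrt (F t) (fun w => `|xi (w, (t, s))|).
  apply/(meas_wrtP (Fs t)); apply: measurableT_comp => //.
  by apply/(meas_wrtP (Fs t)); exact: wxi.
have := condexp_abs_le (Fs t) (@Fm t) (eys ts) mn (fun=> normr_ge0 _).
under eq_integral do rewrite -normrM.
by under [X in (_ <= X)%E]eq_integral do rewrite -normrM.
Qed.

Lemma Rintegral_condexp_field :
  \int[P3]_q (xi q * ey q) = \int[P3]_q (xi q * y (q.1, q.2.2)).
Proof.
have [mxi wxi] := axi; have ie := integrable_condexp_field.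
rewrite (Rintegral_iterated ie) (Rintegral_iterated iy).
apply: ae_eq_Rintegral_any.
have ai := aeI (ae_integrable_iterated ie) (ae_integrable_iterated iy).
apply: aeS (aeI eyP ai) => t [eyt [iet iyt]]; apply: ae_eq_Rintegral_any.
have [t0|t0] := leP 0 t; last first.
  apply: aeW => s /=.
  under eq_Rintegral do rewrite cxi ?mul0r ?leNgt ?t0//.
  by under [RHS]eq_Rintegral do rewrite cxi ?mul0r ?leNgt ?t0//.
apply: aeS (aeI (eyt t0) (aeI iet iyt)) => s [eys [ies iys]] /=.
have [ts|ts] := leP t s; last first.
  under eq_Rintegral do rewrite cxi ?mul0r ?leNgt ?ts ?andbF//.
  by under [RHS]eq_Rintegral do rewrite cxi ?mul0r ?leNgt ?ts ?andbF//.
exact: (condexp_mul (Fs t) (@Fm t) (eys ts) (wxi t s t0) iys ies).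
Qed.

End conditional_exchange.

Section order_sets.
Context d (S : measurableType d) (R : realType).

Lemma measurable_nonneg_set (f : S -> R) : measurable_fun setT f ->
  measurable [set q | 0 <= f q].
Proof.
move=> mf; have m0 : measurable_fun setT (fun _ : S => 0 : R) by exact: measurable_cst.
by have := measurable_fun_ler m0 mf;
  move=> /(_ measurableT _ (I : measurable [set true])); rewrite setTI.
Qed.

Lemma measurable_ordered_set (f g : S -> R) : measurable_fun setT f ->
  measurable_fun setT g -> measurable [set q | 0 <= f q <= g q].
Proof.
move=> mf mg; have m0 : measurable_fun setT (fun _ : S => 0 : R) by exact: measurable_cst.
have := measurable_and (measurable_fun_ler m0 mf) (measurable_fun_ler mf mg).
by move=> /(_ measurableT _ (I : measurable [set true])); rewrite setTI.
Qed.

End order_sets.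

(** * Measurability of the coefficients along processes *)

Section composition.
Context d (S : measurableType d) (R : realType) (n l : nat).
Notation mR := (measurableTypeR R).
Variables (D : set S) (mD : measurable D).

(** The coefficients take tuples as measurable arguments and are measurable on a subset only;
    extending the arguments by 0 off [D] gives a globally measurable inner map. *)
Let restricted_tuple m (x : S -> 'cV[R]_m) (q : S) : m.-tuple mR :=
  [tuple (fun q => x q i 0) \_ D q | i < m].

Let measurable_restricted_tuple m (x : S -> 'cV[R]_m) :
  (forall i, measurable_fun D (fun q => x q i 0 : mR)) ->
  measurable_fun setT (restricted_tuple x).
Proof.
move=> mx; apply/measurable_fun_tnthP => i.
rewrite (_ : _ \o _ = (fun q => x q i 0 : mR) \_ D).
  exact: (measurable_restrictT _ mD).1 (mx i).
by apply/funext => q /=; rewrite tnth_mktuple.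
Qed.

Let restricted_tupleE m (x : S -> 'cV[R]_m) q : D q ->
  vec_of_tuple (restricted_tuple x q) = x q.
Proof.
move=> Dq; apply/colP => i; rewrite mxE tnth_mktuple patchE mem_set//.
Qed.

Variables (x : S -> 'cV[R]_n) (v : S -> 'cV[R]_l).
Hypothesis mx : forall i, measurable_fun D (fun q => x q i 0 : mR).
Hypothesis mv : forall i, measurable_fun D (fun q => v q i 0 : mR).

Lemma measurable_coef m k (f : R -> R -> 'cV[R]_n -> 'cV[R]_l -> 'M[R]_(m, k))
    (tau sig : S -> mR) i j : meas_coef f ->
  measurable_fun D tau -> measurable_fun D sig ->
  (forall q, D q -> 0 <= sig q <= tau q) ->
  measurable_fun D (fun q => f (tau q) (sig q) (x q) (v q) i j).
Proof.
move=> mf mt ms h.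
pose g q : (mR * mR) * (n.-tuple mR * l.-tuple mR) :=
  ((tau \_ D) q, (sig \_ D) q, (restricted_tuple x q, restricted_tuple v q)).
have mg : measurable_fun setT g.
  apply: measurable_fun_pair; apply: measurable_fun_pair.
  - exact: (measurable_restrictT _ mD).1 mt.
  - exact: (measurable_restrictT _ mD).1 ms.
  - exact: measurable_restricted_tuple.
  - exact: measurable_restricted_tuple.
pose E := [set q : (mR * mR) * (n.-tuple mR * l.-tuple mR) | 0 <= q.1.2 <= q.1.1].
have mE : measurable E.
  have m1 : measurable_fun setT (fun q : (mR * mR) * (n.-tuple mR * l.-tuple mR) => q.1.1).
    exact: measurableT_comp measurable_fst measurable_fst.
  have m2 : measurable_fun setT (fun q : (mR * mR) * (n.-tuple mR * l.-tuple mR) => q.1.2).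
    exact: measurableT_comp measurable_snd measurable_fst.
  exact: measurable_ordered_set.
apply: eq_measurable_fun; last first.
  apply: (measurable_comp mE _ (mf i j) (measurable_funTS mg)).
  by move=> _ [q Dq <-]; rewrite /E /g /= !patchE mem_set//; exact: h.
move=> q /set_mem Dq; rewrite /= !patchE mem_set//.
by rewrite !restricted_tupleE.
Qed.

Lemma measurable_cost (h : R -> 'cV[R]_n -> 'cV[R]_l -> R) (tau : S -> mR) :
  meas_cost h -> measurable_fun D tau -> (forall q, D q -> 0 <= tau q) ->
  measurable_fun D (fun q => h (tau q) (x q) (v q)).
Proof.
move=> mh mt t0.
pose g q : mR * (n.-tuple mR * l.-tuple mR) :=
  ((tau \_ D) q, (restricted_tuple x q, restricted_tuple v q)).
have mg : measurable_fun setT g.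
  apply: measurable_fun_pair; last apply: measurable_fun_pair.
  - exact: (measurable_restrictT _ mD).1 mt.
  - exact: measurable_restricted_tuple.
  - exact: measurable_restricted_tuple.
pose E := [set q : mR * (n.-tuple mR * l.-tuple mR) | 0 <= q.1].
have mE : measurable E.
  have m1 : measurable_fun setT (fun q : mR * (n.-tuple mR * l.-tuple mR) => q.1).
    exact: measurable_fst.
  exact: measurable_nonneg_set.
apply: eq_measurable_fun; last first.
  apply: (measurable_comp mE _ mh (measurable_funTS mg)).
  by move=> _ [q Dq <-]; rewrite /E /g /= !patchE mem_set//; exact: t0.
move=> q /set_mem Dq; rewrite /= !patchE mem_set//.
by rewrite !restricted_tupleE.
Qed.

End composition.

(** * Discounted processes and coefficients *)

Section discount_weights.
Context {R : realType}.
Notation leb := (@lebesgue_measure R).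
Notation mR := (measurableTypeR R).

(** Discounting a coefficient at the later time [s] and the process inside it at the earlier time
    [t] leaves the factor [e^(- mu (s - t))] on the kernel. *)
Definition delay_weight (mu : R) (Kx Ku : R -> R) : mR -> R :=
  (fun r => expR (- (mu * r)) * (Kx r + Ku r)) \_ halfline.

Lemma delay_weightE mu Kx Ku r : 0 <= r ->
  delay_weight mu Kx Ku r = expR (- (mu * r)) * (Kx r + Ku r).
Proof. by move=> r0; rewrite /delay_weight patchE halflineE r0. Qed.

Lemma delay_weight_ge0 p mu Kx Ku r : Lstar p Kx -> Lstar p Ku ->
  0 <= delay_weight mu Kx Ku r.
Proof.
move=> [_ x0 _] [_ u0 _]; rewrite /delay_weight patchE halflineE; case: ifP => // r0.
by rewrite mulr_ge0 ?expR_ge0// addr_ge0 ?x0 ?u0.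
Qed.

Let measurable_delay_weight p mu Kx Ku : Lstar p Kx -> Lstar p Ku ->
  measurable_fun setT (delay_weight mu Kx Ku).
Proof.
move=> [mx _ _] [mu' _ _]; apply/(measurable_restrictT _ _).1; first exact: measurable_halfline.
apply: measurable_funM; last exact: measurable_funD.
by apply: measurableT_comp => //; apply: measurableT_comp.
Qed.

Lemma bracket_integrable p (f : R -> R) rho : (0 < p)%N -> Lstar p f ->
  (bracket p f rho < +oo)%E ->
  leb.-integrable setT (EFin \o ((fun t => expR (- (p%:R * rho * t)) * f t ^+ p) \_ halfline)).
Proof.
move=> p0 [mf f0 _]; rewrite /bracket => h.
have mh := @measurable_halfline R.
rewrite -restrict_EFin; apply/(integrable_mkcond _ mh).1.
have mg : measurable_fun halfline (fun t : mR => expR (- (p%:R * rho * t)) * f t ^+ p).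
  apply: measurable_funM; last exact: measurable_funX.
  by apply: measurableT_comp => //; apply: measurableT_comp.
apply/integrableP; split; first exact/measurable_EFinP.
have e t : t \in (halfline : set mR) ->
   (`|(expR (- (p%:R * rho * t)) * f t ^+ p)%:E| =
   (expR (- (p%:R * rho * t)) * f t ^+ p)%:E)%E.
  rewrite halflineE => t0.
  by rewrite gee0_abs// lee_fin mulr_ge0 ?expR_ge0// exprn_ge0// f0.
(* An infinite integral would have an infinite root. *)
rewrite (eq_integral _ _ e) ltey; apply/eqP => Iy.
by move: h; rewrite Iy poweRyr ?invr_neq0 ?pnatr_eq0 -?lt0n ?gt_eqF// ?invr_gt0 ?ltr0n.
Qed.

Variables (Kbx Kbu Ksx Ksu : R -> R) (mu : R).
Hypotheses (Lbx : Lstar 1 Kbx) (Lbu : Lstar 1 Kbu) (Lsx : Lstar 2 Ksx) (Lsu : Lstar 2 Ksu).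
Hypothesis hmu : (rho_bsigma Kbx Kbu Ksx Ksu < mu%:E)%E.

(** As [mu] exceeds the infimum, some admissible [rho] lies below it; a sum of nonnegative brackets
    that is finite or at most 1 has finite terms. *)
Let rho_exists : exists rho, [/\ 0 <= rho, rho < mu,
  (bracket 1 Kbx rho < +oo)%E /\ (bracket 1 Kbu rho < +oo)%E &
  (bracket 2 Ksx rho < +oo)%E /\ (bracket 2 Ksu rho < +oo)%E].
Proof.
have /ereal_inf_lt[_ [rho [r0 h1 h2] <-]] := hmu; rewrite lte_fin => rmu.
have b0 p f : (0 <= bracket p f rho)%E by exact: poweR_ge0.
exists rho; split=> //; split.
- by apply: le_lt_trans (le_lt_trans h2 (ltry 1)); rewrite leeDl.
- by apply: le_lt_trans h1; rewrite leeDl.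
- by apply: le_lt_trans (le_lt_trans h2 (ltry 1)); rewrite leeDr.
- by apply: le_lt_trans h1; rewrite leeDr.
Qed.

(** The infimum runs over nonnegative numbers. Positivity of [mu] is what puts constants into the
    weighted L^2 space. *)
Lemma mu_gt0 : 0 < mu.
Proof. by have [rho [r0 rmu _ _]] := rho_exists; exact: le_lt_trans rmu. Qed.

(** On the half-line [e^(- mu r) <= e^(- rho r)]. *)
Lemma integrable_drift_weight : leb.-integrable setT (EFin \o delay_weight mu Kbx Kbu).
Proof.
have [rho [r0 rmu [hx hu] _]] := rho_exists.
have ix := bracket_integrable (ltn0Sn _) Lbx hx; have iu := bracket_integrable (ltn0Sn _) Lbu hu.
apply: le_integrableR (integrableDR ix iu) _; first exact: measurable_delay_weight Lbx Lbu.
move=> r; rewrite ger0_norm; last exact: delay_weight_ge0 Lbx Lbu.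
rewrite /delay_weight !patchE halflineE; case: ifP => [rr|]; last by rewrite addr0.
have [_ x0 _] := Lbx; have [_ u0 _] := Lbu.
rewrite !expr1 -mulrDr ler_wpM2r ?addr_ge0 ?x0 ?u0// ler_expR lerN2 mul1r.
by rewrite ler_wpM2r// ltW.
Qed.

(** As for the drift, together with [(Kx + Ku)^2 <= 2 (Kx^2 + Ku^2)]. *)
Lemma sq_integrable_diffusion_weight : sq_integrable leb (delay_weight mu Ksx Ksu).
Proof.
have [rho [r0 rmu _ [hx hu]]] := rho_exists.
have ix := bracket_integrable (ltn0Sn _) Lsx hx; have iu := bracket_integrable (ltn0Sn _) Lsu hu.
have md := measurable_delay_weight mu Lsx Lsu.
apply/sq_integrableP; split=> //.
apply: le_integrableR (integrableZR 2 (integrableDR ix iu)) _; first exact: measurable_funX.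
move=> r; rewrite ger0_norm ?sqr_ge0//.
rewrite /delay_weight !patchE halflineE; case: ifP => [rr|]; last first.
  by rewrite addr0 mulr0 expr0n.
rewrite exprMn -expRM_natl -mulrDr [leRHS]mulrCA.
apply: ler_pM; rewrite ?expR_ge0 ?sqr_ge0//.
  by rewrite ler_expR mulrN lerN2 -mulrA ler_wpM2l// ler_wpM2r// ltW.
by have := sqr_ge0 (Ksx r - Ksu r); rewrite !expr2; nra.
Qed.

End discount_weights.

Section weighted_processes.
Context {R : realType} {disp : measure_display} {T : measurableType disp}.
Variables (P : probability T R) (d : nat) (W : T -> R -> 'cV[R]_d) (mu : R).
Notation mR := (measurableTypeR R).
Notation leb := (@lebesgue_measure R).
Notation P2 := (P \x leb)%E.
Notation P3 := (P \x @lebesgue2 R)%E.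

(** Carries the space with weight [- mu] into plain L^2 of the product measure. *)
Definition discounted (f : T -> R -> R) : T * mR -> R :=
  half_extension (fun w t => expR (- (mu * t)) * f w t).

Lemma sqr_entry_le_fnorm m n (A : 'M[R]_(m, n)) i j : A i j ^+ 2 <= fnorm A ^+ 2.
Proof.
rewrite /fnorm sqr_sqrtr; last by apply: sumr_ge0 => ? _; apply: sumr_ge0 => ? _; exact: sqr_ge0.
rewrite (bigD1 i)//= (bigD1 j)//= -addrA lerDl addr_ge0//.
  by apply: sumr_ge0 => ? _; exact: sqr_ge0.
by apply: sumr_ge0 => ? _; apply: sumr_ge0 => ? _; exact: sqr_ge0.
Qed.

Lemma entry_le_fnorm m n (A : 'M[R]_(m, n)) i j : `|A i j| <= fnorm A.
Proof.
rewrite -(@ler_pXn2r _ 2)// ?nnegrE ?sqrtr_ge0//.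
by rewrite real_normK ?num_real// sqr_entry_le_fnorm.
Qed.

Lemma fnorm_le_sum m n (A : 'M[R]_(m, n)) : fnorm A <= \sum_i \sum_j `|A i j|.
Proof.
have s0 : 0 <= \sum_i \sum_j `|A i j| by apply: sumr_ge0 => ? _; exact: sumr_ge0.
rewrite -(@ler_pXn2r _ 2)// ?nnegrE ?sqrtr_ge0//.
rewrite /fnorm sqr_sqrtr; last by apply: sumr_ge0 => ? _; apply: sumr_ge0 => ? _; exact: sqr_ge0.
have sq (I : finType) (F : I -> R) : (forall i, 0 <= F i) ->
    \sum_i F i ^+ 2 <= (\sum_i F i) ^+ 2.
  move=> F0; rewrite expr2 mulr_suml; apply: ler_sum => i _.
  by rewrite expr2 ler_wpM2l// (bigD1 i)//= lerDl sumr_ge0.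
apply: le_trans (sq _ (fun i => \sum_j `|A i j|) _); last by move=> i; exact: sumr_ge0.
apply: ler_sum => i _; apply: le_trans (sq _ (fun j => `|A i j|) _) => //.
by apply: ler_sum => j _; rewrite real_normK// num_real.
Qed.

Lemma measurable_discounted f :
  measurable_fun ([set: T] `*` halfline) (fun q : T * mR => f q.1 q.2) ->
  measurable_fun setT (discounted f).
Proof.
move=> mf; apply: measurable_half_extension; apply: measurable_funM => //.
apply: measurableT_comp => //; apply: measurableT_comp => //.
by apply: measurable_funM => //; apply: measurable_funTS.
Qed.

Let meas_component m n (f : T -> R -> 'M[R]_(m, n)) i j : meas_process f ->
  measurable_fun setT (discounted (fun w t => f w t i j)).
Proof. by move=> mf; apply: measurable_discounted; exact: mf. Qed.

Let discounted_sqr_sum m n (f : T -> R -> 'M[R]_(m, n)) w t : 0 <= t ->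
  expR (2 * - mu * t) * fnorm (f w t) ^+ 2 =
  \sum_i \sum_j discounted (fun w t => f w t i j) (w, t) ^+ 2.
Proof.
move=> t0; rewrite /fnorm sqr_sqrtr; last first.
  by apply: sumr_ge0 => ? _; apply: sumr_ge0 => ? _; exact: sqr_ge0.
rewrite mulr_sumr; apply: eq_bigr => i _; rewrite mulr_sumr; apply: eq_bigr => j _.
rewrite /discounted half_extensionE t0 exprMn -expRM_natl; congr (expR _ * _).
by ring.
Qed.

Lemma L2F_discounted m n (V : set 'M[R]_(m, n)) f i j : L2F P W (- mu) V f ->
  sq_integrable P2 (discounted (fun w t => f w t i j)).
Proof.
move=> [mf _ _ fin].
pose G (q : T * mR) := \sum_i \sum_j discounted (fun w t => f w t i j) q ^+ 2.
have mG : measurable_fun setT G.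
  apply: measurable_sum => i'; apply: measurable_sum => j'; apply: measurable_funX.
  exact: meas_component.
have G0 q : 0 <= G q by apply: sumr_ge0 => ? _; apply: sumr_ge0 => ? _; exact: sqr_ge0.
split; first exact: meas_component.
apply: le_lt_trans fin; apply: (@le_trans _ _ (\int[P2]_q (G q)%:E)%E).
  apply: ge0_le_integral => //.
  - by move=> q _; rewrite lee_fin sqr_ge0.
  - by apply/measurable_EFinP; apply: measurable_funX; exact: meas_component.
  - exact/measurable_EFinP.
  - move=> q _; rewrite lee_fin /G (bigD1 i)//= (bigD1 j)//= -addrA lerDl addr_ge0//.
      by apply: sumr_ge0 => ? _; exact: sqr_ge0.
    by apply: sumr_ge0 => ? _; apply: sumr_ge0 => ? _; exact: sqr_ge0.
rewrite -[X in (X <= _)%E](@integral_half_extension _ _ _ P (fun q => (G q)%:E)).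
- rewrite le_eqVlt; apply/orP; left; apply/eqP; apply: eq_integral => w _.
  apply: eq_integral => t; rewrite halflineE => t0.
  by rewrite discounted_sqr_sum.
- exact/measurable_EFinP.
- by move=> q; rewrite lee_fin.
- move=> w t t0; rewrite /G big1// => i' _; rewrite big1// => j' _.
  by rewrite /discounted half_extensionE leNgt t0 expr0n.
Qed.

(** The square is [e^(- 2 mu t)], a multiple of the exponential density of rate [2 mu]. *)
Lemma sq_integrable_discount : 0 < mu -> sq_integrable P2 (discounted (fun=> fun=> 1)).
Proof.
move=> mu0; apply/sq_integrableP; split.
  by apply: measurable_discounted; exact: measurable_cst.
have mu2 : 0 < 2 * mu by rewrite mulr_gt0.
have i1 : P.-integrable setT (EFin \o (fun _ : T => 1 : R)).
  exact: (sq_integrable_integrable (sq_integrable_cst P 1)).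
have i2 := integrableZR (2 * mu)^-1 (integrable_exponential_pdf mu2).
have := integrable_prod_mul i1 i2; congr (integrable _ _ (EFin \o _)).
apply/funext => -[w t]; rewrite mul1r /discounted half_extensionE /=.
rewrite mulr1; case: ifP => t0; last first.
  by rewrite lt0_exponential_pdf ?mulr0 ?expr0n// ltNge t0.
rewrite exponential_pdfE// mulrA mulVf ?mul1r ?gt_eqF// -expRM_natl.
by congr expR; ring.
Qed.

(* Coordinates are (w, (t, s)) with the integration time [t] of the equations
   first; the first time argument of [z] is the later time [s]. *)
Definition discounted2 (z : T -> R -> R -> R) (q : T * (mR * mR)) : R :=
  if (0 <= q.2.1) && (0 <= q.2.2) then expR (- (mu * q.2.2)) * z q.1 q.2.2 q.2.1 else 0.

Lemma measurable_discounted2 (z : T -> R -> R -> R) :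
  measurable_fun ([set: T] `*` (halfline `*` halfline))
    (fun q : T * (mR * mR) => z q.1 q.2.1 q.2.2) ->
  measurable_fun setT (discounted2 z).
Proof.
move=> mz.
have mhh : measurable ([set: T] `*` ((halfline : set mR) `*` (halfline : set mR))).
  by apply: measurableX => //; apply: measurableX; exact: measurable_halfline.
have mz' := (measurable_restrictT _ mhh).1 mz.
have msw : measurable_fun setT (fun q : T * (mR * mR) => (q.1, (q.2.2, q.2.1))).
  apply: measurable_fun_pair => //; apply: measurable_fun_pair.
    exact: measurableT_comp measurable_snd measurable_snd.
  exact: measurableT_comp measurable_fst measurable_snd.
have me : measurable_fun setT (fun q : T * (mR * mR) => expR (- (mu * q.2.2))).
  apply: measurableT_comp => //; apply: measurableT_comp => //.
  apply: measurable_funM => //.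
  exact: measurableT_comp measurable_snd measurable_snd.
have := measurable_funM me (measurableT_comp mz' msw); congr measurable_fun.
apply/funext => -[w [t s]]; rewrite /discounted2 /= patchE.
have -> : ((w, (s, t)) \in [set: T] `*` ((halfline : set mR) `*` (halfline : set mR))) =
    (0 <= t) && (0 <= s).
  rewrite -!halflineE; apply/idP/idP.
    by move=> /set_mem[_ [/= h1 h2]]; apply/andP; split; exact/mem_set.
  by move=> /andP[/set_mem h1 /set_mem h2]; apply/mem_set.
by case: ifP; rewrite ?mulr0.
Qed.

Lemma LL2F_discounted2 m n (z : T -> R -> R -> 'M[R]_(m, n)) i j :
  LL2F P W (- mu) z -> sq_integrable P3 (discounted2 (fun w t s => z w t s i j)).
Proof.
move=> [mz _ fin].
pose G (q : T * (mR * mR)) := \sum_i \sum_j discounted2 (fun w t s => z w t s i j) q ^+ 2.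
have mcomp i' j' : measurable_fun setT (discounted2 (fun w t s => z w t s i' j')).
  by apply: measurable_discounted2; exact: mz.
have mG : measurable_fun setT G.
  by apply: measurable_sum => i'; apply: measurable_sum => j'; exact: measurable_funX.
have G0 q : 0 <= G q by apply: sumr_ge0 => ? _; apply: sumr_ge0 => ? _; exact: sqr_ge0.
split=> //.
apply: le_lt_trans fin; apply: (@le_trans _ _ (\int[P3]_q (G q)%:E)%E).
  apply: ge0_le_integral => //.
  - by move=> q _; rewrite lee_fin sqr_ge0.
  - by apply/measurable_EFinP; exact: measurable_funX.
  - exact/measurable_EFinP.
  - move=> q _; rewrite lee_fin /G (bigD1 i)//= (bigD1 j)//= -addrA lerDl addr_ge0//.
      by apply: sumr_ge0 => ? _; exact: sqr_ge0.
    by apply: sumr_ge0 => ? _; apply: sumr_ge0 => ? _; exact: sqr_ge0.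
have mGE : measurable_fun setT (fun q => (G q)%:E) by exact/measurable_EFinP.
rewrite fubini_tonelli1//=.
rewrite le_eqVlt; apply/orP; left; apply/eqP; apply: eq_integral => w _.
rewrite /fubini_F fubini_tonelli2//=; last first.
- by move=> q; rewrite lee_fin.
- apply/measurable_EFinP; apply: (measurableT_comp mG (g := fun x => (w, x))).
  exact: measurable_pair1.
rewrite [RHS]integral_mkcond; apply: eq_integral => s _.
rewrite /fubini_G patchE halflineE; case: ifP => s0; last first.
  rewrite integral0_eq// => t _; rewrite /G big1// => i' _; rewrite big1// => j' _.
  by rewrite /discounted2/= s0 andbF expr0n.
pose N (t : mR) : R := fnorm (z w s t) ^+ 2.
have GN t : G (w, (t, s)) = expR (2 * - mu * s) * (N \_ halfline) t.
  rewrite patchE halflineE; case: ifP => t0; last first.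
    rewrite mulr0 /G big1// => i' _; rewrite big1// => j' _.
    by rewrite /discounted2/= t0 expr0n.
  rewrite /N /fnorm sqr_sqrtr; last first.
    by apply: sumr_ge0 => ? _; apply: sumr_ge0 => ? _; exact: sqr_ge0.
  rewrite /G mulr_sumr; apply: eq_bigr => i' _; rewrite mulr_sumr; apply: eq_bigr => j' _.
  rewrite /discounted2/= t0 s0/= exprMn -expRM_natl; congr (expR _ * _).
  by ring.
have mN : measurable_fun setT (N \_ halfline).
  have -> : N \_ halfline = fun t : mR => expR (2 * mu * s) * G (w, (t, s)).
    apply/funext => t; rewrite GN mulrA -expRD (_ : _ + _ = 0) ?expR0 ?mul1r//.
    by ring.
  apply: measurable_funM => //.
  apply: (measurableT_comp mG (g := fun t : mR => (w, (t, s)))).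
  by apply: measurable_fun_pair => //; exact: measurable_fun_pair.
rewrite [in RHS]integral_mkcond -ge0_integralZl//.
- by apply: eq_integral => t _; rewrite GN EFinM restrict_EFin.
- by rewrite restrict_EFin; exact/measurable_EFinP.
- by move=> t _; rewrite patchE; case: ifP => // _; rewrite lee_fin sqr_ge0.
Qed.

End weighted_processes.

(** * The coefficients at a fixed pair of times *)

Section coefficients.
Context {R : realType} {n d l : nat}.
Variables (b : R -> R -> 'cV[R]_n -> 'cV[R]_l -> 'cV[R]_n)
  (sigma : R -> R -> 'cV[R]_n -> 'cV[R]_l -> 'M[R]_(n, d)).
Notation mR := (measurableTypeR R).
Notation leb := (@lebesgue_measure R).
Notation V := ('cV[R]_n * 'cV[R]_l)%type.
Notation J := ('I_n + 'I_n * 'I_d)%type.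

(* The drift and diffusion coefficients are indexed by one finite type, the
   later time [s] being the first argument. *)
Definition coef (a : J) (s t : R) (z : V) : R :=
  match a with
  | inl i => b s t z.1 z.2 i 0
  | inr (i, k) => sigma s t z.1 z.2 i k
  end.

(** The l^1 norm, an intermediary between the Frobenius norm of the assumptions and the sup norm
    that underlies differentiability. *)
Definition size1 m (x : 'cV[R]_m) : R := \sum_i `|x i 0|.

Lemma size1_ge0 m (x : 'cV[R]_m) : 0 <= size1 x.
Proof. exact: sumr_ge0. Qed.

Lemma fnorm_le_size1 m (x : 'cV[R]_m) : fnorm x <= size1 x.
Proof.
apply: le_trans (fnorm_le_sum x) _; apply: ler_sum => i _.
by rewrite big_ord1.
Qed.

Lemma size1_le_norm m (x : 'cV[R]_m) : size1 x <= m%:R * `|x|.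
Proof.
have -> : m%:R * `|x| = \sum_(i < m) `|x| by rewrite sumr_const card_ord mulr_natl.
apply: ler_sum => i _; rewrite [leRHS]/Num.norm/= mx_normrE.
by apply: le_trans (le_bigmax _ (fun ij => `|x ij.1 ij.2|) (i, 0)).
Qed.

Variables (Kbx Kbu Ksx Ksu : R -> R).

(** State and control constants are added: [Kx |x| + Ku |u| <= (Kx + Ku) (|x| + |u|)]. *)
Definition rate (a : J) (r : R) : R :=
  match a with inl _ => Kbx r + Kbu r | inr _ => Ksx r + Ksu r end.

(** Gathers what is used of the coefficients at one pair of times, so that a single null set has to
    be avoided. The last two clauses identify the Jacobian entries of the adjoint equation with
    differentials in the joint variable. *)
Definition regular_at (s t : R) : Prop :=
  [/\ forall a (z z' : V), `|coef a s t z - coef a s t z'| <=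
        rate a (s - t) * (size1 (z.1 - z'.1) + size1 (z.2 - z'.2)),
      forall a, coef a s t 0 = 0,
      forall a z, differentiable (coef a s t : V -> R^o) z,
      forall x u i j, dmx (fun x => b s t x u) x i j =
        ('d (coef (inl i) s t : V -> R^o) (x, u) (delta_mx j 0, 0) : R) &
      forall x u i j k, dmx (fun x => col k (sigma s t x u)) x i j =
        ('d (coef (inr (i, k)) s t : V -> R^o) (x, u) (delta_mx j 0, 0) : R)].

Let derive_entry m k (f : V -> 'M[R]_(m, k)) (x : 'cV[R]_n) (u : 'cV[R]_l) i j
    (v : 'cV[R]_n) : differentiable f (x, u) ->
  differentiable (fun z => f z i j : R^o) (x, u) /\
  h^-1 * (f (h *: v + x, u) i j - f (x, u) i j) @[h --> 0^'] -->
    ('d (fun z => f z i j : R^o) (x, u) (v, 0) : R).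
Proof.
move=> fd; have fd' : differentiable (fun z => f z i j : R^o) (x, u).
  exact: (@differentiable_comp _ _ _ _ f (fun N : 'M[R]_(m, k) => N i j : R^o) _ fd
    (differentiable_coord _ _ _)).
split=> //.
have := @diff_derivable _ _ _ _ _ (v, 0) fd'; rewrite -deriveE//.
rewrite (_ : (fun h => _) = fun h => h^-1 *: (((fun z : V => f z i j : R^o) \o shift (x, u))
  (h *: (v, 0)) - f (x, u) i j))//.
apply/funext => h; congr (_ * (_ - _)) => /=.
by congr (f _ i j); congr (_, _); rewrite /= scaler0 add0r.
Qed.

(** The derivative of a vector-valued map is taken entry by entry, and moving the state alone is the
    direction [(v, 0)]. *)
Let dmx_entry m (f : V -> 'cV[R]_m) (x : 'cV[R]_n) (u : 'cV[R]_l) i j :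
  (forall i, differentiable (fun z => f z i 0 : R^o) (x, u)) ->
  (forall i v, h^-1 * (f (h *: v + x, u) i 0 - f (x, u) i 0) @[h --> 0^'] -->
    ('d (fun z => f z i 0 : R^o) (x, u) (v, 0) : R)) ->
  dmx (fun x => f (x, u)) x i j =
  ('d (fun z => f z i 0 : R^o) (x, u) (delta_mx j 0, 0) : R).
Proof.
move=> fd fc; rewrite /dmx mxE.
have fdv v : derivable (fun x => f (x, u)) x v.
  apply/derivable_mxP => i' j'; rewrite ord1 /derivable; apply/cvg_ex.
  by eexists; exact: fc.
rewrite (derive_mx (fdv _)) mxE.
exact: cvg_lim (fc i _).
Qed.

Let weights_le (kx ku a c a' c' : R) : 0 <= kx -> 0 <= ku -> 0 <= a -> 0 <= c ->
  a <= a' -> c <= c' -> kx * a + ku * c <= (kx + ku) * (a' + c').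
Proof.
move=> kx0 ku0 a0 c0 aa bb.
have h1 : kx * a <= kx * (a' + c') by rewrite ler_wpM2l// (le_trans aa)// lerDl (le_trans c0).
have h2 : ku * c <= ku * (a' + c') by rewrite ler_wpM2l// (le_trans bb)// lerDr (le_trans a0).
by rewrite mulrDl lerD.
Qed.

Lemma regular_ae : coef_regular b Kbx Kbu -> coef_regular sigma Ksx Ksu ->
  Lstar 1 Kbx -> Lstar 1 Kbu -> Lstar 2 Ksx -> Lstar 2 Ksu ->
  {ae (leb \x leb)%E, forall ts, 0 <= ts.2 <= ts.1 -> regular_at ts.1 ts.2}.
Proof.
move=> [_ hb] [_ hs] [_ bx0 _] [_ bu0 _] [_ sx0 _] [_ su0 _].
apply: aeS (aeI hb hs) => -[s t] /= [hb' hs'] ts.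
have [[bd _] bl bz] := hb' ts; have [[sd _] sl sz] := hs' ts.
have st0 : 0 <= s - t by case/andP: ts; rewrite subr_ge0.
split.
- move=> [i|[i k]] z z' /=.
    have -> : b s t z.1 z.2 i 0 - b s t z'.1 z'.2 i 0 =
      (b s t z.1 z.2 - b s t z'.1 z'.2) i 0 by rewrite !mxE.
    apply: le_trans (entry_le_fnorm _ i 0) _; apply: le_trans (bl _ _ _ _) _.
    by apply: weights_le; rewrite ?sqrtr_ge0 ?bx0 ?bu0 ?fnorm_le_size1.
  have -> : sigma s t z.1 z.2 i k - sigma s t z'.1 z'.2 i k =
    (sigma s t z.1 z.2 - sigma s t z'.1 z'.2) i k by rewrite !mxE.
  apply: le_trans (entry_le_fnorm _ i k) _; apply: le_trans (sl _ _ _ _) _.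
  by apply: weights_le; rewrite ?sqrtr_ge0 ?sx0 ?su0 ?fnorm_le_size1.
- by move=> [i|[i k]] /=; rewrite ?bz ?sz mxE.
- by move=> [i|[i k]] [x u] /=; [case: (derive_entry i 0 0 (bd (x, u)))|
    case: (derive_entry i k 0 (sd (x, u)))].
- move=> x u i j; apply: (dmx_entry (f := fun z => b s t z.1 z.2)).
    by move=> i'; case: (derive_entry i' 0 0 (bd (x, u))).
  by move=> i' v; case: (derive_entry i' 0 v (bd (x, u))).
- move=> x u i j k.
  have e i' : (fun z : V => col k (sigma s t z.1 z.2) i' 0 : R^o) =
      fun z => sigma s t z.1 z.2 i' k by apply/funext => z; rewrite mxE.
  rewrite (dmx_entry (f := fun z => col k (sigma s t z.1 z.2))).
  - by rewrite e.
  - by move=> i'; rewrite e; case: (derive_entry i' k 0 (sd (x, u))).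
  - move=> i' v; rewrite e; rewrite !mxE.
    under eq_fun do rewrite mxE.
    by case: (derive_entry i' k v (sd (x, u))).
Qed.

End coefficients.

(** * Adapted fields on pairs of times and their pairing with the adjoint processes *)

Section fields.
Context {R : realType} {disp : measure_display} {T : measurableType disp}.
Variables (P : probability T R) (d : nat) (W : T -> R -> 'cV[R]_d).
Hypotheses (cP : measure_is_complete P) (bm : brownian_motion P W).
Notation mR := (measurableTypeR R).
Notation leb := (@lebesgue_measure R).
Notation F := (aug_filtration P W).
Notation field := (T * (mR * mR) -> R).
Implicit Types (f g : field).

Let Fs t : sigma_algebra setT (F t). Proof. exact: aug_filtration_sigma. Qed.

Let adapted_field2 (op : R -> R -> R) f g :
  (forall d' (S : measurableType d') (u v : S -> R), measurable_fun setT u ->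
    measurable_fun setT v -> measurable_fun setT (fun x => op (u x) (v x))) ->
  adapted_field P W f -> adapted_field P W g ->
  adapted_field P W (fun q => op (f q) (g q)).
Proof.
move=> mop [mf af] [mg ag]; split; first exact: mop.
move=> t s t0; apply/(meas_wrtP (Fs t)); apply: mop; apply/(meas_wrtP (Fs t)).
  exact: af.
exact: ag.
Qed.

Lemma adapted_fieldM f g : adapted_field P W f -> adapted_field P W g ->
  adapted_field P W (fun q => f q * g q).
Proof. by apply: (@adapted_field2 *%R) => *; exact: measurable_funM. Qed.

Lemma adapted_fieldB f g : adapted_field P W f -> adapted_field P W g ->
  adapted_field P W (fun q => f q - g q).
Proof. by apply: (@adapted_field2 (fun x y => x - y)) => *; exact: measurable_funB. Qed.

Definition clip (B f : field) : field := fun q => Num.max (- B q) (Num.min (f q) (B q)).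

Lemma adapted_clip B f : adapted_field P W B -> adapted_field P W f ->
  adapted_field P W (clip B f).
Proof.
apply: (@adapted_field2 (fun x y => Num.max (- x) (Num.min y x))) => d' S u v mu mv.
apply: measurable_maxr; first exact: measurable_funN.
exact: measurable_minr.
Qed.

Lemma clip_le B f q : 0 <= B q -> `|clip B f q| <= B q.
Proof.
move=> B0; rewrite /clip ler_norml le_max lexx /= ge_max ge_min lexx orbT andbT.
by rewrite (le_trans _ B0)// oppr_le0.
Qed.

Lemma clip_id B f q : `|f q| <= B q -> clip B f q = f q.
Proof. by rewrite ler_norml => /andP[h1 h2]; rewrite /clip min_l// max_r. Qed.

Lemma adapted_limsup (f_ : nat -> field) : (forall m, adapted_field P W (f_ m)) ->
  adapted_field P W (real_limsup f_).
Proof.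
move=> af; split; first by apply: measurable_real_limsup => m; case: (af m).
move=> t s t0; apply/(meas_wrtP (Fs t)).
apply: (@measurable_real_limsup _ (g_sigma_algebraType (F t)) R
  (fun m w => f_ m (w, (t, s)))) => m.
by apply/(meas_wrtP (Fs t)); case: (af m) => _; exact.
Qed.

Lemma adapted_time (k : mR -> R) : measurable_fun setT k ->
  adapted_field P W (fun q => k q.2.2).
Proof.
move=> mk; split.
  apply: measurableT_comp mk _; exact: measurableT_comp measurable_snd measurable_snd.
by move=> t s t0; apply/(meas_wrtP (Fs t)); exact: (measurable_cst (k s)).
Qed.

Definition causal_set : set (T * (mR * mR)) := [set q | 0 <= q.2.1 <= q.2.2].

Definition causal_part (f : field) : field :=
  fun q => if 0 <= q.2.1 <= q.2.2 then f q else 0.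

Lemma measurable_causal_set : measurable causal_set.
Proof.
apply: measurable_ordered_set.
  exact: measurableT_comp measurable_fst measurable_snd.
exact: measurableT_comp measurable_snd measurable_snd.
Qed.

Lemma causal_part_causal f : causal (causal_part f).
Proof. by move=> w t s /negbTE ts; rewrite /causal_part/= ts. Qed.

Lemma adapted_causal_part f : measurable_fun causal_set f ->
  (forall t s, 0 <= t <= s -> meas_wrt (F t) (fun w => f (w, (t, s)))) ->
  adapted_field P W (causal_part f).
Proof.
move=> mf af; split.
  rewrite (_ : causal_part f = f \_ causal_set).
    exact: (measurable_restrictT _ measurable_causal_set).1 mf.
  apply/funext => q; rewrite /causal_part patchE.
  suff -> : (q \in causal_set) = (0 <= q.2.1 <= q.2.2) by [].
  by apply/idP/idP; rewrite in_setE.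
move=> t s t0; have [ts|ts] := boolP (0 <= t <= s).
  rewrite (_ : (fun w => _) = fun w => f (w, (t, s))); first exact: af.
  by apply/funext => w; rewrite /causal_part/= ts.
rewrite (_ : (fun w => _) = fun=> 0); last first.
  by apply/funext => w; rewrite /causal_part/= (negbTE ts).
by apply/(meas_wrtP (Fs t)); exact: (measurable_cst (0 : R)).
Qed.

Section scaled.
Variables (n l : nat) (mu : R).
Variables (b : R -> R -> 'cV[R]_n -> 'cV[R]_l -> 'cV[R]_n)
  (sigma : R -> R -> 'cV[R]_n -> 'cV[R]_l -> 'M[R]_(n, d)).
Hypotheses (mb : meas_coef b) (ms : meas_coef sigma).
Notation J := ('I_n + 'I_n * 'I_d)%type.

(** A coefficient along a state and a control taken at the earlier time, discounted at the later
    one. *)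
Definition scaled (a : J) (X : T -> R -> 'cV[R]_n) (v : T -> R -> 'cV[R]_l) : field :=
  causal_part (fun q => expR (- (mu * q.2.2)) *
    coef b sigma a q.2.2 q.2.1 (X q.1 q.2.1, v q.1 q.2.1)).

Let measurable_coef_field d' (S : measurableType d') (D : set S) a
    (x : S -> 'cV[R]_n) (v : S -> 'cV[R]_l) (tau sig : S -> mR) : measurable D ->
  (forall i, measurable_fun D (fun q => x q i 0 : mR)) ->
  (forall i, measurable_fun D (fun q => v q i 0 : mR)) ->
  measurable_fun D tau -> measurable_fun D sig ->
  (forall q, D q -> 0 <= sig q <= tau q) ->
  measurable_fun D (fun q => coef b sigma a (tau q) (sig q) (x q, v q)).
Proof.
move=> mD mx mv mt msg h; case: a => [i|[i k]] /=.
  exact: (@measurable_coef _ _ _ _ _ _ mD _ _ mx mv _ _ b tau sig i 0 mb).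
exact: (@measurable_coef _ _ _ _ _ _ mD _ _ mx mv _ _ sigma tau sig i k ms).
Qed.

Lemma measurable_coef_section a t x u :
  0 <= t -> measurable_fun (`[t, +oo[ : set mR) (fun s : mR => coef b sigma a s t (x, u)).
Proof.
move=> t0; apply: measurable_coef_field => //; try exact: measurable_cst.
by move=> s /=; rewrite in_itv/= andbT t0.
Qed.

Lemma adapted_scaled a X v : meas_process X -> adapted P W X ->
  meas_process v -> adapted P W v -> adapted_field P W (scaled a X v).
Proof.
move=> mX aX mv av; have mD := measurable_causal_set.
have m21 : measurable_fun causal_set (fun q : T * (mR * mR) => q.2.1 : mR).
  by apply: measurable_funTS; exact: measurableT_comp measurable_fst measurable_snd.
have m22 : measurable_fun causal_set (fun q : T * (mR * mR) => q.2.2 : mR).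
  by apply: measurable_funTS; exact: measurableT_comp measurable_snd measurable_snd.
have mproc m (Y : T -> R -> 'cV[R]_m) i : meas_process Y ->
    measurable_fun causal_set (fun q : T * (mR * mR) => Y q.1 q.2.1 i 0 : mR).
  move=> mY; have mTh : measurable ([set: T] `*` (halfline : set mR)).
    by apply: measurableX => //; exact: measurable_halfline.
  apply: (measurable_comp (g := fun q : T * (mR * mR) => (q.1, q.2.1)) mTh _ (mY i 0)).
    move=> _ [q /andP[q0 _] <-]; split => //=.
    by apply/set_mem; rewrite halflineE.
  by apply: measurable_funTS; apply: measurable_fun_pair => //;
    exact: measurableT_comp measurable_fst measurable_snd.
apply: adapted_causal_part.
  apply: measurable_funM.
    apply: measurableT_comp => //; apply: measurableT_comp => //.
    by apply: measurable_funM => //; exact: measurable_cst.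
  by apply: measurable_coef_field => // i; exact: mproc.
move=> t s ts; have t0 : 0 <= t by case/andP: ts.
apply/(meas_wrtP (Fs t)); apply: measurable_funM; first exact: (measurable_cst (expR (- (mu * s)))).
apply: (@measurable_coef_field _ (g_sigma_algebraType (F t)) setT) => //.
- by move=> i; apply/(meas_wrtP (Fs t)); exact: aX.
- by move=> i; apply/(meas_wrtP (Fs t)); exact: av.
Qed.

End scaled.

Section duality.
Variables (n : nat) (mu : R).
Variables (Y : T -> R -> 'cV[R]_n) (Z : T -> R -> R -> 'M[R]_(n, d))
  (EY : T -> R -> R -> 'cV[R]_n).
Notation J := ('I_n + 'I_n * 'I_d)%type.
Notation P2 := (P \x leb)%E.
Notation P3 := (P \x @lebesgue2 R)%E.
Local Notation intble m f := (m.-integrable setT (EFin \o f)).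
Hypothesis LY : L2F P W (- mu) setT Y.
Hypothesis LZ : LL2F P W (- mu) Z.
Hypothesis cEY : condexp_field P W Y EY.

(** The partner of each coefficient in the adjoint equation, discounted at the later time: Y(s) for
    the drift, Z(s, t) for the diffusion. *)
Definition adjoint_dual (a : J) : field :=
  match a with
  | inl i => fun q => discounted mu (fun w s => Y w s i 0) (q.1, q.2.2)
  | inr (i, k) => discounted2 mu (fun w t s => Z w t s i k)
  end.

Let ey i : field := fun q =>
  if (0 <= q.2.1) && (0 <= q.2.2) then EY q.1 q.2.1 q.2.2 i 0 else 0.

(** The partner in the Hamiltonian: it differs from [adjoint_dual] only for the drift, where
    E_t[Y(s)] replaces Y(s). *)
Definition predicted_dual (a : J) : field :=
  match a with
  | inl i => fun q => expR (- (mu * q.2.2)) * ey i q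
  | inr (i, k) => discounted2 mu (fun w t s => Z w t s i k)
  end.

Variables (k1 k2 : mR -> R) (a0 : T * mR -> R).
Hypotheses (ik1 : intble leb k1) (sk2 : sq_integrable leb k2).
Hypotheses (k10 : forall r, 0 <= k1 r) (k20 : forall r, 0 <= k2 r).
Hypotheses (sa0 : sq_integrable P2 a0) (a00 : forall q, 0 <= a0 q).
Hypothesis aa0 : forall t, 0 <= t -> meas_wrt (F t) (fun w => a0 (w, t)).

Definition kernel_of (a : J) : mR -> R := if a is inl _ then k1 else k2.

(** The majorant of all weights: delay kernel times the size of the processes at the earlier
    time. *)
Definition envelope (a : J) : field :=
  causal_part (fun q => kernel_of a (q.2.2 - q.2.1) * a0 (q.1, q.2.1)).

Lemma envelope_ge0 a q : 0 <= envelope a q.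
Proof.
rewrite /envelope /causal_part; case: ifP => // _.
by rewrite mulr_ge0//; case: a => *; rewrite /kernel_of.
Qed.

Let measurable_kernel_of a : measurable_fun setT (kernel_of a).
Proof. by case: a => *; [exact: integrable_measurable ik1|case: sk2]. Qed.

Lemma adapted_envelope a : adapted_field P W (envelope a).
Proof.
have [ma0 _] := sa0; apply: adapted_causal_part.
  apply: measurable_funTS; apply: measurable_funM; first exact: measurable_delay.
  exact: measurable_proj_fst.
move=> t s /andP[t0 _]; apply/(meas_wrtP (Fs t)); apply: measurable_funM.
  exact: (measurable_cst (kernel_of a (s - t))).
by apply/(meas_wrtP (Fs t)); exact: aa0.
Qed.

(** The bound gives integrability of the pairings, adaptedness the exchange of the two duals. *)
Definition admissible (a : J) (xi : field) : Prop :=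
  adapted_field P W xi /\ forall q, `|xi q| <= envelope a q.

Lemma admissible_envelope a : admissible a (envelope a).
Proof.
split; first exact: adapted_envelope.
by move=> q; rewrite ger0_norm// envelope_ge0.
Qed.

Lemma admissible_causal a xi : admissible a xi -> causal xi.
Proof.
move=> [_ xiB] w t s ts; apply/eqP; rewrite -normr_le0.
by rewrite (le_trans (xiB _))// /envelope causal_part_causal.
Qed.

Lemma envelope_le a q : envelope a q <= kernel_of a (q.2.2 - q.2.1) * a0 (q.1, q.2.1).
Proof.
rewrite /envelope /causal_part; case: ifP => // _.
by rewrite mulr_ge0//; case: a => *; rewrite /kernel_of.
Qed.

Lemma admissible_young i xi (c : T * mR -> R) : admissible (inl i) xi ->
  sq_integrable P2 c -> intble P3 (fun q => xi q * c (q.1, q.2.2)).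
Proof.
move=> [[mxi _] xiB] sc; have [mc _] := sc.
have iy := integrable_normR (integrable_young1 ik1 k10 sa0 sc).
apply: le_integrableR iy _.
  by apply: measurable_funM => //; exact: measurable_proj_snd.
move=> q; rewrite mulrA !normrM ler_wpM2r// (le_trans (xiB q))//.
apply: le_trans (envelope_le (inl i) q) _; rewrite /kernel_of -normrM.
exact: ler_norm.
Qed.

Lemma sq_integrable_admissible ik xi : admissible (inr ik) xi -> sq_integrable P3 xi.
Proof.
move=> [[mxi _] xiB].
apply: le_sq_integrable (sq_integrable_delay sk2 sa0) _ => // q.
apply: le_trans (xiB q) _; apply: le_trans (envelope_le (inr ik) q) _.
exact: ler_norm.
Qed.

Let measurable_ey i : measurable_fun setT (ey i).
Proof.
have [mEY _] := cEY.
have mhh : measurable ([set: T] `*` ((halfline : set mR) `*` (halfline : set mR))).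
  by apply: measurableX => //; apply: measurableX; exact: measurable_halfline.
have := (measurable_restrictT _ mhh).1 (mEY i 0); congr measurable_fun.
apply/funext => -[w [t s]]; rewrite /ey patchE /=.
suff -> : ((w, (t, s)) \in [set: T] `*` ((halfline : set mR) `*` (halfline : set mR))) =
    (0 <= t) && (0 <= s) by [].
rewrite -!halflineE; apply/idP/idP.
  by move=> /set_mem[_ [/= h1 h2]]; apply/andP; split; exact/mem_set.
by move=> /andP[/set_mem h1 /set_mem h2]; apply/mem_set.
Qed.

Lemma measurable_adjoint_dual a : measurable_fun setT (adjoint_dual a).
Proof.
case: a => [i|[i k]] /=.
  have [mY _ _ _] := LY; apply: measurable_proj_snd.
  by apply: measurable_discounted; exact: mY.
by have [mZ _ _] := LZ; apply: measurable_discounted2; exact: mZ.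
Qed.

Lemma measurable_predicted_dual a : measurable_fun setT (predicted_dual a).
Proof.
case: a => [i|[i k]] /=; last exact: (measurable_adjoint_dual (inr (i, k))).
apply: measurable_funM; last exact: measurable_ey.
apply: measurableT_comp => //; apply: measurableT_comp => //.
apply: measurable_funM => //.
exact: measurableT_comp measurable_snd measurable_snd.
Qed.

(** Diffusion components have the same partner on both sides and need only L^2 bounds. For the
    drift, the delay inequality gives integrability with Y(s), and the conditional exchange then
    carries it to E_t[Y(s)]. *)
Lemma dual_exchange a xi : admissible a xi ->
  [/\ intble P3 (fun q => xi q * adjoint_dual a q),
      intble P3 (fun q => xi q * predicted_dual a q) &
      \int[P3]_q (xi q * predicted_dual a q) = \int[P3]_q (xi q * adjoint_dual a q)].
Proof.
case: a => [i|[i k]] axi; last first.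
  have sxi := sq_integrable_admissible axi.
  have sZ : sq_integrable P3 (discounted2 mu (fun w t s => Z w t s i k)).
    exact: LL2F_discounted2 LZ.
  by split => //; exact: sq_integrable_mul.
have [axi1 xiB] := axi; have cxi := admissible_causal axi.
have sY : sq_integrable P2 (discounted mu (fun w s => Y w s i 0)) by exact: L2F_discounted LY.
have iy := admissible_young axi sY.
pose y : T * mR -> R := half_extension (fun w s => Y w s i 0).
(* The conditional expectation concerns the undiscounted [Y], so its discount is moved into the
   weight. *)
pose xi' : field := fun q => expR (- (mu * q.2.2)) * xi q.
have axi' : adapted_field P W xi'.
  apply: adapted_fieldM axi1; apply: (@adapted_time (fun s => expR (- (mu * s)))).
  by apply: measurableT_comp => //; apply: measurableT_comp => //.
have cxi' : causal xi' by move=> w t s ts; rewrite /xi' cxi ?mulr0.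
have ye : (fun q => xi q * adjoint_dual (inl i) q) = fun q => xi' q * y (q.1, q.2.2).
  apply/funext => -[w [t s]]; rewrite /xi' /y /= /discounted !half_extensionE.
  by case: ifP => _; [ring|rewrite !mulr0].
have ee : (fun q => xi q * predicted_dual (inl i) q) = fun q => xi' q * ey i q.
  by apply/funext => q; rewrite /xi' /=; ring.
have eyP : {ae leb, forall t, 0 <= t -> {ae leb, forall s, t <= s ->
    is_condexp P (F t) (fun w => y (w, s)) (fun w => ey i (w, (t, s)))}}.
  have [_ hE] := cEY; apply: aeS hE => t hE t0; apply: aeS (hE t0) => s hs ts.
  have s0 : 0 <= s by exact: le_trans ts.
  have := hs ts i; congr is_condexp; apply/funext => w.
    by rewrite /y half_extensionE s0.
  by rewrite /ey /= t0 s0.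
have iy' : intble P3 (fun q => xi' q * y (q.1, q.2.2)) by rewrite -ye.
rewrite ee ye; split.
- exact: iy'.
- exact: (integrable_condexp_field cP bm (measurable_ey i) eyP axi' cxi' iy').
- exact: (Rintegral_condexp_field cP bm (measurable_ey i) eyP axi' cxi' iy').
Qed.

End duality.

End fields.

Section ito_pairing.
Context {R : realType} {disp : measure_display} {T : measurableType disp}.
Variables (P : probability T R) (d : nat) (W : T -> R -> 'cV[R]_d).
Hypotheses (cP : measure_is_complete P) (bm : brownian_motion P W).
Notation leb := (@lebesgue_measure R).
Notation P2 := (P \x leb)%E.

(** The mean of [y] pairs to 0 with an Ito integral, and of the coordinates only [k] survives the
    isometry. *)
Lemma ito_pairing (y : T -> R) (m : R) (g : 'I_d -> T -> R -> R) (Iy : 'I_d -> T -> R)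
    k (g' : T -> R -> R) I :
  (forall j, is_ito_coord P W j (g j) (Iy j)) ->
  {ae P, forall w, y w = m + \sum_j Iy j w} ->
  is_ito_coord P W k g' I ->
  \int[P]_w (y w * I w) =
  \int[P2]_q (half_extension (g k) q * half_extension g' q).
Proof.
move=> hg yE hI; have [sI _] := ito_sq_integrable cP bm hI.
have iI := sq_integrable_integrable sI.
have sg j : sq_integrable P (Iy j) by have [] := ito_sq_integrable cP bm (hg j).
transitivity (\int[P]_w (m * I w + \sum_j Iy j w * I w)).
  apply: ae_eq_Rintegral_any; apply: aeS yE => w ->.
  by rewrite mulrDl mulr_suml.
have ig j := sq_integrable_mul (sg j) sI.
rewrite RintegralD//; [|exact: integrableZR|exact: integrable_sumR].
rewrite RintegralZl// (ito_mean cP bm hI) mulr0 add0r Rintegral_sum//.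
rewrite (bigD1 k)//= big1 ?addr0 => [|j jk]; rewrite (ito_isometry cP bm (hg _) hI).
  by rewrite eqxx mul1r.
by rewrite (negbTE jk) mul0r.
Qed.

End ito_pairing.

(** * Comparison of the costs *)

Section gaps.
Context {R : realType} {disp : measure_display} {T : measurableType disp}.
Variables (P : probability T R) (n d l : nat) (W : T -> R -> 'cV[R]_d).
Hypotheses (cP : measure_is_complete P) (bm : brownian_motion P W).
Variables (mu lambda : R).
Variables (b : R -> R -> 'cV[R]_n -> 'cV[R]_l -> 'cV[R]_n)
  (sigma : R -> R -> 'cV[R]_n -> 'cV[R]_l -> 'M[R]_(n, d)).
Variables (Kbx Kbu Ksx Ksu : R -> R).
Hypotheses (mb : meas_coef b) (ms : meas_coef sigma).
Hypotheses (Lbx : Lstar 1 Kbx) (Lbu : Lstar 1 Kbu) (Lsx : Lstar 2 Ksx) (Lsu : Lstar 2 Ksu).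
Hypothesis hmu : (rho_bsigma Kbx Kbu Ksx Ksu < mu%:E)%E.
Hypothesis hlambda : 2 * mu <= lambda.
Variables (X Xh : T -> R -> 'cV[R]_n) (v uh : T -> R -> 'cV[R]_l).
Variables (U : set 'cV[R]_l).
Hypotheses (LX : L2F P W (- mu) setT X) (LXh : L2F P W (- mu) setT Xh).
Hypotheses (Lv : L2F P W (- mu) U v) (Luh : L2F P W (- mu) U uh).
Notation mR := (measurableTypeR R).
Notation leb := (@lebesgue_measure R).
Notation F := (aug_filtration P W).
Notation P2 := (P \x leb)%E.
Notation P3 := (P \x @lebesgue2 R)%E.
Notation J := ('I_n + 'I_n * 'I_d)%type.
Notation V := ('cV[R]_n * 'cV[R]_l)%type.
Notation field := (T * (mR * mR) -> R).
Notation regular := (regular_at b sigma Kbx Kbu Ksx Ksu).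
Notation rate := (@rate R n d Kbx Kbu Ksx Ksu).

Let Fs t : sigma_algebra setT (F t). Proof. exact: aug_filtration_sigma. Qed.

(** The summand 1 lets [gap_bound] dominate the Lipschitz constant itself, as is required at
    arbitrary arguments of the Hamiltonian. *)
Definition total_size (w : T) (t : R) : R :=
  1 + (size1 (X w t) + size1 (Xh w t) + (size1 (v w t) + size1 (uh w t))).

Definition base : T * mR -> R := discounted mu total_size.

Let total_size_ge0 w t : 0 <= total_size w t.
Proof. by rewrite /total_size !addr_ge0// size1_ge0. Qed.

Lemma base_ge0 q : 0 <= base q.
Proof.
case: q => w t; rewrite /base /discounted half_extensionE; case: ifP => // _.
by rewrite mulr_ge0 ?expR_ge0.
Qed.

Let baseE : base = fun q => discounted mu (fun=> fun=> 1) q +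
  (\sum_i `|discounted mu (fun w t => X w t i 0) q| +
   \sum_i `|discounted mu (fun w t => Xh w t i 0) q| +
   (\sum_i `|discounted mu (fun w t => v w t i 0) q| +
    \sum_i `|discounted mu (fun w t => uh w t i 0) q|)).
Proof.
apply/funext => -[w t]; rewrite /base /discounted !half_extensionE.
have s m (x : T -> R -> 'cV[R]_m) :
    \sum_i `|half_extension (fun w t => expR (- (mu * t)) * x w t i 0) (w, t)| =
    if 0 <= t then expR (- (mu * t)) * size1 (x w t) else 0.
  case: ifP => t0; last by rewrite big1// => i _; rewrite half_extensionE t0 normr0.
  rewrite /size1 mulr_sumr; apply: eq_bigr => i _.
  by rewrite half_extensionE t0 normrM ger0_norm ?expR_ge0.
rewrite !s /total_size; case: ifP => _; last by rewrite !addr0.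
by rewrite !mulrDr.
Qed.

Let sq_integrable_norm d' (S : measurableType d') (m : {measure set S -> \bar R}) (f : S -> R) :
  sq_integrable m f -> sq_integrable m (fun x => `|f x|).
Proof.
move=> sf; have [mf _] := sf; apply: le_sq_integrable sf _.
  exact: measurableT_comp.
by move=> x; rewrite normr_id.
Qed.

Lemma sq_integrable_base : sq_integrable P2 base.
Proof.
rewrite baseE; apply: sq_integrableD; first exact: sq_integrable_discount (mu_gt0 hmu).
have h m (x : T -> R -> 'cV[R]_m) S : L2F P W (- mu) S x ->
    sq_integrable P2 (fun q => \sum_i `|discounted mu (fun w t => x w t i 0) q|).
  move=> Lx; apply: sq_integrable_sum => i; apply: sq_integrable_norm.
  exact: L2F_discounted Lx.
by apply: sq_integrableD; apply: sq_integrableD;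
  [exact: h LX|exact: h LXh|exact: h Lv|exact: h Luh].
Qed.

Lemma adapted_base t : 0 <= t -> meas_wrt (F t) (fun w => base (w, t)).
Proof.
move=> t0; have h m (x : T -> R -> 'cV[R]_m) : adapted P W x ->
    measurable_fun setT (fun w : g_sigma_algebraType (F t) => size1 (x w t)).
  move=> ax; apply: measurable_sum => i; apply: measurableT_comp => //.
  by apply/(meas_wrtP (Fs t)); exact: ax.
apply/(meas_wrtP (Fs t)).
rewrite (_ : (fun w => _) = fun w => expR (- (mu * t)) * total_size w t); last first.
  by apply/funext => w; rewrite /base /discounted half_extensionE t0.
apply: measurable_funM; first exact: (measurable_cst (expR (- (mu * t)))).
apply: measurable_funD; first exact: (measurable_cst (1 : R)).
have [[_ aX _ _] [_ aXh _ _]] := (LX, LXh).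
have [[_ av _ _] [_ auh _ _]] := (Lv, Luh).
by apply: measurable_funD; apply: measurable_funD; exact: h.
Qed.

Let k1 := delay_weight mu Kbx Kbu.
Let k2 := delay_weight mu Ksx Ksu.

Let k10 r : 0 <= k1 r. Proof. exact: delay_weight_ge0 Lbx Lbu. Qed.
Let k20 r : 0 <= k2 r. Proof. exact: delay_weight_ge0 Lsx Lsu. Qed.
Let ik1 : leb.-integrable setT (EFin \o k1).
Proof. exact: integrable_drift_weight hmu. Qed.
Let sk2 : sq_integrable leb k2.
Proof. exact: sq_integrable_diffusion_weight hmu. Qed.

Definition gap_bound (a : J) : field := envelope k1 k2 base a.

Definition gap_admissible (a : J) (xi : field) : Prop :=
  admissible P W k1 k2 base a xi.

Lemma gap_bound_ge0 a q : 0 <= gap_bound a q.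
Proof. exact: envelope_ge0 k10 k20 base_ge0 a q. Qed.

Lemma adapted_gap_bound a : adapted_field P W (gap_bound a).
Proof. exact: adapted_envelope ik1 sk2 sq_integrable_base adapted_base a. Qed.

Lemma gap_bound_causal a : causal (gap_bound a).
Proof. exact: causal_part_causal. Qed.

Lemma rate_ge0 a r : 0 <= r -> 0 <= rate a r.
Proof.
have [[_ bx0 _] [_ bu0 _]] := (Lbx, Lbu); have [[_ sx0 _] [_ su0 _]] := (Lsx, Lsu).
by move=> r0; case: a => [i|[i k]] /=; rewrite addr_ge0 ?bx0 ?bu0 ?sx0 ?su0.
Qed.

Lemma gap_boundE a w t s : 0 <= t <= s ->
  gap_bound a (w, (t, s)) = expR (- (mu * s)) * (rate a (s - t) * total_size w t).
Proof.
move=> /[dup] ts /andP[t0 ts']; rewrite /gap_bound /envelope /causal_part/= ts.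
have st0 : 0 <= s - t by rewrite subr_ge0.
have -> : kernel_of k1 k2 a (s - t) = expR (- (mu * (s - t))) * rate a (s - t).
  by case: a => [i|[i k]] /=; rewrite /k1 /k2 delay_weightE.
rewrite /base /discounted half_extensionE t0.
have -> : - (mu * s) = - (mu * (s - t)) + - (mu * t) by ring.
by rewrite expRD; ring.
Qed.

Let gap_bound_ge a w t s (c m : R) : 0 <= t <= s -> c <= rate a (s - t) * m ->
  m <= total_size w t -> expR (- (mu * s)) * c <= gap_bound a (w, (t, s)).
Proof.
move=> ts cm mt; rewrite gap_boundE// ler_wpM2l ?expR_ge0// (le_trans cm)//.
by rewrite ler_wpM2l// rate_ge0// subr_ge0; case/andP: ts.
Qed.

(** What remains of [e^(- lambda s)] after one factor [e^(- mu s)] has gone to the coefficient and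
    another to its dual; at most 1 on the half-line because [lambda >= 2 mu]. *)
Definition discount_factor (s : R) : R := expR (- ((lambda - 2 * mu) * s)).

Let discount_factor_le1 s : 0 <= s -> discount_factor s <= 1.
Proof.
move=> s0; rewrite /discount_factor -[leRHS]expR0 ler_expR oppr_le0.
by rewrite mulr_ge0// subr_ge0.
Qed.

Let adapted_discount_factor : adapted_field P W (fun q => discount_factor q.2.2).
Proof.
apply: (@adapted_time _ _ _ P d W discount_factor).
by apply: measurableT_comp => //; apply: measurableT_comp => //.
Qed.

(* Clipping makes the bound by [gap_bound] hold everywhere; it is inactive at the
   almost all times at which the coefficients are regular. *)
Definition clipped_gap (a : J) (f : field) : field :=
  fun q => discount_factor q.2.2 * clip (gap_bound a) f q.

Lemma clipped_gap_admissible a f : adapted_field P W f ->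
  gap_admissible a (clipped_gap a f).
Proof.
move=> af; split.
  apply: adapted_fieldM; first exact: adapted_discount_factor.
  by apply: adapted_clip => //; exact: adapted_gap_bound.
move=> q; have b0 := gap_bound_ge0 a q; have cB := clip_le f b0.
rewrite /clipped_gap normrM ger0_norm ?expR_ge0//.
have [ts|ts] := boolP (0 <= q.2.1 <= q.2.2).
  rewrite (le_trans _ cB)// ler_piMl// discount_factor_le1//.
  by case/andP: ts; exact: le_trans.
have B0 : gap_bound a q = 0 by case: q ts {b0 cB} => w [t s] ts; exact: gap_bound_causal.
rewrite -/(gap_bound a q) B0 in cB *.
by move: cB; rewrite normr_le0 => /eqP ->; rewrite normr0 mulr0.
Qed.

Definition state_gap (a : J) : field := clipped_gap a
  (fun q => scaled mu b sigma a X v q - scaled mu b sigma a Xh uh q).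

Let perturbed (m : nat) (w : T) (t : R) : 'cV[R]_n :=
  Xh w t + m.+1%:R^-1 *: (X w t - Xh w t).

(** The derivative of the coefficient along X - Xhat with the control frozen. Difference quotients
    of [scaled] at steps [1/(m+1)] are adapted, and so is their upper limit. *)
Definition derivative_gap (a : J) : field := clipped_gap a
  (real_limsup (fun m q => m.+1%:R *
    (scaled mu b sigma a (perturbed m) uh q - scaled mu b sigma a Xh uh q))).

Lemma state_gap_admissible a : gap_admissible a (state_gap a).
Proof.
have [[mX aX _ _] [mXh aXh _ _]] := (LX, LXh).
have [[mv av _ _] [muh auh _ _]] := (Lv, Luh).
by apply: clipped_gap_admissible; apply: adapted_fieldB; exact: adapted_scaled.
Qed.

Lemma derivative_gap_admissible a : gap_admissible a (derivative_gap a).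
Proof.
have [[mX aX _ _] [mXh aXh _ _]] := (LX, LXh).
have [muh auh _ _] := Luh.
apply: clipped_gap_admissible; apply: adapted_limsup => m; apply: adapted_fieldM.
  by apply: (@adapted_time _ _ _ P d W (fun=> m.+1%:R)); exact: measurable_cst.
apply: adapted_fieldB; apply: adapted_scaled => //.
  move=> i j; rewrite (_ : (fun q => _) = fun q : T * mR => Xh q.1 q.2 i j +
      m.+1%:R^-1 * (X q.1 q.2 i j - Xh q.1 q.2 i j)).
    apply: measurable_funD; first exact: mXh.
    by apply: measurable_funM => //; apply: measurable_funB; [exact: mX|exact: mXh].
  by apply/funext => q; rewrite !mxE.
move=> t t0 i j; rewrite (_ : (fun w => _) = fun w => Xh w t i j +
    m.+1%:R^-1 * (X w t i j - Xh w t i j)); last by apply/funext => w; rewrite !mxE.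
have mXh' : measurable_fun setT (fun w : g_sigma_algebraType (F t) => Xh w t i j).
  by apply/(meas_wrtP (Fs t)); exact: aXh.
have mX' : measurable_fun setT (fun w : g_sigma_algebraType (F t) => X w t i j).
  by apply/(meas_wrtP (Fs t)); exact: aX.
apply/(meas_wrtP (Fs t)); apply: measurable_funD => //.
by apply: measurable_funM => //; exact: measurable_funB.
Qed.

Let size1D m (x y : 'cV[R]_m) : size1 (x - y) <= size1 x + size1 y.
Proof.
rewrite /size1 -big_split/=; apply: ler_sum => i _; rewrite !mxE.
exact: ler_normB.
Qed.

Let size1Z m (c : R) (x : 'cV[R]_m) : size1 (c *: x) = `|c| * size1 x.
Proof.
by rewrite /size1 mulr_sumr; apply: eq_bigr => i _; rewrite mxE normrM.
Qed.

Let size10 m : size1 (0 : 'cV[R]_m) = 0.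
Proof. by rewrite /size1 big1// => i _; rewrite mxE normr0. Qed.

Let scaledE a (x : T -> R -> 'cV[R]_n) (u : T -> R -> 'cV[R]_l) w t s : 0 <= t <= s ->
  scaled mu b sigma a x u (w, (t, s)) =
  expR (- (mu * s)) * coef b sigma a s t (x w t, u w t).
Proof. by move=> ts; rewrite /scaled /causal_part/= ts. Qed.

Lemma scaled_le a w t s : 0 <= t <= s -> regular s t ->
  `|scaled mu b sigma a X v (w, (t, s))| <= gap_bound a (w, (t, s)) /\
  `|scaled mu b sigma a Xh uh (w, (t, s))| <= gap_bound a (w, (t, s)).
Proof.
move=> ts [lip z0 _ _ _]; have sz := (size1_ge0 (X w t), size1_ge0 (Xh w t),
  (size1_ge0 (v w t), size1_ge0 (uh w t))).
have h (x : T -> R -> 'cV[R]_n) (u : T -> R -> 'cV[R]_l) :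
    size1 (x w t) + size1 (u w t) <= total_size w t ->
    `|scaled mu b sigma a x u (w, (t, s))| <= gap_bound a (w, (t, s)).
  move=> xt; rewrite scaledE// normrM (ger0_norm (expR_ge0 _)).
  apply: gap_bound_ge xt => //.
  have := lip a (x w t, u w t) 0; rewrite z0 subr0.
  by rewrite /= !subr0.
by split; apply: h; rewrite /total_size; move: sz => [[? ?] [? ?]]; lra.
Qed.

Lemma state_gapE a w t s : 0 <= t <= s -> regular s t ->
  state_gap a (w, (t, s)) = discount_factor s * (expR (- (mu * s)) *
    (coef b sigma a s t (X w t, v w t) - coef b sigma a s t (Xh w t, uh w t))).
Proof.
move=> ts [lip z0 _ _ _]; rewrite /state_gap /clipped_gap clip_id !scaledE// -mulrBr//.
rewrite normrM (ger0_norm (expR_ge0 _)).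
apply: gap_bound_ge (lip a _ _) _ => //=.
have := (size1D (X w t) (Xh w t), size1D (v w t) (uh w t)).
by rewrite /total_size => -[? ?]; lra.
Qed.

Lemma derivative_gapE a w t s : 0 <= t <= s -> regular s t ->
  derivative_gap a (w, (t, s)) = discount_factor s * (expR (- (mu * s)) *
    ('d (coef b sigma a s t : V -> R^o) (Xh w t, uh w t) (X w t - Xh w t, 0) : R)).
Proof.
move=> ts [lip z0 dif _ _]; rewrite /derivative_gap /clipped_gap.
set f_ := (f in real_limsup f).
have fE m : f_ m (w, (t, s)) = expR (- (mu * s)) * (m.+1%:R *
    (coef b sigma a s t (m.+1%:R^-1 *: (X w t - Xh w t, 0 : 'cV[R]_l) + (Xh w t, uh w t)) -
     coef b sigma a s t (Xh w t, uh w t))).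
  rewrite /f_ !scaledE// -mulrBr mulrCA; congr (_ * (_ * (_ - _))).
  rewrite [X in _ = coef _ _ _ _ _ X](_ : _ = (perturbed m w t, uh w t))//.
  by congr (_, _); rewrite /perturbed /= ?scaler0 ?add0r// addrC.
have lE : real_limsup f_ (w, (t, s)) = expR (- (mu * s)) *
    ('d (coef b sigma a s t : V -> R^o) (Xh w t, uh w t) (X w t - Xh w t, 0) : R).
  apply: real_limsupE; under eq_fun do rewrite fE.
  apply: cvgMl_tmp.
  have c0 : e^-1 * (coef b sigma a s t (e *: (X w t - Xh w t, 0 : 'cV[R]_l) + (Xh w t, uh w t)) -
      coef b sigma a s t (Xh w t, uh w t)) @[e --> 0^'] -->
      ('d (coef b sigma a s t : V -> R^o) (Xh w t, uh w t) (X w t - Xh w t, 0) : R).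
    have := @diff_derivable _ _ _ _ _ (X w t - Xh w t, 0) (dif a (Xh w t, uh w t)).
    by rewrite -deriveE.
  have c1 := (cvgr_dnbhsP _ _ _).1 c0 (fun m => m.+1%:R^-1).
  have : (fun m : nat => (m.+1%:R^-1)^-1 * (coef b sigma a s t
       (m.+1%:R^-1 *: (X w t - Xh w t, 0 : 'cV[R]_l) + (Xh w t, uh w t)) -
      coef b sigma a s t (Xh w t, uh w t))) @ \oo -->
      ('d (coef b sigma a s t : V -> R^o) (Xh w t, uh w t) (X w t - Xh w t, 0) : R).
    apply: c1; split; last exact: cvg_harmonic.
    by move=> m; rewrite invr_eq0 pnatr_eq0.
  by under eq_fun do rewrite invrK.
(* The Lipschitz bound holds for every quotient, hence for the upper limit, so clipping is
   inactive. *)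
rewrite clip_id lE//; rewrite -lE; apply: real_limsup_norm_le => m.
rewrite fE normrM (ger0_norm (expR_ge0 _)) normrM ger0_norm//.
apply: (@gap_bound_ge _ _ _ _ _ (size1 (X w t - Xh w t))) => //; last first.
  have := (size1D (X w t) (Xh w t), size1_ge0 (v w t), size1_ge0 (uh w t)).
  by rewrite /total_size => -[[? ?] ?]; lra.
apply: (@le_trans _ _ (m.+1%:R * (rate a (s - t) * (m.+1%:R^-1 * size1 (X w t - Xh w t))))).
  rewrite ler_wpM2l//; apply: le_trans (lip _ _ _) _ => /=.
  by rewrite !addrK scaler0 size10 addr0 size1Z ger0_norm// invr_ge0.
by rewrite mulrCA mulVKf// pnatr_eq0.
Qed.

Variables (phi : T -> R -> 'cV[R]_n) (Y : T -> R -> 'cV[R]_n)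
  (Z : T -> R -> R -> 'M[R]_(n, d)) (EY : T -> R -> R -> 'cV[R]_n).
Hypothesis reg : {ae (leb \x leb)%E, forall ts, 0 <= ts.2 <= ts.1 -> regular ts.1 ts.2}.
Hypotheses (MYZ : M2F P W (- mu) Y Z) (cEY : condexp_field P W Y EY).
Hypotheses (SX : is_state P W phi b sigma mu v X) (SXh : is_state P W phi b sigma mu uh Xh).
Local Notation intble m f := (m.-integrable setT (EFin \o f)).

Let LY : L2F P W (- mu) setT Y. Proof. by case: MYZ. Qed.
Let LZ : LL2F P W (- mu) Z. Proof. by case: MYZ. Qed.

Notation pY := (adjoint_dual mu Y Z).
Notation pE := (predicted_dual mu Z EY).

Lemma gap_exchange a xi : gap_admissible a xi ->
  [/\ intble P3 (fun q => xi q * pY a q), intble P3 (fun q => xi q * pE a q) &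
      \int[P3]_q (xi q * pE a q) = \int[P3]_q (xi q * pY a q)].
Proof.
exact: (dual_exchange cP bm LY LZ cEY ik1 sk2 k10 k20 sq_integrable_base base_ge0).
Qed.

(** By Fubini almost every time section is square integrable; at a fixed time the discount is a
    constant factor. *)
Lemma L2F_section m k (f : T -> R -> 'M[R]_(m, k)) S i j : L2F P W (- mu) S f ->
  {ae leb, forall s, 0 <= s -> sq_integrable P (fun w => f w s i j)}.
Proof.
move=> Lf; have /sq_integrableP[md id] := L2F_discounted i j Lf.
apply: aeS (@ae_integrable_snd _ _ _ _ _ P leb _ id) => s is2 s0.
have -> : (fun w => f w s i j) =
    fun w => expR (mu * s) * discounted mu (fun w t => f w t i j) (w, s).
  apply/funext => w; rewrite /discounted half_extensionE s0 mulrA -expRD.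
  by rewrite subrr expR0 mul1r.
apply: sq_integrableZ; apply/sq_integrableP; split; last exact: is2.
exact: measurableT_comp md (measurable_pair2 s).
Qed.

Let mem_itv0 (s t : R) : (t \in (`[0, s]%classic : set R)) = (0 <= t <= s).
Proof. by apply/idP/idP; rewrite in_setE /= in_itv. Qed.

Let measurable_time_section (w : T) (s : mR) :
  measurable_fun setT (fun t : mR => (w, (t, s))).
Proof.
apply: measurable_fun_pair; first exact: measurable_cst.
by apply: measurable_fun_pair; [exact: measurable_id|exact: measurable_cst].
Qed.

Let mem_itvt (t s : R) : (s \in (`[t, +oo[%classic : set R)) = (t <= s).
Proof. by apply/idP/idP; rewrite in_setE /= in_itv/= andbT. Qed.

(** The factor [discounted mu 1] at time [s] equals [e^(- mu s)]: it is the square-integrable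
    partner with which the envelope has been paired, and is divided out here. *)
Let integrable_scaled i (x : T -> R -> 'cV[R]_n) (u : T -> R -> 'cV[R]_l) w s :
  0 <= s -> adapted_field P W (scaled mu b sigma (inl i) x u) ->
  {ae leb, forall t, 0 <= t <= s ->
    `|scaled mu b sigma (inl i) x u (w, (t, s))| <= gap_bound (inl i) (w, (t, s))} ->
  intble leb (fun t => gap_bound (inl i) (w, (t, s)) * discounted mu (fun=> fun=> 1) (w, s)) ->
  intble leb (fun t => scaled mu b sigma (inl i) x u (w, (t, s))) /\
  vint `[0, s] (fun t => b s t (x w t) (u w t)) i 0 =
  expR (mu * s) * \int[leb]_t scaled mu b sigma (inl i) x u (w, (t, s)).
Proof.
move=> s0 [mxu _] sB iB.
have ix : intble leb (fun t => scaled mu b sigma (inl i) x u (w, (t, s))).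
  apply: ae_le_integrable (integrableZR (expR (mu * s)) iB) _.
    exact: measurableT_comp mxu (measurable_time_section w s).
  apply: aeS sB => t tB.
  have -> : expR (mu * s) * (gap_bound (inl i) (w, (t, s)) *
      discounted mu (fun=> fun=> 1) (w, s)) = gap_bound (inl i) (w, (t, s)).
    rewrite /discounted half_extensionE s0 mulr1 mulrCA -expRD subrr.
    by rewrite expR0 mulr1.
  have [ts|ts] := boolP (0 <= t <= s); first exact: tB.
  by rewrite /scaled causal_part_causal// normr0 gap_bound_ge0.
split=> //; rewrite -RintegralZl// /vint mxE Rintegral_mkcond.
apply: eq_Rintegral => t _; rewrite patchE mem_itv0 /scaled /causal_part/=.
case: ifP => _; last by rewrite mulr0.
by rewrite mulrA -expRD subrr expR0 mul1r.
Qed.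

Let drift_gap s i : 0 <= s -> {ae leb, forall t, 0 <= t <= s -> regular s t} ->
  intble P2 (fun q => gap_bound (inl i) (q.1, (q.2, s)) *
    discounted mu (fun=> fun=> 1) (q.1, s)) ->
  {ae P, forall w, intble leb (fun t => state_gap (inl i) (w, (t, s))) /\
    expR (- (mu * s)) * discount_factor s *
    (vint `[0, s] (fun t => b s t (X w t) (v w t)) i 0 -
     vint `[0, s] (fun t => b s t (Xh w t) (uh w t)) i 0) =
    \int[leb]_t state_gap (inl i) (w, (t, s))}.
Proof.
move=> s0 rs iB.
have [[mX aX _ _] [mXh aXh _ _]] := (LX, LXh).
have [[mv av _ _] [muh auh _ _]] := (Lv, Luh).
apply: aeS (@ae_integrable_fst _ _ _ _ _ P leb _ iB) => w iw.
have [iX ->] := @integrable_scaled i X v w s s0 (adapted_scaled mu mb ms (inl i) mX aX mv av)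
  (aeS (fun t r ts => (scaled_le (inl i) w ts (r ts)).1) rs) iw.
have [iXh ->] := @integrable_scaled i Xh uh w s s0
  (adapted_scaled mu mb ms (inl i) mXh aXh muh auh)
  (aeS (fun t r ts => (scaled_le (inl i) w ts (r ts)).2) rs) iw.
have gE : {ae leb, forall t, state_gap (inl i) (w, (t, s)) = discount_factor s *
    (scaled mu b sigma (inl i) X v (w, (t, s)) - scaled mu b sigma (inl i) Xh uh (w, (t, s)))}.
  apply: aeS rs => t r; have [ts|ts] := boolP (0 <= t <= s).
    rewrite state_gapE//; last exact: r.
    by rewrite /scaled /causal_part/= ts -mulrBr.
  rewrite (admissible_causal (state_gap_admissible (inl i)))//.
  by rewrite /scaled !causal_part_causal// subrr mulr0.
have iD := integrableZR (discount_factor s) (integrableBR iX iXh).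
split.
  apply: ae_le_integrable (integrable_normR iD) _; last by apply: aeS gE => t ->.
  have [[mg _] _] := state_gap_admissible (inl i).
  exact: measurableT_comp mg (measurable_time_section w s).
rewrite -mulrBr -RintegralB// mulrAC mulrA -expRD (_ : _ + _ = 0) ?expR0 ?mul1r; last by ring.
rewrite mulrC -RintegralZl//; last exact: integrableBR.
by apply: ae_eq_Rintegral_any; apply: aeS gE => t ->.
Qed.

Let ae_dual : {ae leb, forall s, forall a,
  intble P2 (fun q => state_gap a (q.1, (q.2, s)) * pY a (q.1, (q.2, s)))}.
Proof.
apply: ae_finite => a; have [iy _ _] := gap_exchange (state_gap_admissible a).
exact: ae_integrable_time2 iy.
Qed.

Let ae_drift : {ae leb, forall s, forall i,
  intble P2 (fun q => gap_bound (inl i) (q.1, (q.2, s)) *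
    discounted mu (fun=> fun=> 1) (q.1, s))}.
Proof.
apply: ae_finite => i.
have sd := sq_integrable_discount P (mu_gt0 hmu).
have iy := admissible_young ik1 k10 k20 sq_integrable_base base_ge0
  (admissible_envelope ik1 sk2 k10 k20 sq_integrable_base base_ge0 adapted_base (inl i)) sd.
exact: ae_integrable_time2 iy.
Qed.

(** In the difference of the state equations [phi] cancels. The drift part is paired with Y(s) by
    Fubini, the stochastic part with the representation of Y(s) by [ito_pairing]. *)
Lemma state_duality : {ae leb, forall s, 0 <= s ->
  expR (- (lambda * s)) * \int[P]_w dotv (Y w s) (X w s - Xh w s) =
  \int[P2]_q \sum_a state_gap a (q.1, (q.2, s)) * pY a (q.1, (q.2, s))}.
Proof.
have [_ hX] := SX; have [_ hXh] := SXh; have [_ _ hY] := MYZ.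
have sX := ae_finite (fun i => L2F_section i 0 LX).
have sXh := ae_finite (fun i => L2F_section i 0 LXh).
have sY := ae_finite (fun i => L2F_section i 0 LY).
have regs := ae_prod1 reg.
apply: aeS (aeI (aeI hX (aeI hXh hY))
  (aeI (aeI sX (aeI sXh sY)) (aeI (aeI ae_dual ae_drift) regs))).
move=> s [[sol1 [sol2 rep]] [[qX [qXh qY]] [[idual ib] rs]]] s0.
have [I1 [J1 hJ1 I1E] XE] := sol1 s0.
have [I2 [J2 hJ2 I2E] XhE] := sol2 s0.
have [IY [JY hJY IYE] YE] := rep s0.
pose y i w := Y w s i 0; pose D i w := X w s i 0 - Xh w s i 0.
have sy i : sq_integrable P (y i) by exact: qY.
have sD i : sq_integrable P (D i) by apply: sq_integrableB; [exact: qX|exact: qXh].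
have sJ1 i k : sq_integrable P (J1 i k) by have [] := ito_sq_integrable cP bm (hJ1 i k).
have sJ2 i k : sq_integrable P (J2 i k) by have [] := ito_sq_integrable cP bm (hJ2 i k).
have sJ i : sq_integrable P (fun w => \sum_k (J1 i k w - J2 i k w)).
  by apply: sq_integrable_sum => k; exact: sq_integrableB.
(* The drift part is defined as a remainder, which makes it square integrable at once; [D'E]
   identifies it with the integral of the drift increments. *)
pose D' i w := D i w - \sum_k (J1 i k w - J2 i k w).
have sD' i : sq_integrable P (D' i) by exact: sq_integrableB.
have D'E i : {ae P, forall w, intble leb (fun t => state_gap (inl i) (w, (t, s))) /\
    expR (- (mu * s)) * discount_factor s * D' i w =
    \int[leb]_t state_gap (inl i) (w, (t, s))}.
  have dg := drift_gap s0 rs (ib i).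
  apply: aeS (aeI dg (aeI XE XhE)) => w [[iw <-] [e1 e2]]; split=> //; congr (_ * _).
  rewrite /D' /D e1 e2 I1E I2E !mxE sumrB; ring.
have drift i : expR (- (lambda * s)) * \int[P]_w (y i w * D' i w) =
    \int[P2]_q (state_gap (inl i) (q.1, (q.2, s)) * pY (inl i) (q.1, (q.2, s))).
  have iyD := sq_integrable_mul (sy i) (sD' i).
  rewrite -RintegralZl// -(@Rintegral_prod_fst _ _ _ _ _ P leb _ (idual (inl i))).
  apply: ae_eq_Rintegral_any; apply: aeS (D'E i) => w [iw e].
  transitivity (expR (- (mu * s)) * y i w * \int[leb]_t state_gap (inl i) (w, (t, s))).
    rewrite -e /discount_factor.
    have -> : - (lambda * s) = - (mu * s) + - (mu * s) + - ((lambda - 2 * mu) * s) by ring.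
    by rewrite !expRD; ring.
  rewrite -RintegralZl//; apply: eq_Rintegral => t _.
  by rewrite /= /discounted half_extensionE s0 mulrC.
have ito i k : expR (- (lambda * s)) * \int[P]_w (y i w * (J1 i k w - J2 i k w)) =
    \int[P2]_q (state_gap (inr (i, k)) (q.1, (q.2, s)) * pY (inr (i, k)) (q.1, (q.2, s))).
  have Yi : {ae P, forall w, y i w = \int[P]_w' Y w' s i 0 + \sum_j JY i j w}.
    by apply: aeS YE => w; rewrite /y => ->; rewrite !mxE IYE mxE.
  have [_ s1] := ito_sq_integrable cP bm (hJ1 i k).
  have [_ s2] := ito_sq_integrable cP bm (hJ2 i k).
  have [_ sz] := ito_sq_integrable cP bm (hJY i k).
  under eq_Rintegral do rewrite mulrBr.
  rewrite RintegralB//; [|exact: sq_integrable_mul..].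
  rewrite (ito_pairing cP bm (hJY i) Yi (hJ1 i k)) (ito_pairing cP bm (hJY i) Yi (hJ2 i k)).
  rewrite -RintegralB//; [|exact: sq_integrable_mul..].
  rewrite -RintegralZl//; last by apply: integrableBR; exact: sq_integrable_mul.
  apply: ae_eq_Rintegral_any.
  apply: aeS (@ae_prod_snd _ _ _ _ _ P leb _ rs) => -[w t] /= r.
  rewrite !half_extensionE /discounted2/= s0 !indicE !mem_itv0.
  have [ts|ts] := boolP (0 <= t <= s); last first.
    rewrite (admissible_causal (state_gap_admissible (inr (i, k))))//.
    by rewrite !mulr0; case: ifP; rewrite ?mul0r ?subrr ?mulr0.
  have t0 : 0 <= t by case/andP: ts.
  rewrite state_gapE//; last exact: r.
  rewrite t0 /= !mulr1 /discount_factor.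
  have -> : - (lambda * s) = - (mu * s) + - (mu * s) + - ((lambda - 2 * mu) * s) by ring.
  by rewrite !expRD; ring.
rewrite (_ : \int[P]_w _ = \sum_i (\int[P]_w (y i w * D' i w) +
   \sum_k \int[P]_w (y i w * (J1 i k w - J2 i k w)))); last first.
  have iJ i k := sq_integrable_mul (sy i) (sq_integrableB (sJ1 i k) (sJ2 i k)).
  have e i : \int[P]_w (y i w * D i w) = \int[P]_w (y i w * D' i w) +
      \sum_k \int[P]_w (y i w * (J1 i k w - J2 i k w)).
    rewrite -Rintegral_sum// -RintegralD//; last exact: integrable_sumR.
      by apply: eq_Rintegral => w _; rewrite -mulr_sumr -mulrDr /D' subrK.
    exact: sq_integrable_mul.
  under [RHS]eq_bigr do rewrite -e.
  rewrite -Rintegral_sum; last by move=> i; exact: sq_integrable_mul.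
  by apply: eq_Rintegral => w _; apply: eq_bigr => i _; rewrite /D !mxE.
rewrite Rintegral_sum// big_sumType/= mulr_sumr.
under [LHS]eq_bigr do rewrite mulrDr drift mulr_sumr.
rewrite big_split/=; congr (_ + _).
rewrite [RHS](_ : _ = \sum_i \sum_k \int[P2]_q
  (state_gap (inr (i, k)) (q.1, (q.2, s)) * pY (inr (i, k)) (q.1, (q.2, s)))).
  by apply: eq_bigr => i _; apply: eq_bigr => k _; exact: ito.
by rewrite pair_bigA; apply: eq_bigr => -[i k] _.
Qed.

(** The remainder of the Hamiltonian inequality. It carries the discount [e^(- lambda s)] where the
    Hamiltonian has [e^(- lambda (s - t))]. *)
Definition adjoint_gap : field := fun q => \sum_a
  (derivative_gap a q * (pE a q - pY a q) - state_gap a q * pE a q).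

(** * The Hamiltonian inequality at a fixed time and sample point *)

Section pointwise.
Variable h : R -> 'cV[R]_n -> 'cV[R]_l -> R.
Variables (w : T) (t : R) (eta : 'cV[R]_n).
Hypothesis t0 : 0 <= t.
Hypothesis rt : {ae leb, forall s, 0 <= t <= s -> regular s t}.
Hypothesis hd : differentiable (fun z : V => h t z.1 z.2 : R^o) (Xh w t, uh w t).
Hypothesis iY : forall a,
  intble leb (fun s => gap_bound a (w, (t, s)) * pY a (w, (t, s))).
Hypothesis iE : forall a,
  intble leb (fun s => gap_bound a (w, (t, s)) * pE a (w, (t, s))).
Hypothesis etaE : eta = grad (fun x => h t x (uh w t)) (Xh w t) +
  vint `[t, +oo[ (fun s => expR (- (lambda * (s - t))) *:
    ((dmx (fun x => b s t x (uh w t)) (Xh w t))^T *m Y w s +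
     \sum_k (dmx (fun x => col k (sigma s t x (uh w t))) (Xh w t))^T *m col k (Z w s t))).

(** Data for [weighted_sum] at this time and sample point. The factors [expR (mu * s)] undo the
    discounts, and [n + l] comes from bounding the l^1 norm by the sup norm. *)
Let e (s : mR) : R := expR (- (lambda * (s - t))).
Let beta (a : J) (s : mR) (z : V) : R := if t <= s then coef b sigma a s t z else 0.
Let L (a : J) (s : mR) : R := (n + l)%:R * (expR (mu * s) * gap_bound a (w, (t, s))).
Let p (a : J) (s : mR) : R := expR (mu * s) * pE a (w, (t, s)).
Let p' (a : J) (s : mR) : R := expR (mu * s) * pY a (w, (t, s)).

Let beta0 : {ae leb, forall s, forall a, beta a s 0 = 0}.
Proof.
apply: aeS rt => s r a; rewrite /beta; case: ifP => // ts.
by have [] := r (introT andP (conj t0 ts)).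
Qed.

(** Since [total_size >= 1], the undiscounted [gap_bound] is at least the rate. *)
Let beta_lip : {ae leb, forall s, forall a y y',
  `|beta a s y - beta a s y'| <= L a s * `|y - y'|}.
Proof.
apply: aeS rt => s r a y y'; rewrite /beta /L; case: ifPn => ts; last first.
  by rewrite subrr normr0 mulr_ge0// mulr_ge0// mulr_ge0 ?expR_ge0 ?gap_bound_ge0.
have ts' : 0 <= t <= s by rewrite t0.
have [lip _ _ _ _] := r ts'.
apply: le_trans (lip a y y') _; rewrite gap_boundE// mulrA -mulrA.
rewrite [X in _ <= X](_ : _ =
  rate a (s - t) * ((n + l)%:R * `|y - y'| * total_size w t)); last first.
  transitivity ((expR (mu * s) * expR (- (mu * s))) * rate a (s - t) *
     ((n + l)%:R * `|y - y'| * total_size w t)); first by ring.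
  by rewrite -expRD subrr expR0 mul1r.
have r0 : 0 <= rate a (s - t) by rewrite rate_ge0// subr_ge0.
rewrite ler_wpM2l//.
have ts1 : 1 <= total_size w t.
  by rewrite /total_size lerDl !addr_ge0// size1_ge0.
apply: (@le_trans _ _ ((n + l)%:R * `|y - y'|)); last by rewrite ler_peMr// mulr_ge0.
rewrite natrD mulrDl; apply: lerD; apply: le_trans (size1_le_norm _) _;
  rewrite ler_wpM2l// prod_normE le_max lexx ?orbT//.
Qed.

Let beta_diff : {ae leb, forall s, forall a,
  differentiable (beta a s : V -> R^o) (Xh w t, uh w t)}.
Proof.
apply: aeS rt => s r a; have [ts|ts] := boolP (t <= s).
  rewrite (_ : beta a s = coef b sigma a s t); last by apply/funext => z; rewrite /beta ts.
  by have [_ _ rd _ _] := r (introT andP (conj t0 ts)); exact: rd.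
rewrite (_ : (beta a s : V -> R^o) = cst 0); first exact: differentiable_cst.
by apply/funext => z; rewrite /beta (negbTE ts).
Qed.

Let measurable_beta a z : measurable_fun setT (fun s => beta a s z).
Proof.
have mI : measurable (`[t, +oo[%classic : set mR) by exact: measurable_itv.
case: z => x u.
rewrite (_ : (fun s => _) = (fun s : mR => coef b sigma a s t (x, u)) \_ `[t, +oo[%classic).
  exact: (measurable_restrictT _ mI).1 (measurable_coef_section mb ms a x u t0).
apply/funext => s; rewrite patchE /beta.
suff -> : (s \in (`[t, +oo[%classic : set mR)) = (t <= s) by [].
by apply/idP/idP; rewrite in_setE /= in_itv/= andbT.
Qed.

Let measurable_section (f : field) : measurable_fun setT f ->
  measurable_fun setT (fun s : mR => f (w, (t, s))).
Proof.
move=> mf; apply: measurableT_comp mf _.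
apply: measurable_fun_pair; first exact: measurable_cst.
by apply: measurable_fun_pair; [exact: measurable_cst|exact: measurable_id].
Qed.

Let measurable_exp (c c' : R) : measurable_fun setT (fun s : mR => expR (c * (s - c'))).
Proof.
apply: measurableT_comp => //; apply: measurable_funM => //.
exact: measurable_funB.
Qed.

Let me : measurable_fun setT e.
Proof.
rewrite (_ : e = fun s => expR (- lambda * (s - t))); first exact: measurable_exp.
by apply/funext => s; rewrite /e mulNr.
Qed.

Let mexp : measurable_fun setT (fun s : mR => expR (mu * s)).
Proof.
rewrite (_ : (fun s => _) = fun s : mR => expR (mu * (s - 0))); first exact: measurable_exp.
by apply/funext => s; rewrite subr0.
Qed.

Let mp a z : measurable_fun setT (fun s => e s * beta a s z * p a s).
Proof.
apply: measurable_funM; first exact: measurable_funM.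
apply: measurable_funM => //; apply: measurable_section.
exact: measurable_predicted_dual LZ cEY a.
Qed.

Let mp' a z : measurable_fun setT (fun s => e s * beta a s z * p' a s).
Proof.
apply: measurable_funM; first exact: measurable_funM.
apply: measurable_funM => //; apply: measurable_section.
exact: measurable_adjoint_dual LY LZ a.
Qed.

(** [e^(- lambda (s - t)) e^(2 mu s)] is [e^(lambda t)] times the discount factor, hence at most
    [e^(lambda t)]. *)
Let ipE a (pf : field) : measurable_fun setT pf ->
  intble leb (fun s => gap_bound a (w, (t, s)) * pf (w, (t, s))) ->
  intble leb (fun s => e s * L a s * `|expR (mu * s) * pf (w, (t, s))|).
Proof.
move=> mpf ip.
apply: le_integrableR (integrable_normR (integrableZR ((n + l)%:R * expR (lambda * t)) ip)) _.
  apply: measurable_funM; first apply: measurable_funM => //.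
    apply: measurable_funM => //; apply: measurable_funM => //.
    by apply: measurable_section; case: (adapted_gap_bound a).
  apply: measurableT_comp => //; apply: measurable_funM => //.
  exact: measurable_section.
move=> s; have B0 := gap_bound_ge0 a (w, (t, s)).
have [ts|ts] := boolP (0 <= t <= s); last first.
  by rewrite /L gap_bound_causal// !mulr0 mul0r normr0 !mul0r mulr0 normr0.
have s0 : 0 <= s by case/andP: ts; exact: le_trans.
rewrite /L !(normrM, normr_id) !(ger0_norm (expR_ge0 _)) !(ger0_norm B0).
rewrite (ger0_norm (ler0n R (n + l))).
have -> : e s * ((n + l)%:R * (expR (mu * s) * gap_bound a (w, (t, s)))) *
    (expR (mu * s) * `|pf (w, (t, s))|) =
    discount_factor s * ((n + l)%:R * expR (lambda * t) *
      (gap_bound a (w, (t, s)) * `|pf (w, (t, s))|)).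
  have -> : e s = discount_factor s * (expR (lambda * t) * (expR (- (mu * s)) * expR (- (mu * s)))).
    by rewrite /e /discount_factor -!expRD; congr expR; ring.
  have E : expR (- (mu * s)) * expR (mu * s) = 1 by rewrite -expRD addNr expR0.
  transitivity (discount_factor s * ((n + l)%:R * expR (lambda * t) *
      (gap_bound a (w, (t, s)) * `|pf (w, (t, s))|)) *
     ((expR (- (mu * s)) * expR (mu * s)) * (expR (- (mu * s)) * expR (mu * s)))); first by ring.
  by rewrite E !mulr1.
by rewrite ler_piMl ?discount_factor_le1// !mulr_ge0 ?expR_ge0.
Qed.

Let pYl i s : 0 <= s -> p' (inl i) s = Y w s i 0.
Proof.
by move=> s0; rewrite /p' /= /discounted half_extensionE s0 mulrA -expRD subrr expR0 mul1r.
Qed.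

Let pYr i k s : 0 <= s -> p' (inr (i, k)) s = Z w s t i k.
Proof. by move=> s0; rewrite /p' /= /discounted2/= t0 s0/= mulrA -expRD subrr expR0 mul1r. Qed.

Let pEl i s : 0 <= s -> p (inl i) s = EY w t s i 0.
Proof. by move=> s0; rewrite /p /= t0 s0/= mulrA -expRD subrr expR0 mul1r. Qed.

Let pEr i k s : 0 <= s -> p (inr (i, k)) s = Z w s t i k.
Proof. exact: pYr. Qed.

Let sum_index (f : J -> R) : \sum_a f a = \sum_i f (inl i) + \sum_k \sum_i f (inr (i, k)).
Proof.
rewrite big_sumType/= exchange_big/= pair_bigA; congr (_ + _).
by apply: eq_bigr => -[i k].
Qed.

Let F (x : 'cV[R]_n) (u : 'cV[R]_l) : R :=
  hamiltonian b sigma h lambda t x u (EY w t) (fun s => Z w s t).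

Let FE x u : F x u = h t x u + \int[leb]_s weighted_sum e beta p s (x, u).
Proof.
rewrite /F /hamiltonian; congr (_ + _); rewrite Rintegral_mkcond.
apply: eq_Rintegral => s _; rewrite patchE mem_itvt /weighted_sum /beta.
case: ifP => ts; last by rewrite big1 ?mulr0// => a _; rewrite mul0r.
have s0 : 0 <= s by exact: le_trans ts.
rewrite sum_index; congr (_ * (_ + _)).
  by apply: eq_bigr => i _; rewrite pEl.
by apply: eq_bigr => k _; apply: eq_bigr => i _; rewrite !mxE pEr.
Qed.

Let grad_h j : grad (fun x => h t x (uh w t)) (Xh w t) j 0 =
  ('d (fun z : V => h t z.1 z.2 : R^o) (Xh w t, uh w t) (delta_mx j 0, 0) : R).
Proof.
rewrite /grad mxE; have := @diff_derivable _ _ _ _ _ (delta_mx j 0, 0) hd.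
rewrite -deriveE// => c; apply: cvg_lim => //; move: c.
rewrite (_ : (fun r => r^-1 *: _) = fun r => r^-1 *:
  (((fun z : V => h t z.1 z.2 : R^o) \o shift (Xh w t, uh w t))
  (r *: (delta_mx j 0, 0)) - h t (Xh w t) (uh w t)))//.
apply/funext => r; congr (_ * (_ - _)) => /=.
by congr (h t _ _); rewrite /= scaler0 add0r.
Qed.

(** The transposed Jacobians of the adjoint equation, read in coordinate [j], are the differentials
    of the coefficients in that direction, paired with [p']. *)
Let eta_diff j : eta j 0 =
  ('d (fun z : V => h t z.1 z.2 : R^o) (Xh w t, uh w t) (delta_mx j 0, 0) : R) +
  \int[leb]_s ('d (weighted_sum e beta p' s : V -> R^o) (Xh w t, uh w t) (delta_mx j 0, 0) : R).
Proof.
rewrite etaE mxE grad_h; congr (_ + _); rewrite mxE Rintegral_mkcond.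
apply: ae_eq_Rintegral_any.
have dw := diff_weighted_sum e beta_diff p'.
apply: aeS (aeI rt dw) => s [r dws].
pose D a : R := 'd (beta a s : V -> R^o) (Xh w t, uh w t) (delta_mx j 0, 0).
have {dws} -> : ('d (weighted_sum e beta p' s : V -> R^o) (Xh w t, uh w t) (delta_mx j 0, 0) : R) =
    e s * \sum_a D a * p' a s by exact: dws.
rewrite patchE mem_itvt; case: ifPn => ts; last first.
  rewrite big1 ?mulr0// => a _.
  rewrite /D (_ : beta a s = cst 0); last by apply/funext => z; rewrite /beta (negbTE ts).
  by rewrite diff_cst mul0r.
have s0 : 0 <= s by exact: le_trans ts.
have [_ _ _ db ds] := r (introT andP (conj t0 ts)).
have bE a : beta a s = coef b sigma a s t by apply/funext => z; rewrite /beta ts.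
have Db i : D (inl i) = dmx (fun x => b s t x (uh w t)) (Xh w t) i j.
  by rewrite /D bE; exact/esym/db.
have Ds i k : D (inr (i, k)) = dmx (fun x => col k (sigma s t x (uh w t))) (Xh w t) i j.
  by rewrite /D bE; exact/esym/ds.
clearbody D; rewrite mxE sum_index; congr (_ * _); rewrite mxE summxE; congr (_ + _).
  by rewrite mxE; apply: eq_bigr => i _; rewrite mxE -Db pYl.
by apply: eq_bigr => k _; rewrite mxE; apply: eq_bigr => i _; rewrite mxE -Ds mxE pYr.
Qed.

(** [hamiltonian_gap] rewritten in terms of the gap fields, which agree with the true increments and
    derivatives for almost every [s]. In the application [eta] is Y(t) + I_t. *)
Lemma pointwise_gap :
  convex_function ([set: 'cV[R]_n] `*` U : set (convex_lmodType V)) (fun z => F z.1 z.2) ->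
  U (v w t) -> U (uh w t) ->
  0 <= dotv (grad (F (Xh w t)) (uh w t)) (v w t - uh w t) ->
  intble leb (fun s => adjoint_gap (w, (t, s))) ->
  dotv eta (X w t - Xh w t) + expR (lambda * t) * \int[leb]_s adjoint_gap (w, (t, s)) <=
  h t (X w t) (v w t) - h t (Xh w t) (uh w t).
Proof.
move=> cF Uv Uuh g0 iPhi.
have e0 s : 0 <= e s by exact: expR_ge0.
have ip a : intble leb (fun s => e s * L a s * `|p a s|).
  by apply: ipE => //; exact: measurable_predicted_dual LZ cEY a.
have ip' a : intble leb (fun s => e s * L a s * `|p' a s|).
  by apply: ipE => //; exact: measurable_adjoint_dual LY LZ a.
have := hamiltonian_gap e0 beta0 beta_lip beta_diff mp ip mp' ip' (X w t) hd FE eta_diff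
  erefl cF Uv Uuh g0.
apply: le_trans; rewrite lerD2l le_eqVlt; apply/orP; left; apply/eqP.
rewrite -RintegralZl//; apply: ae_eq_Rintegral_any; apply: aeS rt => s r.
rewrite /adjoint_gap; have [ts|ts] := boolP (t <= s); last first.
  have ts' : ~~ (0 <= t <= s) by rewrite negb_and ts orbT.
  rewrite !big1 ?mulr0// => a _.
    rewrite (_ : beta a s = cst 0); last by apply/funext => z; rewrite /beta (negbTE ts).
    by rewrite diff_cst /= subrr !mul0r subrr.
  rewrite (admissible_causal (state_gap_admissible a))//.
  by rewrite (admissible_causal (derivative_gap_admissible a))// !mul0r subrr.
have ts' : 0 <= t <= s by rewrite t0.
have bE a : beta a s = coef b sigma a s t by apply/funext => z; rewrite /beta ts.
rewrite !mulr_sumr; apply: eq_bigr => a _.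
have [D DE dgE] : exists2 D : R,
    ('d (beta a s : V -> R^o) (Xh w t, uh w t) (X w t - Xh w t, 0) : R) = D &
    derivative_gap a (w, (t, s)) = discount_factor s * (expR (- (mu * s)) * D).
  exists ('d (coef b sigma a s t : V -> R^o) (Xh w t, uh w t) (X w t - Xh w t, 0) : R).
    by rewrite bE.
  exact: (derivative_gapE a w ts' (r ts')).
rewrite {}DE {}dgE (state_gapE a w ts' (r ts')) bE /p /p'.
have -> : e s = expR (lambda * t) * (discount_factor s * (expR (- (mu * s)) * expR (- (mu * s)))).
  by rewrite /e /discount_factor -!expRD; congr expR; ring.
have E : expR (- (mu * s)) * expR (mu * s) = 1 by rewrite -expRD addNr expR0.
set c := coef _ _ _ _ _ (X w t, _); set c' := coef _ _ _ _ _ (Xh w t, _).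
transitivity ((expR (- (mu * s)) * expR (mu * s)) * (expR (lambda * t) *
  (discount_factor s * (expR (- (mu * s)) * D) * (pE a (w, (t, s)) - pY a (w, (t, s))) -
   discount_factor s * (expR (- (mu * s)) * (c - c')) * pE a (w, (t, s))))).
  by rewrite E mul1r.
by ring.
Qed.

End pointwise.

(** * Taking expectations and integrating in time *)

Section comparison.
Variable h : R -> 'cV[R]_n -> 'cV[R]_l -> R.
Hypothesis hreg : cost_regular h.

Definition running_cost (x : T -> R -> 'cV[R]_n) (u : T -> R -> 'cV[R]_l) : T * mR -> R :=
  half_extension (fun w t => expR (- (lambda * t)) * h t (x w t) (u w t)).

Let fnorm_sqr m (x : 'cV[R]_m) : fnorm x ^+ 2 = \sum_i x i 0 ^+ 2.
Proof.
rewrite /fnorm sqr_sqrtr; last by apply: sumr_ge0 => i _; apply: sumr_ge0 => j _; exact: sqr_ge0.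
by apply: eq_bigr => i _; rewrite big_ord1.
Qed.

(** Quadratic growth of [h] meets [e^(- lambda t) <= e^(- 2 mu t)], which discounts each square
    twice by [mu]. *)
Lemma integrable_running_cost x u S S' : L2F P W (- mu) S x -> L2F P W (- mu) S' u ->
  intble P2 (running_cost x u).
Proof.
move=> Lx Lu; have [mh _ [C C0 hC]] := hreg.
have [[mx _ _ _] [mu' _ _ _]] := (Lx, Lu).
have mTh : measurable ([set: T] `*` (halfline : set mR)).
  by apply: measurableX => //; exact: measurable_halfline.
pose B (q : T * mR) := C * (discounted mu (fun=> fun=> 1) q ^+ 2 +
  \sum_i discounted mu (fun w t => x w t i 0) q ^+ 2 +
  \sum_i discounted mu (fun w t => u w t i 0) q ^+ 2).
have iB : intble P2 B.
  apply: integrableZR; apply: integrableDR; first apply: integrableDR.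
  - by have /sq_integrableP[] := sq_integrable_discount P (mu_gt0 hmu).
  - by apply: integrable_sumR => i; have /sq_integrableP[] := L2F_discounted i 0 Lx.
  - by apply: integrable_sumR => i; have /sq_integrableP[] := L2F_discounted i 0 Lu.
apply: ae_le_integrable iB _.
  apply: measurable_half_extension; apply: measurable_funM.
    apply: measurableT_comp => //; apply: measurableT_comp => //.
    by apply: measurable_funM => //; exact: measurable_funTS.
  apply: (@measurable_cost _ _ _ _ _ _ mTh (fun q => x q.1 q.2) (fun q => u q.1 q.2)) => //.
  - by move=> i; exact: mx.
  - by move=> i; exact: mu'.
  - exact: measurable_funTS.
  - by move=> q [_ q0]; rewrite -halflineE; apply/mem_set.
apply: aeS (@ae_prod_snd _ _ _ _ _ P leb _ hC) => -[w t] /= ht.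
rewrite /B /running_cost /discounted !half_extensionE.
under eq_bigr do rewrite half_extensionE.
under [X in _ + X]eq_bigr do rewrite half_extensionE.
have [t0|t0] := leP 0 t; last first.
  rewrite normr0; apply: mulr_ge0; first exact: ltW.
  by rewrite !addr_ge0 ?sqr_ge0//; apply: sumr_ge0 => i _; exact: sqr_ge0.
have [hb _ _] := ht t0 (x w t) (u w t).
rewrite normrM (ger0_norm (expR_ge0 _)).
under eq_bigr do rewrite exprMn.
under [X in _ + X]eq_bigr do rewrite exprMn.
rewrite -!mulr_sumr exprMn expr1n -!mulrDr -!fnorm_sqr mulrCA.
apply: ler_pM; rewrite ?expR_ge0//.
rewrite -expRM_natl ler_expR; have := ler_wpM2r t0 hlambda; lra.
Qed.

(** Integrability makes the costs finite, so that they can be subtracted. *)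
Lemma costE x u S S' : L2F P W (- mu) S x -> L2F P W (- mu) S' u ->
  cost P h lambda u x = (\int[P2]_q running_cost x u q)%:E.
Proof.
move=> Lx Lu; have ic := integrable_running_cost Lx Lu.
rewrite (EFin_Rintegral ic) -(integral12_prod_meas1 ic) /cost /fubini_F.
rewrite -[RHS]/(\int[P]_w \int[leb]_t (running_cost x u (w, t))%:E)%E.
apply: eq_integral => w _; rewrite integral_mkcond.
apply: eq_integral => t _; rewrite patchE halflineE /= /running_cost half_extensionE.
by case: ifP.
Qed.

Hypothesis adjoint : {ae leb, forall t, 0 <= t ->
  exists2 I, is_ito P W `[t, +oo[ (fun w s => Z w t s) I &
    {ae P, forall w, Y w t = grad (fun x => h t x (uh w t)) (Xh w t)
      + vint `[t, +oo[ (fun s => expR (- (lambda * (s - t))) *: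
          ((dmx (fun x => b s t x (uh w t)) (Xh w t))^T *m Y w s
           + \sum_k (dmx (fun x => col k (sigma s t x (uh w t))) (Xh w t))^T *m col k (Z w s t)))
      - I w}}.

Let H (w : T) (t : R) (x : 'cV[R]_n) (u : 'cV[R]_l) : R :=
  hamiltonian b sigma h lambda t x u (EY w t) (fun s => Z w s t).

Hypothesis Hconvex : {ae leb, forall t, 0 <= t -> {ae P, forall w,
  convex_function ([set: 'cV[R]_n] `*` U : set (convex_lmodType V)) (fun z => H w t z.1 z.2)}}.
Hypothesis Hmin : {ae leb, forall t, 0 <= t -> {ae P, forall w, forall u, U u ->
  0 <= dotv (grad (fun v => H w t (Xh w t) v) (uh w t)) (u - uh w t)}}.

Let state_term : field := fun q => \sum_a state_gap a q * pY a q.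

Let istate : intble P3 state_term.
Proof.
by apply: integrable_sumR => a; have [] := gap_exchange (state_gap_admissible a).
Qed.

Let adjoint_gapE : adjoint_gap = fun q => \sum_a
  (derivative_gap a q * pE a q - derivative_gap a q * pY a q - state_gap a q * pE a q).
Proof. by apply/funext => q; apply: eq_bigr => a _; rewrite mulrBr. Qed.

Let iadjoint : intble P3 adjoint_gap.
Proof.
rewrite adjoint_gapE; apply: integrable_sumR => a.
have [i1 i2 _] := gap_exchange (derivative_gap_admissible a).
have [_ i3 _] := gap_exchange (state_gap_admissible a).
by apply: integrableBR => //; exact: integrableBR.
Qed.

(** The exchange makes the derivative terms integrate to 0 and replaces E_t[Y(s)] by Y(s) next to
    the increments. *)
Let adjoint_state : \int[P3]_q adjoint_gap q = - \int[P3]_q state_term q.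
Proof.
rewrite adjoint_gapE /state_term.
have i1 a : intble P3 (fun q => derivative_gap a q * pY a q).
  by have [] := gap_exchange (derivative_gap_admissible a).
have i2 a : intble P3 (fun q => derivative_gap a q * pE a q).
  by have [] := gap_exchange (derivative_gap_admissible a).
have i3 a : intble P3 (fun q => state_gap a q * pE a q).
  by have [] := gap_exchange (state_gap_admissible a).
have i4 a : intble P3 (fun q => state_gap a q * pY a q).
  by have [] := gap_exchange (state_gap_admissible a).
rewrite !Rintegral_sum//; last first.
  by move=> a; apply: integrableBR => //; exact: integrableBR.
rewrite -sumrN; apply: eq_bigr => a _.
rewrite RintegralB//; last exact: integrableBR.
rewrite RintegralB//.
have [_ _ ->] := gap_exchange (derivative_gap_admissible a).
have [_ _ ->] := gap_exchange (state_gap_admissible a).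
by rewrite subrr sub0r.
Qed.

(** What the pointwise inequality requires at a fixed time and sample point: the majorant is itself
    admissible, so it pairs integrably with either dual. *)
Let ae_bound : {ae leb, forall t, {ae P, forall w, forall a,
  intble leb (fun s => gap_bound a (w, (t, s)) * pY a (w, (t, s))) /\
  intble leb (fun s => gap_bound a (w, (t, s)) * pE a (w, (t, s)))}}.
Proof.
have ab a : gap_admissible a (gap_bound a).
  exact: admissible_envelope ik1 sk2 k10 k20 sq_integrable_base base_ge0 adapted_base a.
have h1 a : {ae leb, forall t, {ae P, forall w,
    intble leb (fun s => gap_bound a (w, (t, s)) * pY a (w, (t, s))) /\
    intble leb (fun s => gap_bound a (w, (t, s)) * pE a (w, (t, s)))}}.
  have [i1 i2 _] := gap_exchange (ab a).
  apply: aeS (aeI (ae_integrable_time1 i1) (ae_integrable_time1 i2)) => t [it1 it2].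
  exact: (aeI (@ae_integrable_fst _ _ _ _ _ P leb _ it1)
    (@ae_integrable_fst _ _ _ _ _ P leb _ it2)).
by apply: aeS (ae_finite h1) => t ht; exact: ae_finite ht.
Qed.

(** Expectation of the pointwise inequality. In [state_term] the fixed time is the later one,
    through E <Y(t), dX(t)>; in [adjoint_gap] it is the earlier one. *)
Let expected_gap : {ae leb, forall t,
  \int[P2]_q state_term (q.1, (q.2, t)) + \int[P2]_q adjoint_gap (q.1, (t, q.2)) <=
  \int[P]_w (running_cost X v (w, t) - running_cost Xh uh (w, t))}.
Proof.
have sX := ae_finite (fun i => L2F_section i 0 LX).
have sXh := ae_finite (fun i => L2F_section i 0 LXh).
have sY := ae_finite (fun i => L2F_section i 0 LY).
have regs := ae_prod2 reg.
have [_ hC1 _] := hreg.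
have ic := ae_integrable_snd (integrable_running_cost LX Lv).
have ich := ae_integrable_snd (integrable_running_cost LXh Luh).
have iphi := ae_integrable_time1 iadjoint.
apply: aeS (aeI (aeI (aeI adjoint (aeI Hconvex Hmin)) (aeI ae_bound state_duality))
  (aeI (aeI sX (aeI sXh sY)) (aeI (aeI regs hC1) (aeI ic (aeI ich iphi))))).
move=> t [[[adj [Hc Hm]] [bd dual]] [[qX [qXh qY]] [[rs hc] [ict [icht iphit]]]]].
have [t0|t0] := leP 0 t; last first.
  rewrite !Rintegral0_eq ?addr0//.
  - by move=> w; rewrite /running_cost !half_extensionE leNgt t0 subrr.
  - move=> [w s]; rewrite /adjoint_gap big1// => a _.
    rewrite (admissible_causal (state_gap_admissible a)) ?leNgt ?t0//.
    by rewrite (admissible_causal (derivative_gap_admissible a)) ?leNgt ?t0// !mul0r subrr.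
  - move=> [w s]; rewrite /state_term big1// => a _ /=.
    rewrite (admissible_causal (state_gap_admissible a)) ?mul0r//.
    by apply/negP => /andP[s0 st]; move: t0; rewrite ltNge (le_trans s0 st).
have [I [J hJ IE] YE] := adj t0.
have [hd _] := hc t0.
pose D i w := X w t i 0 - Xh w t i 0.
have sD i : sq_integrable P (D i) by apply: sq_integrableB; [exact: qX|exact: qXh].
have sy i : sq_integrable P (fun w => Y w t i 0) by exact: qY.
have sJ i k : sq_integrable P (J i k) by have [] := ito_sq_integrable cP bm (hJ i k).
(* The integrand of I_t vanishes before [t], and X(t) - Xhat(t) is known at [t]. *)
have ID0 i k : \int[P]_w (D i w * J i k w) = 0.
  apply: (ito_orthogonal cP bm t0 (hJ i k)).
  - move=> w s /andP[_ st]; rewrite indicE mem_itvt leNgt st mulr0//.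
  - have [[_ aX _ _] [_ aXh _ _]] := (LX, LXh).
    apply/(meas_wrtP (Fs t)); apply: measurable_funB; apply/(meas_wrtP (Fs t)).
      exact: aX.
    exact: aXh.
  - exact: sq_integrable_mul.
have iYD : intble P (fun w => dotv (Y w t) (X w t - Xh w t)).
  rewrite (_ : (fun w => _) = fun w => \sum_i Y w t i 0 * D i w).
    by apply: integrable_sumR => i; exact: sq_integrable_mul.
  by apply/funext => w; apply: eq_bigr => i _; rewrite /D !mxE.
have IDE w : dotv (I w) (X w t - Xh w t) = \sum_i \sum_k D i w * J i k w.
  apply: eq_bigr => i _; rewrite IE !mxE mulrC mulr_sumr.
  by apply: eq_bigr => k _.
have iID : intble P (fun w => dotv (I w) (X w t - Xh w t)).
  under eq_fun do rewrite IDE.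
  by apply: integrable_sumR => i; apply: integrable_sumR => k; exact: sq_integrable_mul.
have ID : \int[P]_w dotv (I w) (X w t - Xh w t) = 0.
  under eq_Rintegral do rewrite IDE.
  rewrite Rintegral_sum; last first.
    by move=> i; apply: integrable_sumR => k; exact: sq_integrable_mul.
  apply: big1 => i _; rewrite Rintegral_sum; last by move=> k; exact: sq_integrable_mul.
  by apply: big1 => k _; exact: ID0.
rewrite -(dual t0).
have iphi1 := @integrable_Rintegral_snd _ _ _ _ _ P leb _ iphit.
rewrite -(@Rintegral_prod_fst _ _ _ _ _ P leb _ iphit).
(* The vanishing expectation of <I_t, X(t) - Xhat(t)> is inserted, because the pointwise inequality
   is stated for Y(t) + I_t. *)
rewrite -[X in X + _]addr0 -[X in _ + X + _](mulr0 (expR (- (lambda * t)))) -ID.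
rewrite -!RintegralZl//.
rewrite -RintegralD//; [|exact: integrableZR..].
rewrite -RintegralD//; last by apply: integrableDR; exact: integrableZR.
apply: ae_le_Rintegral.
- by apply: integrableDR => //; apply: integrableDR; exact: integrableZR.
- exact: integrableBR.
have iphiw := @ae_integrable_fst _ _ _ _ _ P leb _ iphit.
apply: aeS (aeI (aeI YE (aeI (Hc t0) (Hm t0))) (aeI bd iphiw)) => w [[Yw [cw mw]] [bw ipw]].
have [_ _ Uv _] := Lv; have [_ _ Uuh _] := Luh.
have rs' : {ae leb, forall s, 0 <= t <= s -> regular s t} by exact: rs.
have eE : Y w t + I w = grad (fun x => h t x (uh w t)) (Xh w t) +
  vint `[t, +oo[ (fun s => expR (- (lambda * (s - t))) *:
    ((dmx (fun x => b s t x (uh w t)) (Xh w t))^T *m Y w s +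
     \sum_k (dmx (fun x => col k (sigma s t x (uh w t))) (Xh w t))^T *m col k (Z w s t))).
  by rewrite Yw subrK.
have := pointwise_gap t0 rs' (hd _) (fun a => (bw a).1) (fun a => (bw a).2) eE cw
  (Uv w t t0) (Uuh w t t0) (mw _ (Uv w t t0)) ipw.
rewrite /running_cost !half_extensionE t0 -mulrBr => gap.
have := ler_wpM2l (expR_ge0 (- (lambda * t))) gap.
apply: le_trans; rewrite mulrDr mulrA -expRD addNr expR0 mul1r lerD2r -mulrDr.
rewrite ler_wpM2l ?expR_ge0// /dotv -big_split/=; apply: ler_sum => i _.
by rewrite !mxE mulrDl.
Qed.

(** Integrated in [t], both kinds of sections give integrals over all pairs of times, and these are
    opposite: the lower bound for the cost difference is 0. *)
Lemma cost_comparison : (cost P h lambda uh Xh <= cost P h lambda v X)%E.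
Proof.
have ic := integrable_running_cost LX Lv; have ich := integrable_running_cost LXh Luh.
rewrite (costE LX Lv) (costE LXh Luh) lee_fin -subr_ge0 -RintegralB//.
have icc := integrableBR ic ich.
rewrite -(@Rintegral_prod_snd _ _ _ _ _ P leb _ icc).
have e0 : \int[leb]_t (\int[P2]_q state_term (q.1, (q.2, t)) +
    \int[P2]_q adjoint_gap (q.1, (t, q.2))) = 0.
  have i1 := integrable_Rintegral_time2 istate; have i2 := integrable_Rintegral_time1 iadjoint.
  have := RintegralD measurableT i1 i2.
  by rewrite (Rintegral_time2 istate) (Rintegral_time1 iadjoint) adjoint_state subrr.
rewrite -e0; apply: ae_le_Rintegral.
- exact: integrableDR (integrable_Rintegral_time2 istate) (integrable_Rintegral_time1 iadjoint).
- exact: (@integrable_Rintegral_fst _ _ _ _ _ P leb _ icc).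
- exact: expected_gap.
Qed.

End comparison.

End gaps.

Theorem theorem4p5 (R : realType) (disp : measure_display)
    (T : measurableType disp) (P : probability T R)
    (n d l : nat) (W : T -> R -> 'cV[R]_d)
    (U : set 'cV[R]_l) (mu lambda : R)
    (phi : T -> R -> 'cV[R]_n)
    (b : R -> R -> 'cV[R]_n -> 'cV[R]_l -> 'cV[R]_n)
    (sigma : R -> R -> 'cV[R]_n -> 'cV[R]_l -> 'M[R]_(n, d))
    (h : R -> 'cV[R]_n -> 'cV[R]_l -> R)
    (Kbx Kbu Ksx Ksu : R -> R)
    (uhat : T -> R -> 'cV[R]_l) (Xhat : T -> R -> 'cV[R]_n)
    (Yhat : T -> R -> 'cV[R]_n) (Zhat : T -> R -> R -> 'M[R]_(n, d))
    (EYhat : T -> R -> R -> 'cV[R]_n) :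
  measure_is_complete P ->
  brownian_motion P W ->
  convex_body U ->
  assumptionC P W phi b sigma h mu Kbx Kbu Ksx Ksu ->
  (rho_bsigma Kbx Kbu Ksx Ksu < mu%:E)%E ->
  2 * mu <= lambda ->
  L2F P W (- mu) U uhat ->
  is_state P W phi b sigma mu uhat Xhat ->
  adjoint_solution P W b sigma h mu lambda uhat Xhat Yhat Zhat ->
  condexp_field P W Yhat EYhat ->
  let H w t x u :=
    hamiltonian b sigma h lambda t x u (EYhat w t) (fun s => Zhat w s t) in
  {ae (@lebesgue_measure R), forall t, 0 <= t -> {ae P, forall w,
     convex_function
       ([set: 'cV[R]_n] `*` U : set (convex_lmodType ('cV[R]_n * 'cV[R]_l)%type))
       (fun z => H w t z.1 z.2)}} ->
  {ae (@lebesgue_measure R), forall t, 0 <= t -> {ae P, forall w,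
     forall u, U u ->
       0 <= dotv (grad (fun v => H w t (Xhat w t) v) (uhat w t))
                 (u - uhat w t)}} ->
  optimal P W phi b sigma h mu lambda U uhat Xhat.
Proof.
move=> cP bm _ hC hmu hlambda Luh SXh hadj cEY H Hconvex Hmin.
have [Lphi [Lbx Lbu Lsx Lsu] cb cs hreg] := hC.
have reg := regular_ae cb cs Lbx Lbu Lsx Lsu.
have [mb _] := cb; have [ms _] := cs.
have [MYZ adjoint] := hadj; have [LXh _] := SXh.
(* [uhat] is itself a competitor, so the infimum is at most its cost; the converse is the comparison
   with every other control. *)
apply/eqP; rewrite eq_le; apply/andP; split; last first.
  by apply: ereal_inf_lbound; exists uhat, Xhat.
apply: le_ereal_inf_tmp => _ [v [X [Lv SX ->]]]; have [LX _] := SX.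
exact: (cost_comparison cP bm mb ms Lbx Lbu Lsx Lsu hmu hlambda LX LXh Lv Luh
  reg MYZ cEY SX SXh hreg adjoint Hconvex Hmin).
Qed.
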